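(* There exist 4-regular planar unit-distance graphs consisting only of unit triangles without additional triangles, and the smallest number of unit triangles in such a graph is at most $6422$. Explicitly: there exist a finite nonempty set $V\subset\mathbb{R}^2$, a set $E$ of closed segments with endpoints in $V$, and a set $T$ of unit triangles with $|T|\le 6422$ such that $(V,E,T)$ is a 4-regular planar unit-distance graph consisting only of unit triangles without additional triangles.
   Context: Definitions. All objects lie in the Euclidean plane $\mathbb{R}^2$. A unit triangle is a (closed, solid) equilateral triangle of side length $1$. A planar unit-distance graph is given by a finite nonempty set $V\subset\mathbb{R}^2$ of points (vertices) and a set $E$ of straight closed segments (edges), each of length exactly $1$ and joining two points of $V$, such that two distinct edges meet, if at all, only in a common endpoint, and no vertex lies in the relative interior of an edge. (Thus the drawing with straight unit edges is itself crossing-free, and vertices do not lie on other edges. It is not required that every two vertices at distance $1$ are joined by an edge.) The graph is 4-regular if every vertex is an endpoint of exactly four edges. The graph consists only of unit triangles, with $T$ as its set of unit triangles, if $T$ is a finite set of unit triangles that are non-overlapping and arranged vertex-to-vertex, meaning: any two distinct triangles of $T$ have disjoint interiors and intersect, if at all, only in common corners; $V$ is the set of all corners of triangles in $T$; and $E$ is the set of all sides of triangles in $T$. Thus each edge is a side of exactly one triangle of $T$, and 4-regularity means that each vertex is a corner of exactly two triangles of $T$. The number of unit triangles of the graph is $|T|$. An additional triangle is a nondegenerate triangle in the plane whose boundary is a union of edges of the graph (a side of it may be composed of several collinear edges) and which is not one of the unit triangles in $T$. For example, an equilateral triangle of side length $2$ formed by three triangles of $T$ placed at its three corners is an additional triangle.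 The graph is without additional triangles if no such triangle occurs. *)

(* Defs.v *)
From HB Require Import structures.
From mathcomp Require Import all_boot all_order all_algebra.
From mathcomp Require Import all_classical all_reals all_analysis.

Set Implicit Arguments.
Unset Strict Implicit.
Unset Printing Implicit Defensive.

Import Order.TTheory GRing.Theory Num.Theory.
Import numFieldNormedType.Exports.

Local Open Scope classical_set_scope.
Local Open Scope card_scope.
Local Open Scope ring_scope.

Notation plane R := (R * R)%type.

(* The norm that the library puts on R * R is the sup norm, so the Euclidean
   distance is written out.  The two norms induce the same topology, hence
   `interior` below is the usual interior in the Euclidean plane. *)
Definition edist (R : realType) (p q : plane R) : R :=
  Num.sqrt ((p.1 - q.1) ^+ 2 + (p.2 - q.2) ^+ 2).

Definition segment (R : realType) (p q : plane R) : set (plane R) :=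
  [set x | exists t : R, [/\ 0 <= t, t <= 1 & x = (1 - t) *: p + t *: q]].

Definition open_segment (R : realType) (p q : plane R) : set (plane R) :=
  [set x | exists t : R, [/\ 0 < t, t < 1 & x = (1 - t) *: p + t *: q]].

Definition endpoint (R : realType) (p : plane R) (e : set (plane R)) : Prop :=
  exists q : plane R, e = segment p q.

Definition triangle (R : realType) (a b c : plane R) : set (plane R) :=
  [set x | exists u v w : R,
     [/\ 0 <= u, 0 <= v, 0 <= w, u + v + w = 1
       & x = u *: a + v *: b + w *: c]].

Definition triangle_boundary (R : realType) (a b c : plane R) : set (plane R) :=
  segment a b `|` segment b c `|` segment c a.

(* Twice the signed area of abc is nonzero. *)
Definition nondegenerate (R : realType) (a b c : plane R) : Prop :=
  (b.1 - a.1) * (c.2 - a.2) - (b.2 - a.2) * (c.1 - a.1) != 0.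

Definition unit_equilateral (R : realType) (a b c : plane R) : Prop :=
  [/\ edist a b = 1, edist b c = 1 & edist c a = 1].

Definition unit_triangle (R : realType) (t : set (plane R)) : Prop :=
  exists a b c : plane R, unit_equilateral a b c /\ t = triangle a b c.

(* Corners and sides are read off the solid triangle.  Requiring abc to be
   unit equilateral makes them unambiguous: the point set determines {a, b, c}. *)
Definition corner (R : realType) (p : plane R) (t : set (plane R)) : Prop :=
  exists b c : plane R, unit_equilateral p b c /\ t = triangle p b c.

Definition side (R : realType) (e t : set (plane R)) : Prop :=
  exists a b c : plane R,
    [/\ unit_equilateral a b c, t = triangle a b c & e = segment a b].

Definition planar_unit_distance_graph (R : realType)
    (V : set (plane R)) (E : set (set (plane R))) : Prop :=
  [/\ finite_set V,
      V !=set0,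
      forall e, E e ->
        exists p q, [/\ V p, V q, edist p q = 1 & e = segment p q],
      forall e f, E e -> E f -> e <> f ->
        forall x, e x -> f x -> endpoint x e /\ endpoint x f
    & forall v p q, V v -> E (segment p q) -> ~ open_segment p q v].

Definition four_regular (R : realType)
    (V : set (plane R)) (E : set (set (plane R))) : Prop :=
  forall v, V v -> [set e | E e /\ endpoint v e] #= `I_4.

Definition consists_of_unit_triangles (R : realType)
    (V : set (plane R)) (E T : set (set (plane R))) : Prop :=
  [/\ finite_set T,
      forall t, T t -> unit_triangle t,
      forall s t, T s -> T t -> s <> t ->
        interior s `&` interior t = set0 /\
        (forall x, s x -> t x -> corner x s /\ corner x t),
      V = [set p | exists2 t, T t & corner p t]
    & E = [set e | exists2 t, T t & side e t]].

Definition additional_triangle (R : realType)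
    (E T : set (set (plane R))) (a b c : plane R) : Prop :=
  [/\ nondegenerate a b c,
      exists2 F : set (set (plane R)),
        F `<=` E & triangle_boundary a b c = \bigcup_(e in F) e
    & ~ T (triangle a b c)].

Definition without_additional_triangles (R : realType)
    (E T : set (set (plane R))) : Prop :=
  forall a b c : plane R, ~ additional_triangle E T a b c.

(* Main.v *)
(* The graph has the symmetry of a regular 145-gon.  The mirror lines of the dihedral group
   of order 290 cut the plane into 290 congruent sectors, and the graph consists of the
   290 images of 22 unit triangles lying in one sector; a corner of these 22 triangles
   that is not shared with another of them lies on a mirror, where it is shared with the
   reflected triangle.  No three of the 6380 triangles touch pairwise, and no edge is
   continued in a straight line through a corner, so that the only triangles bounded by
   edges are the unit triangles.

   The 22 triangles are constructed with ruler and compass from one free point (x, y),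
   starting from z = exp (i pi / 145), and they close up if two of the constructed points
   coincide.  This is a system of two equations in x and y; interval arithmetic that also
   propagates difference quotients shows that a Newton step with a fixed matrix is a
   contraction of a tiny box, and the fixed point is the solution.  The resulting
   enclosures of all corners also show that the triangles do not overlap. *)

From Stdlib Require Import ZArith.
From HB Require Import structures.
From mathcomp Require Import all_boot all_order all_algebra.
From mathcomp Require Import all_classical all_reals all_analysis.
From mathcomp Require Import ring lra zify ssrZ.
Require Import Defs.

Set Implicit Arguments.
Unset Strict Implicit.
Unset Printing Implicit Defensive.

Import Order.TTheory GRing.Theory Num.Theory.
Import numFieldNormedType.Exports.

Local Open Scope classical_set_scope.
Local Open Scope card_scope.
Local Open Scope ring_scope.
Delimit Scope Z_scope with coqZ.

(** * Segments and unit triangles *)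

Section Segments.
Variable R : realType.
Implicit Types (p q a b c x y : plane R) (t : R).

(** Enclosures can prove strict inequalities only, and this shapes the proof. Every equality has to
    come from the construction: unit lengths from the kind of step, incidence with a mirror from
    being a foot on it, shared corners from equal indices, and one last coincidence from the fixed
    point. What remains, that triangles do not overlap and that edges are not continued, consists of
    open conditions, which survive the errors of the approximation.

    The geometry is reduced to a finite table that gives each corner one partner: a corner of
    another triangle, or a mirror. A side of an additional triangle is a union of edges; two that
    follow each other on it would be opposite at their common end, so the side is a single edge.
    Three such edges belong to one triangle of [T] or to three that touch pairwise.

    Difference quotients replace derivatives because they obey exact algebraic rules, so that the
    contraction property needs no calculus. *)

Definition sqd p q : R := (p.1 - q.1) ^+ 2 + (p.2 - q.2) ^+ 2.

Lemma sqdC p q : sqd p q = sqd q p.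
Proof. by rewrite /sqd; ring. Qed.

Lemma sqd_ge0 p q : 0 <= sqd p q.
Proof. by rewrite /sqd addr_ge0 // sqr_ge0. Qed.

Lemma edist1 p q : (edist p q = 1) <-> (sqd p q = 1).
Proof.
rewrite /edist -/(sqd p q); split=> [h|->]; last by rewrite sqrtr1.
by rewrite -(sqr_sqrtr (sqd_ge0 p q)) h expr1n.
Qed.

Lemma sqd1_neq p q : sqd p q = 1 -> p <> q.
Proof.
by move=> h pq; move: h; rewrite pq /sqd !subrr expr0n addr0 => /eqP; rewrite eq_sym oner_eq0.
Qed.

Definition comb t p q : plane R := (1 - t) *: p + t *: q.

Lemma combE t p q :
  comb t p q = ((1 - t) * p.1 + t * q.1, (1 - t) * p.2 + t * q.2).
Proof. by []. Qed.

Lemma plane_eq p q : p.1 = q.1 -> p.2 = q.2 -> p = q.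
Proof. by case: p q => [? ?] [? ?] /= -> ->. Qed.

Lemma comb0 p q : comb 0 p q = p.
Proof. by rewrite combE; apply: plane_eq => /=; ring. Qed.

Lemma comb1 p q : comb 1 p q = q.
Proof. by rewrite combE; apply: plane_eq => /=; ring. Qed.

Lemma comb_inj p q t u : p <> q -> comb t p q = comb u p q -> t = u.
Proof.
move=> pq; rewrite !combE => -[h1 h2]; apply/eqP; apply: contra_notT pq => tu.
have tu0 : t - u != 0 by rewrite subr_eq0.
apply: plane_eq; apply/eqP; rewrite -subr_eq0 -(mulrI_eq0 _ (mulfI tu0)); apply/eqP; lra.
Qed.

Lemma segmentC p q : segment p q = segment q p.
Proof.
by apply/seteqP; split=> x /= [t [t0 t1 ->]]; exists (1 - t);
  split; rewrite ?subr_ge0 ?lerBlDr ?lerDl // -!/(comb _ _ _) !combE;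
  apply: plane_eq => /=; ring.
Qed.

Lemma segment_l p q : segment p q p.
Proof. by exists 0; split=> //; rewrite -/(comb _ _ _) comb0. Qed.

Lemma segment_r p q : segment p q q.
Proof. by exists 1; split=> //; rewrite -/(comb _ _ _) comb1. Qed.

(** An endpoint is an extreme point: writing [a] through [p] and [q], and these through [a] and [b],
    makes a sum of two nonnegative terms vanish. *)
Lemma segment_extremal_l a b p q : a <> b ->
  segment p q a -> segment a b p -> segment a b q -> a = p \/ a = q.
Proof.
move=> ab [s [s0 s1 ha]] [t [t0 t1 hp]] [u [u0 u1 hq]].
have h : (1 - s) * t + s * u = 0.
  apply: (comb_inj ab); rewrite comb0 [RHS]ha hp hq -!/(comb _ _ _) !combE.
  by apply: plane_eq => /=; ring.
have /eqP : (1 - s) * t == 0.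
  have := mulr_ge0 s0 u0; have : 0 <= (1 - s) * t by rewrite mulr_ge0 ?subr_ge0.
  by move=> ? ?; apply/eqP; lra.
move/eqP; rewrite mulf_eq0 subr_eq0 => /orP[/eqP s1e|/eqP t0e].
  right; have u0e : u = 0 by move: h; rewrite -s1e subrr mul0r add0r mul1r.
  by rewrite hq u0e -/(comb _ _ _) comb0.
by left; rewrite hp t0e -/(comb _ _ _) comb0.
Qed.

(** Edges are bare point sets, and this is how their endpoints are recovered. *)
Lemma segment_inj a b p q : a <> b -> segment a b = segment p q ->
  (a = p /\ b = q) \/ (a = q /\ b = p).
Proof.
move=> ab e.
have pa : segment a b p by rewrite e; exact: segment_l.
have qa : segment a b q by rewrite e; exact: segment_r.
have ap : segment p q a by rewrite -e; exact: segment_l.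
have bp : segment p q b by rewrite -e; exact: segment_r.
have [ea|ea] := segment_extremal_l ab ap pa qa;
have [eb|eb] := segment_extremal_l (nesym ab) bp
  (eq_ind _ (fun S : set _ => S p) pa _ (segmentC a b)) (eq_ind _ (fun S : set _ => S q) qa _ (segmentC a b));
  try (by left); try (by right); by case: ab; rewrite ea eb.
Qed.

Lemma segment_injr a b c : a <> b -> segment a b = segment a c -> b = c.
Proof. by move=> ab /(segment_inj ab)[[_ ->]//|[<- //]] ba; case: ab. Qed.

Lemma endpoint_segment a b p : a <> b -> endpoint p (segment a b) -> p = a \/ p = b.
Proof. by move=> ab [q /(segment_inj ab)[[-> _]|[_ ->]]]; [left|right]. Qed.

Lemma endpoint_l a b : endpoint a (segment a b).
Proof. by exists b. Qed.

Lemma endpoint_r a b : endpoint b (segment a b).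
Proof. by exists a; exact: segmentC. Qed.

Lemma open_segmentE a b p q x : a <> b -> segment a b = segment p q ->
  open_segment p q x -> open_segment a b x.
Proof.
move=> ab /(segment_inj ab)[[-> ->]//|[-> ->]] [t [t0 t1 ->]].
by exists (1 - t); split; rewrite ?subr_gt0 ?ltrBlDr ?ltrDl // -!/(comb _ _ _) !combE;
  apply: plane_eq => /=; ring.
Qed.

End Segments.

Section Triangles.
Variable R : realType.
Implicit Types (p q a b c x y : plane R) (t u v w : R).

Definition unit3 a b c := [/\ sqd a b = 1, sqd b c = 1 & sqd c a = 1].

Lemma unit_equilateralE a b c : unit_equilateral a b c <-> unit3 a b c.
Proof. by split=> -[/edist1 ? /edist1 ? /edist1 ?]. Qed.

Definition bary u v w a b c : plane R := u *: a + v *: b + w *: c.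

Lemma baryE u v w a b c : bary u v w a b c =
  (u * a.1 + v * b.1 + w * c.1, u * a.2 + v * b.2 + w * c.2).
Proof. by []. Qed.

Lemma triangle_rot a b c : triangle a b c = triangle b c a.
Proof.
by apply/seteqP; split=> x [u [v [w [u0 v0 w0 s ->]]]];
  [exists v, w, u | exists w, u, v]; 
  (split=> //; [lra|rewrite -!/(bary _ _ _ _ _ _) !baryE; apply: plane_eq => /=; ring]).
Qed.

Lemma triangle_swap a b c : triangle a b c = triangle b a c.
Proof.
by apply/seteqP; split=> x [u [v [w [u0 v0 w0 s ->]]]];
  exists v, u, w; 
  (split=> //; [lra|rewrite -!/(bary _ _ _ _ _ _) !baryE; apply: plane_eq => /=; ring]).
Qed.

Lemma triangle_l a b c : triangle a b c a.
Proof.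
exists 1, 0, 0; split=> //; first by rewrite !addr0.
by rewrite -/(bary _ _ _ _ _ _) baryE; apply: plane_eq => /=; ring.
Qed.

Lemma triangle_seg a b c x : segment a b x -> triangle a b c x.
Proof.
move=> [t [t0 t1 ->]]; exists (1 - t), t, 0; split; rewrite ?subr_ge0 //; first by lra.
by rewrite -/(bary _ _ _ _ _ _) -/(comb _ _ _) combE baryE; apply: plane_eq => /=; ring.
Qed.

(* For the side lengths 1 the squared distance of two points of the plane spanned
   by a triangle is half the squared distance of their barycentric coordinates,
   so only distinct corners are at distance 1. *)
Lemma sqd_bary a b c u v w u' v' w' : unit3 a b c ->
  u + v + w = 1 -> u' + v' + w' = 1 ->
  sqd (bary u v w a b c) (bary u' v' w' a b c) *+ 2 =
    (u - u') ^+ 2 + (v - v') ^+ 2 + (w - w') ^+ 2.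
Proof.
move=> [ab bc ca] s s'.
have -> : u = 1 - v - w by lra.
have -> : u' = 1 - v' - w' by lra.
have e d1 d2 d3 : d1 + d2 + d3 = 0 ->
    (d1 * a.1 + d2 * b.1 + d3 * c.1) ^+ 2 + (d1 * a.2 + d2 * b.2 + d3 * c.2) ^+ 2
      = - (d1 * d2 + d2 * d3 + d3 * d1).
  move=> d0; have -> : d1 = - d2 - d3 by lra.
  transitivity (- ((- d2 - d3) * d2 * sqd a b + d2 * d3 * sqd b c
                   + d3 * (- d2 - d3) * sqd c a)); first by rewrite /sqd; ring.
  by rewrite ab bc ca !mulr1.
have -> : sqd (bary (1 - v - w) v w a b c) (bary (1 - v' - w') v' w' a b c) =
    - ((- (v - v') - (w - w')) * (v - v') + (v - v') * (w - w')
       + (w - w') * (- (v - v') - (w - w'))).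
  rewrite -(e (- (v - v') - (w - w')) (v - v') (w - w')); last by ring.
  by rewrite /sqd !baryE /=; ring.
by ring.
Qed.

(** Squaring [u + v + w = 1] leaves no room for the mixed products, so at most one coordinate is
    nonzero. *)
Lemma simplex_vertex u v w : 0 <= u -> 0 <= v -> 0 <= w -> u + v + w = 1 ->
  1 <= u ^+ 2 + v ^+ 2 + w ^+ 2 -> [\/ u = 1, v = 1 | w = 1].
Proof.
move=> u0 v0 w0 s h.
have uv := mulr_ge0 u0 v0; have vw := mulr_ge0 v0 w0; have uw := mulr_ge0 u0 w0.
have h2 : (u + v + w) ^+ 2 = 1 by rewrite s expr1n.
have uv0 : u * v = 0 by nra.
have vw0 : v * w = 0 by nra.
have uw0 : u * w = 0 by nra.
move/eqP: uv0; rewrite mulf_eq0 => /orP[/eqP u0e|/eqP v0e].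
  move/eqP: vw0; rewrite mulf_eq0 => /orP[/eqP v0e|/eqP w0e].
    by constructor 3; lra.
  by constructor 2; lra.
move/eqP: uw0; rewrite mulf_eq0 => /orP[/eqP u0e|/eqP w0e].
  by constructor 3; lra.
by constructor 1; lra.
Qed.

(** In barycentric coordinates, distance 1 means that the squared differences add up to 2. The mixed
    products are nonnegative and each sum of squares is at most 1, so the sum of squares for [x] is
    1. *)
Lemma triangle_diam a b c x y : unit3 a b c ->
  triangle a b c x -> triangle a b c y -> sqd x y = 1 ->
  [\/ x = a, x = b | x = c].
Proof.
move=> abc [u [v [w [u0 v0 w0 s ->]]]] [u' [v' [w' [u0' v0' w0' s' ->]]]] h.
have := sqd_bary abc s s'; rewrite [sqd _ _]h => e.
have [uu vv ww] : [/\ 0 <= u * u', 0 <= v * v' & 0 <= w * w'] by split; exact: mulr_ge0.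
have le1 u1 v1 w1 : 0 <= u1 -> 0 <= v1 -> 0 <= w1 -> u1 + v1 + w1 = 1 ->
    u1 ^+ 2 + v1 ^+ 2 + w1 ^+ 2 <= 1.
  move=> ? ? ? e1; have <- : (u1 + v1 + w1) ^+ 2 = 1 by rewrite e1 expr1n.
  by nra.
have := le1 _ _ _ u0' v0' w0' s'; move=> hl.
have : 1 <= u ^+ 2 + v ^+ 2 + w ^+ 2 by nra.
move=> /(simplex_vertex u0 v0 w0 s)[e1|e1|e1]; [constructor 1|constructor 2|constructor 3];
  rewrite -/(bary _ _ _ _ _ _).
- have v00 : v = 0 by lra. have w00 : w = 0 by lra.
  by rewrite e1 v00 w00 baryE; apply: plane_eq => /=; ring.
- have v00 : u = 0 by lra. have w00 : w = 0 by lra.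
  by rewrite e1 v00 w00 baryE; apply: plane_eq => /=; ring.
- have v00 : u = 0 by lra. have w00 : v = 0 by lra.
  by rewrite e1 v00 w00 baryE; apply: plane_eq => /=; ring.
Qed.

(** In any presentation of the triangle, another corner is at distance 1 from [p], so
    [triangle_diam] applies. *)
Lemma corner_triangle a b c p : unit3 a b c ->
  corner p (triangle a b c) <-> [\/ p = a, p = b | p = c].
Proof.
move=> abc; split=> [[b' [c' [/unit_equilateralE[pb bc cp] e]]]|].
  apply: (@triangle_diam a b c p b' abc _ _ pb); rewrite e; first exact: triangle_l.
  by rewrite triangle_rot; exact: triangle_l.
case: abc => ab bc ca [->|->|->].
- by exists b, c; split=> //; apply/unit_equilateralE.
- by exists c, a; split; [exact/unit_equilateralE|exact: triangle_rot].
- exists a, b; split; first exact/unit_equilateralE.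
  by rewrite triangle_rot triangle_rot.
Qed.

Lemma side_triangle a b c e : unit3 a b c ->
  side e (triangle a b c) <->
  [\/ e = segment a b, e = segment b c | e = segment c a].
Proof.
move=> abc; have [ab bc ca] := abc.
split=> [[p [q [r [/unit_equilateralE pqr et ->]]]]|[->|->|->]]; first last.
- exists c, a, b; split=> //; first exact/unit_equilateralE.
  by rewrite triangle_rot triangle_rot.
- by exists b, c, a; split=> //; [exact/unit_equilateralE|exact: triangle_rot].
- by exists a, b, c; split=> //; exact/unit_equilateralE.
have [pq _ _] := pqr.
have /(corner_triangle p abc) : corner p (triangle a b c).
  by rewrite et; apply/(corner_triangle _ pqr); constructor 1.
have /(corner_triangle q abc) : corner q (triangle a b c).
  by rewrite et; apply/(corner_triangle _ pqr); constructor 2.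
have := sqd1_neq pq.
move=> npq [qe|qe|qe] [pe|pe|pe]; try (by case: npq; rewrite pe qe); rewrite pe qe.
- by constructor 1; exact: segmentC.
- by constructor 3.
- by constructor 1.
- by constructor 2; exact: segmentC.
- by constructor 3; exact: segmentC.
- by constructor 2.
Qed.

Lemma unit3_rot a b c : unit3 a b c -> unit3 b c a.
Proof. by case. Qed.

Lemma bary_inj a b c u v w u' v' w' : unit3 a b c ->
  u + v + w = 1 -> u' + v' + w' = 1 ->
  bary u v w a b c = bary u' v' w' a b c -> [/\ u = u', v = v' & w = w'].
Proof.
move=> abc s s' e; have := sqd_bary abc s s'.
rewrite e /sqd !subrr expr0n /= addr0 mul0rn => /esym/eqP.
have := sqr_ge0 (u - u'); have := sqr_ge0 (v - v'); have := sqr_ge0 (w - w').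
move=> h1 h2 h3 /eqP h.
have z (x : R) : 0 <= x ^+ 2 -> x ^+ 2 <= 0 -> x = 0.
  by move=> x0 x1; apply/eqP; rewrite -sqrf_eq0 eq_le x0 x1.
by split; apply/eqP; rewrite -subr_eq0; apply/eqP; apply: z; lra.
Qed.

Lemma segment_bary a b c x : segment a b x ->
  exists t, [/\ 0 <= t, t <= 1 & x = bary (1 - t) t 0 a b c].
Proof.
move=> [t [t0 t1 ->]]; exists t; split=> //.
by rewrite -/(comb _ _ _) combE baryE; apply: plane_eq => /=; ring.
Qed.

Lemma segment_meet a b c x : unit3 a b c ->
  segment a b x -> segment a c x -> x = a.
Proof.
move=> abc /(segment_bary c)[t [t0 t1 ->]] [u [u0 u1]].
have -> : (1 - u) *: a + u *: c = bary (1 - u) 0 u a b c.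
  by rewrite -/(comb _ _ _) combE baryE; apply: plane_eq => /=; ring.
move=> e; have [||_ te _] := bary_inj abc _ _ e; [by ring|by ring|].
by rewrite te baryE; apply: plane_eq => /=; ring.
Qed.

Lemma corner_segment a b c : unit3 a b c -> ~ segment a b c.
Proof.
move=> abc /(segment_bary c)[t [t0 t1]].
have {1}-> : c = bary 0 0 1 a b c by rewrite baryE; apply: plane_eq => /=; ring.
move=> e; have [||_ _ /eqP] := bary_inj abc _ _ e; [by ring|by ring|].
by rewrite oner_eq0.
Qed.

Lemma open_segment_corner a b c x : unit3 a b c -> open_segment a b x ->
  ~ [\/ x = a, x = b | x = c].
Proof.
move=> abc xo; have [ab _ _] := abc.
have xs : segment a b x by case: xo => t [t0 t1 ->]; exists t; split=> //; exact: ltW.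
move: (xo) => [t [t0 t1 xe]] [xa|xb|xc].
- have : comb t a b = comb 0 a b by rewrite comb0 /comb -xe.
  by move/(comb_inj (sqd1_neq ab)) => te; rewrite te ltxx in t0.
- have : comb t a b = comb 1 a b by rewrite comb1 /comb -xe.
  by move/(comb_inj (sqd1_neq ab)) => te; rewrite te ltxx in t1.
- by apply: (corner_segment abc); rewrite -xc.
Qed.

Lemma unit3_perm a b c : unit3 a b c -> unit3 b a c.
Proof. by case=> ab bc ca; split; rewrite sqdC. Qed.

End Triangles.

(** * Segments near a point of a line *)

Section Germs.
Variable R : realType.
Implicit Types (p q a b c x y : plane R) (t : R).

(** If the ray from [a] hits the segment twice, it runs along the line [p p'], where the position
    depends affinely on [t] and starts outside the segment. With at most one hit, any bound before
    it will do. *)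
Lemma segment_germ p p' a b : p <> p' -> ~ segment p p' a ->
  exists2 d : R, 0 < d & forall t, 0 < t -> t < d -> ~ segment p p' (comb t a b).
Proof.
move=> pp na.
have [[t1 [t10 [s1 [s10 s11 e1]]]]|no] :=
  pselect (exists t, 0 < t /\ segment p p' (comb t a b)); last first.
  by exists 1 => // t t0 _ h; apply: no; exists t.
have [[t2 [t20 t21 [s2 [s20 s21 e2]]]]|no] :=
  pselect (exists t, [/\ 0 < t, t < t1 & segment p p' (comb t a b)]); last first.
  by exists t1 => // t t0 tt1 h; apply: no; exists t.
have t12 : t1 - t2 != 0 by rewrite subr_eq0 gt_eqF.
(* The position of [a] on the line [p p'], extrapolated from the two hits to [t = 0]. *)
pose la := (t1 * s2 - t2 * s1) / (t1 - t2).
have ae : a = comb la p p'.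
  move: e1 e2; rewrite -!/(comb _ _ _) !combE => -[x1 y1] [x2 y2].
  apply: plane_eq => /=; apply: (mulfI t12).
    transitivity (t1 * ((1 - t2) * a.1 + t2 * b.1) - t2 * ((1 - t1) * a.1 + t1 * b.1)); first by ring.
    by rewrite x1 x2 /la; field.
  transitivity (t1 * ((1 - t2) * a.2 + t2 * b.2) - t2 * ((1 - t1) * a.2 + t1 * b.2)); first by ring.
  by rewrite y1 y2 /la; field.
have key t s : comb t a b = comb s p p' -> t1 * s = t1 * la + t * (s1 - la).
  move=> e; apply: (comb_inj pp).
  have : comb t1 a b = comb s1 p p' by rewrite e1.
  move: e; rewrite {1 2}ae !combE /= => -[x y] [x1 y1].
  apply: plane_eq => /=.
    transitivity (p.1 + t1 * (((1 - s) * p.1 + s * p'.1) - p.1)); first by ring.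
    rewrite -x; transitivity (p.1 + t1 * (((1 - la) * p.1 + la * p'.1) - p.1) + t *
      (((1 - t1) * ((1 - la) * p.1 + la * p'.1) + t1 * b.1) - ((1 - la) * p.1 + la * p'.1))); first by ring.
    by rewrite x1; ring.
  transitivity (p.2 + t1 * (((1 - s) * p.2 + s * p'.2) - p.2)); first by ring.
  rewrite -y; transitivity (p.2 + t1 * (((1 - la) * p.2 + la * p'.2) - p.2) + t *
    (((1 - t1) * ((1 - la) * p.2 + la * p'.2) + t1 * b.2) - ((1 - la) * p.2 + la * p'.2))); first by ring.
  by rewrite y1; ring.
have [l0|l0] := ltP la 0.
  have dl : 0 < s1 - la by lra.
  (* The value of [t] at which the affine position [s] reaches 0. *)
  exists (t1 * (- la) / (s1 - la)); first by rewrite divr_gt0 // mulr_gt0 // oppr_gt0.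
  move=> t t0; rewrite ltr_pdivlMr // => td [s [s0 _ /key h]].
  have : 0 <= t1 * s by rewrite mulr_ge0 // ltW.
  by rewrite h; lra.
have [l1|l1] := ltP 1 la.
  have dl : 0 < la - s1 by lra.
  exists (t1 * (la - 1) / (la - s1)); first by rewrite divr_gt0 // mulr_gt0 // subr_gt0.
  move=> t t0; rewrite ltr_pdivlMr // => td [s [_ s0 /key h]].
  have : t1 * s <= t1 * 1 by rewrite ler_wpM2l // ltW.
  by rewrite h; lra.
by case: na; exists la; split.
Qed.

Lemma segments_germ (J : eqType) (s : seq J) (p p' : J -> plane R) a b :
  (forall j, j \in s -> p j <> p' j) ->
  exists2 d : R, 0 < d & forall t, 0 < t -> t < d -> forall j, j \in s ->
    segment (p j) (p' j) (comb t a b) -> segment (p j) (p' j) a.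
Proof.
elim: s => [_|j s IH pp]; first by exists 1.
have [k ks|d d0 h] := IH; first by apply: pp; rewrite inE ks orbT.
have [aj|naj] := pselect (segment (p j) (p' j) a).
  by exists d => // t t0 td k; rewrite inE => /orP[/eqP -> //|ks]; exact: h.
have [d' d'0 h'] := segment_germ b (pp j (mem_head j s)) naj.
exists (Order.min d d'); first by rewrite lt_min d0.
move=> t t0; rewrite lt_min => /andP[td td'] k; rewrite inE => /orP[/eqP ->|ks]; last exact: h.
by move/(h' _ t0 td').
Qed.

(** The signed area over the base [a b] is [w] times that of the triangle, so [w = 0] on the line
    [a b]. *)
Lemma triangle_line a b c t : nondegenerate a b c ->
  triangle a b c (comb t a b) -> 0 <= t <= 1.
Proof.
rewrite /nondegenerate => nd [u [v [w [u0 v0 w0 s]]]].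
rewrite -/(bary _ _ _ _ _ _) combE baryE => -[x y].
have w0e : w = 0.
  apply: (mulIf nd); rewrite mul0r.
  have ue : u = 1 - v - w by lra.
  rewrite {}ue in x y.
  transitivity ((b.1 - a.1) * (((1 - v - w) * a.2 + v * b.2 + w * c.2) - a.2)
     - (b.2 - a.2) * (((1 - v - w) * a.1 + v * b.1 + w * c.1) - a.1)); first by ring.
  by rewrite -x -y; ring.
have ab : a <> b by move=> ab; move: nd; rewrite ab !subrr !mul0r subr0 eqxx.
have -> : t = v.
  apply: (comb_inj ab); rewrite !combE x y w0e.
  have -> : u = 1 - v by lra.
  by apply: plane_eq => /=; ring.
by apply/andP; split=> //; lra.
Qed.

Lemma boundary_triangle a b c x : triangle_boundary a b c x -> triangle a b c x.
Proof.
move=> [[]|] h; first exact: triangle_seg.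
  by rewrite triangle_rot; exact: triangle_seg.
by rewrite triangle_rot triangle_rot; exact: triangle_seg.
Qed.

End Germs.

(** * Graphs of triangles *)

Section TriangleComplex.
Variables (R : realType) (I : finType) (P : I -> 'I_3 -> plane R).
(** The partner of a corner: the other triangle at this vertex, together with its corner there. *)
Variable sg : I -> 'I_3 -> I * 'I_3.

Let o0 : 'I_3 := @Ordinal 3 0 isT.
Let o1 : 'I_3 := @Ordinal 3 1 isT.
Let o2 : 'I_3 := @Ordinal 3 2 isT.

Definition solid i := triangle (P i o0) (P i o1) (P i o2).

Hypothesis unitP : forall i, unit3 (P i o0) (P i o1) (P i o2).
Hypothesis sgP : forall i k, P (sg i k).1 (sg i k).2 = P i k.
Hypothesis sg_neq : forall i k, (sg i k).1 <> i.
Hypothesis sg_inj : forall i k l, (sg i k).1 = (sg i l).1 -> k = l.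
Hypothesis solid_meet : forall i j x, i <> j -> solid i x -> solid j x ->
  exists2 k, x = P i k & (sg i k).1 = j.
(** As all edges have length 1, two edges at a vertex are opposite exactly if the vertex is the
    midpoint of their far ends; straightness is thus a linear equation. *)
Hypothesis not_straight : forall i k k' l', k' <> k -> l' <> (sg i k).2 ->
  P i k' + P (sg i k).1 l' <> P i k + P i k.
Hypothesis no_3cycle : forall i k l m,
  (sg (sg (sg i k).1 l).1 m).1 = i -> False.

Lemma ord3P (k : 'I_3) : [\/ k = o0, k = o1 | k = o2].
Proof.
by case: k => -[|[|[|//]]] h; [constructor 1|constructor 2|constructor 3]; exact/val_inj.
Qed.

(** Relabels the corners so that any side can play the first one in the lemmas on a single
    triangle. *)
Lemma triple i k l : k <> l ->
  exists m, [/\ unit3 (P i k) (P i l) (P i m), solid i = triangle (P i k) (P i l) (P i m)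
   & forall n, [\/ n = k, n = l | n = m]].
Proof.
have u := unitP i; have u' := unit3_rot u; have u'' := unit3_rot u'.
rewrite /solid.
have e1 := triangle_rot (P i o0) (P i o1) (P i o2).
have e2 := triangle_rot (P i o1) (P i o2) (P i o0).
case: (ord3P k) (ord3P l) => -> [] -> kl; try by case: kl.
- by exists o2; split=> // n; exact: ord3P.
- exists o1; split; [exact: unit3_perm|by rewrite e1 e2 triangle_swap|].
  by move=> n; case: (ord3P n) => ->; [constructor 1|constructor 3|constructor 2].
- exists o2; split; [exact: unit3_perm|by rewrite triangle_swap|].
  by move=> n; case: (ord3P n) => ->; [constructor 2|constructor 1|constructor 3].
- exists o0; split=> //.
  by move=> n; case: (ord3P n) => ->; [constructor 3|constructor 1|constructor 2].
- exists o1; split; [by []|by rewrite e1 e2|].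
  by move=> n; case: (ord3P n) => ->; [constructor 2|constructor 3|constructor 1].
- exists o0; split; [exact: unit3_perm|by rewrite e1 triangle_swap|].
  by move=> n; case: (ord3P n) => ->; [constructor 3|constructor 2|constructor 1].
Qed.

Lemma P_sqd i k l : k <> l -> sqd (P i k) (P i l) = 1.
Proof. by move=> /(triple i)[m [[]]]. Qed.

Lemma P_inj i k l : P i k = P i l -> k = l.
Proof.
move=> e; apply/eqP; apply/negP => /negP/eqP/(P_sqd i)/sqd1_neq; exact.
Qed.

Lemma solidP i k : solid i (P i k).
Proof.
rewrite /solid; case: (ord3P k) => ->; first exact: triangle_l.
- by rewrite triangle_rot; exact: triangle_l.
- by rewrite triangle_rot triangle_rot; exact: triangle_l.
Qed.

Lemma solid_corner i x : corner x (solid i) <-> exists k, x = P i k.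
Proof.
split=> [/(corner_triangle _ (unitP i))[->|->|->]|[k ->]]; try by eexists.
by apply/(corner_triangle _ (unitP i)); case: (ord3P k) => ->;
  [constructor 1|constructor 2|constructor 3].
Qed.

Lemma solid_side i e : side e (solid i) <->
  exists k l, k <> l /\ e = segment (P i k) (P i l).
Proof.
split=> [/(side_triangle _ (unitP i))[->|->|->]|[k [l [kl ->]]]].
- by exists o0, o1.
- by exists o1, o2.
- by exists o2, o0.
have [m [u -> _]] := triple i kl.
by apply/(side_triangle _ u); constructor 1.
Qed.

(** A common corner of two triangles is a common point of the solids, and [solid_meet] makes it a
    partner. *)
Lemma P_eq i j k l : P i k = P j l -> (i = j /\ k = l) \/ (i <> j /\ sg i k = (j, l)).
Proof.
move=> e; have [ij|ij] := eqVneq i j.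
  by left; split=> //; apply: (@P_inj i); rewrite e ij.
right; split; first exact/eqP.
have [] := solid_meet (elimN eqP ij) (solidP i k); first by rewrite e; exact: solidP.
move=> k0 /P_inj <- sj; apply/eqP; rewrite -pair_eqE /pair_eq /= sj eqxx /=.
by apply/eqP; apply: (@P_inj j); rewrite -[in LHS]sj sgP.
Qed.

Let V : set (plane R) := [set p | exists2 t, range solid t & corner p t].
Let E : set (set (plane R)) := [set e | exists2 t, range solid t & side e t].

Lemma vertexP v : V v <-> exists i k, v = P i k.
Proof.
split=> [[_ [i _ <-]] /solid_corner[k ->]|[i [k ->]]]; first by exists i, k.
by exists (solid i); [exists i|apply/solid_corner; exists k].
Qed.

Lemma edgeP e : E e <-> exists i k l, k <> l /\ e = segment (P i k) (P i l).
Proof.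
split=> [[_ [i _ <-]] /solid_side[k [l h]]|[i h]]; first by exists i, k, l.
by exists (solid i); [exists i|apply/solid_side].
Qed.

Lemma edge_ends a b : a <> b -> E (segment a b) ->
  exists i k l, [/\ k <> l, a = P i k & b = P i l].
Proof.
move=> ab /edgeP[i [k [l [kl /(segment_inj ab)[[-> ->]|[-> ->]]]]]].
  by exists i, k, l.
by exists i, l, k; split=> // e; apply: kl.
Qed.

Lemma side_corner i k l x m : k <> l -> segment (P i k) (P i l) x -> x = P i m -> m = k \/ m = l.
Proof.
move=> kl sx xm; have [n [u _ /(_ m)[|mn|mn]]] := triple i kl; [by left| by right|].
by case: (corner_segment u); rewrite -mn -xm.
Qed.

Lemma side_solid i k l x : k <> l -> segment (P i k) (P i l) x -> solid i x.
Proof. by move=> kl sx; have [n [u -> _]] := triple i kl; exact: triangle_seg. Qed.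

(** In one triangle this is [segment_meet]. Edges of different triangles meet in a common point of
    the solids, which is a corner of both and therefore an end of each edge. *)
Lemma edges_meet e f x : E e -> E f -> e <> f -> e x -> f x -> endpoint x e /\ endpoint x f.
Proof.
move=> /edgeP[i [k [l [kl ->]]]] /edgeP[j [k' [l' [kl' ->]]]] ef ex fx.
have [ij|/eqP ij] := eqVneq i j.
  subst j; have [n [u _ un]] := triple i kl.
  have hs a b c : unit3 a b c -> segment a b x -> segment a c x ->
      endpoint x (segment a b) /\ endpoint x (segment a c).
    move=> abc xab xac; rewrite (segment_meet abc xab xac); split; exact: endpoint_l.
  have u2 : unit3 (P i l) (P i k) (P i n) by exact: unit3_perm.
  move: ef kl' fx; case: (un k') => ->; case: (un l') => -> // ef kl' fx.
  - exact: hs u _ _.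
  - by case: ef; rewrite segmentC.
  - by rewrite segmentC; apply: hs u2 _ _; rewrite // segmentC.
  - by rewrite (segmentC (P i n)) in fx *; exact: hs u _ _.
  - by rewrite (segmentC (P i n)) (segmentC (P i k)) in fx *; apply: hs u2 _ _; rewrite // segmentC.
have [m xm sm] := solid_meet ij (side_solid kl ex) (side_solid kl' fx).
have xj : x = P j (sg i m).2 by rewrite xm -sgP sm.
split.
- by rewrite xm; case: (side_corner kl ex xm) => ->; [exact: endpoint_l|exact: endpoint_r].
- by rewrite xj; case: (side_corner kl' fx xj) => ->; [exact: endpoint_l|exact: endpoint_r].
Qed.

Lemma vertex_off_edge v p q : V v -> E (segment p q) -> ~ open_segment p q v.
Proof.
move=> /vertexP[j [m ->]] /edgeP[i [k [l [kl e]]]] vo.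
have [n [u st un]] := triple i kl.
have {}vo := open_segmentE (sqd1_neq (P_sqd i kl)) (esym e) vo.
apply: (open_segment_corner u vo).
have vs : segment (P i k) (P i l) (P j m).
  by case: vo => t [t0 t1 ->]; exists t; split=> //; exact: ltW.
have [m' ->] : exists m', P j m = P i m'.
  have [ij|/eqP ij] := eqVneq i j; first by exists m; rewrite ij.
  by have [m' xm _] := solid_meet ij (side_solid kl vs) (solidP j m); exists m'.
by case: (un m') => ->; [constructor 1|constructor 2|constructor 3].
Qed.

Lemma finite_vertices : finite_set V.
Proof.
have -> : V = [set P x.1 x.2 | x in [set: I * 'I_3]].
  by apply/seteqP; split=> v; [move/vertexP=> [i [k ->]]; exists (i, k)|move=> [[i k] _ <-]; apply/vertexP; exists i, k].
exact: finite_image.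
Qed.

Lemma planar_complex (i0 : I) : planar_unit_distance_graph V E.
Proof.
split.
- exact: finite_vertices.
- by exists (P i0 o0); apply/vertexP; exists i0, o0.
- move=> e /edgeP[i [k [l [kl ->]]]]; exists (P i k), (P i l); split=> //.
  + by apply/vertexP; exists i, k.
  + by apply/vertexP; exists i, l.
  + by apply/edist1; exact: P_sqd.
- by move=> e f Ee Ef ef x; exact: edges_meet.
- by move=> v p q; exact: vertex_off_edge.
Qed.

Lemma other_corners (k : 'I_3) : exists k1 k2,
  [/\ k1 <> k, k2 <> k, k1 <> k2 & forall n, [\/ n = k, n = k1 | n = k2]].
Proof.
case: (ord3P k) => ->.
- by exists o1, o2; split=> // n; exact: ord3P.
- exists o0, o2; split=> // n.
  by case: (ord3P n) => ->; [constructor 2|constructor 1|constructor 3].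
- exists o0, o1; split=> // n.
  by case: (ord3P n) => ->; [constructor 2|constructor 3|constructor 1].
Qed.

Lemma four_regular_complex : four_regular V E.
Proof.
move=> _ /vertexP[i [k ->]]; set v := P i k.
have [k1 [k2 [k1k k2k k12 hk]]] := other_corners k.
have [l1 [l2 [l1l l2l l12 hl]]] := other_corners (sg i k).2.
set j := (sg i k).1 in l1l l2l l12 hl *; set l := (sg i k).2 in l1l l2l hl *.
have vj : v = P j l by rewrite sgP.
have ij : i <> j by move=> e; exact: (@sg_neq i k (esym e)).
(* The far ends of the four edges at [v]: two in triangle [i], two in its partner [j]. *)
pose s := [:: P i k1; P i k2; P j l1; P j l2].
(* Otherwise [i] and [j] would have a second corner in common, against [sg_inj]. *)
have cross k' l' : k' <> k -> P i k' <> P j l'.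
  move=> k'k /P_eq[[e _]//|[_ e]]; apply: k'k.
  by apply: (@sg_inj i); rewrite e.
have s_uniq : uniq s.
  rewrite /s /= !inE !negb_or !andbT.
  by apply/and3P; split; [apply/and3P; split|apply/andP; split|]; apply/eqP;
    [move/P_inj|exact: cross|exact: cross|exact: cross|exact: cross|move/P_inj].
have s_neq x : x \in s -> v <> x.
  rewrite !inE => /or4P[] /eqP -> => [/P_inj/esym//|/P_inj/esym//||];
  by rewrite vj => /P_inj/esym.
have -> : [set e | E e /\ endpoint v e] = [set segment v (nth v s n) | n in `I_4].
  apply/seteqP; split=> [e [/edgeP[i' [a [b [ab ->]]]]]|e [n /= n4 <-]]; last first.
    split; last exact: endpoint_l.
    apply/edgeP; case: n n4 => [|[|[|[|//]]]] _ /=.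
    + by exists i, k, k1; split=> // /esym.
    + by exists i, k, k2; split=> // /esym.
    + by exists j, l, l1; rewrite vj; split=> // /esym.
    + by exists j, l, l2; rewrite vj; split=> // /esym.
  have main x y : P i' x = v -> x <> y ->
      [set segment v (nth v s n) | n in `I_4] (segment (P i' x) (P i' y)).
    move=> xv xy; have /P_eq[[ii xk]|[_ se]] := esym xv.
      subst i'; rewrite xv; have [yk|->|->] := hk y; first by case: xy; rewrite yk xk.
        by exists 0%N.
      by exists 1%N.
    have {}ii : i' = j by rewrite /j se.
    have xl : x = l by rewrite /l se.
    subst i'; rewrite xv; have [yk|->|->] := hl y; first by case: xy; rewrite yk xl.
      by exists 2%N.
    by exists 3%N.
  move/(endpoint_segment (sqd1_neq (P_sqd i' ab))) => [va|vb]; first exact: main.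
  by rewrite segmentC; apply: main => // /esym.
apply: inj_card_eq => n m; rewrite !inE /= => n4 m4 e.
apply/eqP; rewrite -(nth_uniq v _ _ s_uniq) //; apply/eqP.
by apply: segment_injr e; apply: s_neq; rewrite mem_nth.
Qed.

Lemma solid_meet_unique i j x y : i <> j -> solid i x -> solid j x ->
  solid i y -> solid j y -> x = y.
Proof.
move=> ij xi xj yi yj.
have [k -> sk] := solid_meet ij xi xj; have [k' -> sk'] := solid_meet ij yi yj.
by congr (P i _); apply: (@sg_inj i); rewrite sk.
Qed.

Lemma consists_complex : consists_of_unit_triangles V E (range solid).
Proof.
split=> //.
- exact: finite_image.
- by move=> _ [i _ <-]; exists (P i o0), (P i o1), (P i o2); split=> //; exact/unit_equilateralE.
move=> _ _ [i _ <-] [j _ <-] st.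
have ij : i <> j by move=> ij; apply: st; rewrite ij.
split; last first.
  move=> x xi xj; have [k xk sk] := solid_meet ij xi xj.
  split; apply/solid_corner; first by exists k.
  by exists (sg i k).2; rewrite -sk sgP.
apply/seteqP; split=> // x [xi xj].
have : nbhs x (solid i `&` solid j) by exact: filterI.
move/nbhs_ballP => [e /= e0 be].
(* A second common point in the ball around [x], whereas two triangles share at most one point. *)
pose y : plane R := (x.1 + e / 2, x.2).
have [yi yj] : (solid i `&` solid j) y.
  apply: be; split => /=; last exact: ballxx.
  by rewrite /ball /= opprD addrA subrr sub0r normrN gtr0_norm ?divr_gt0 // ltr_pdivrMr // mulr2n mulrDr mulr1 ltrDl.
have [/= xi' xj'] : (solid i `&` solid j) x by apply: be; exact: ballxx.
have /(congr1 fst) /= := solid_meet_unique ij xi' xj' yi yj.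
by move/eqP; rewrite -subr_eq0 opprD addrA subrr sub0r oppr_eq0 mulf_eq0 invr_eq0 pnatr_eq0 orbF gt_eqF.
Qed.

Lemma no_opposite_edges r a b : E (segment r a) -> E (segment r b) -> r <> a -> r <> b ->
  a + b <> r + r.
Proof.
move=> Ea Eb ra rb.
have [i [k [k' [kk' rk ak]]]] := edge_ends ra Ea.
have [j [l [l' [ll' rl bl]]]] := edge_ends rb Eb.
have /P_eq[[ij kl]|[ij e]] : P i k = P j l by rewrite -rk -rl.
  subst j l; rewrite ak bl rk => e.
  have e1 : (P i k').1 - (P i l').1 = 2 * ((P i k').1 - (P i k).1).
    by move/(congr1 fst): e => /= e; lra.
  have e2 : (P i k').2 - (P i l').2 = 2 * ((P i k').2 - (P i k).2).
    by move/(congr1 snd): e => /= e; lra.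
  have : sqd (P i k') (P i l') = 4.
    transitivity (4 * sqd (P i k) (P i k')); last by rewrite P_sqd // mulr1.
    by rewrite /sqd e1 e2; ring.
  have [->|/eqP kl'] := eqVneq k' l'.
    by rewrite /sqd !subrr expr0n addr0 => /eqP; rewrite eq_sym pnatr_eq0.
  rewrite P_sqd // => /eqP; rewrite -subr_eq0; apply/negP.
  by have -> : (1 - 4 : R) = - 3%:R by ring; rewrite oppr_eq0 pnatr_eq0.
rewrite ak bl rk.
have <- : (sg i k).1 = j by rewrite e.
by apply: not_straight; [exact: nesym|rewrite e; exact: nesym].
Qed.

(** Only finitely many edges exist, so sufficiently close beyond [comb t0 a b] only edges through
    that point can cover. *)
Lemma boundary_germ (F : set (set (plane R))) a b t0 : F `<=` E -> t0 < 1 ->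
  (forall t, t0 <= t -> t <= 1 -> (\bigcup_(e in F) e) (comb t a b)) ->
  exists e t, [/\ F e, e (comb t0 a b), e (comb t a b), t0 < t & t <= 1].
Proof.
move=> FE t1 cov.
have tb : 0 < 1 - t0 by rewrite subr_gt0.
pose p (j : I * 'I_3 * 'I_3) := P j.1.1 j.1.2; pose p' (j : I * 'I_3 * 'I_3) := P j.1.1 j.2.
pose js := [seq j <- enum {: I * 'I_3 * 'I_3} | j.1.2 != j.2].
have pp j : j \in js -> p j <> p' j.
  by rewrite mem_filter => /andP[/eqP jj _]; exact/sqd1_neq/P_sqd.
have [d d0 h] := segments_germ (comb t0 a b) b pp.
pose u := Order.min d 1 / 2.
have m0 : 0 < Order.min d 1 by rewrite lt_min d0 ltr01.
have u0 : 0 < u by rewrite divr_gt0.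
have um : u < Order.min d 1 by rewrite ltr_pdivrMr // mulr2n mulrDr mulr1 ltrDl.
have [ud u1] : u < d /\ u < 1 by apply/andP; rewrite -lt_min.
pose t := t0 + u * (1 - t0).
have ut : 0 < u * (1 - t0) by rewrite mulr_gt0.
have ut1 : u * (1 - t0) <= 1 * (1 - t0) by rewrite ler_wpM2r // ltW.
have te : comb u (comb t0 a b) b = comb t a b.
  by rewrite !combE /t; apply: plane_eq => /=; ring.
have [e Fe et] := cov t (ltac:(rewrite /t; lra)) (ltac:(rewrite /t; lra)).
exists e, t; split=> //; [|rewrite /t; lra|rewrite /t; lra].
have /edgeP[i [k [l [/eqP kl ee]]]] := FE _ Fe.
have := h u u0 ud (i, k, l); rewrite te /p /p' /= -ee; apply=> //.
by rewrite mem_filter kl mem_enum.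
Qed.

(** An edge [e] of [F] leaves [a] along the side, and [a] is an end of it, since otherwise [e] would
    stick out of the triangle. If its other end [r] is not [b], a second edge continues from [r]
    along the side, and the two are opposite at [r]. *)
Lemma boundary_side (F : set (set (plane R))) a b c : nondegenerate a b c -> F `<=` E ->
  triangle_boundary a b c = \bigcup_(e in F) e -> E (segment a b).
Proof.
move=> nd FE bF.
have ab : a <> b by move=> ab; move: nd; rewrite /nondegenerate ab !subrr !mul0r subr0 eqxx.
have cov t : 0 <= t -> t <= 1 -> (\bigcup_(e in F) e) (comb t a b).
  by move=> t0 t1; rewrite -bF; left; left; exists t.
have inF e x t : F e -> e x -> x = comb t a b -> 0 <= t <= 1.
  move=> Fe ex xt; apply: (triangle_line nd); rewrite -xt; apply: boundary_triangle.
  by rewrite bF; exists e.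
have [e [t [Fe ea et t0 t1]]] := boundary_germ FE ltr01 cov.
rewrite comb0 in ea.
have [r [ee ar]] : exists r, e = segment a r /\ sqd a r = 1.
  have /edgeP[i [k [l [kl ee]]]] := FE _ Fe.
  have pq := P_sqd i kl; have npq := sqd1_neq pq.
  move: ea et; rewrite ee => -[s [s0 s1 ea]] [s' [s0' s1' et]].
  have [s00|s00] := eqVneq s 0.
    by exists (P i l); rewrite ea s00 -/(comb _ _ _) comb0.
  have [s11|s11] := eqVneq s 1.
    by exists (P i k); rewrite ea s11 -/(comb _ _ _) comb1 segmentC sqdC.
  have sp : 0 < s by rewrite lt_neqAle eq_sym s00.
  have sm : 0 < 1 - s by rewrite subr_gt0 lt_neqAle s11.
  (* With [a] inside [e], stepping back from [a] by [d] times the way to the second point stays in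
     [e] and reaches the parameter [- (d * t) < 0] on the line [a b]. *)
  pose d := Order.min s (1 - s).
  have d0 : 0 < d by rewrite lt_min sp.
  have ds : d <= s by rewrite ge_min lexx.
  have ds' : d <= 1 - s by rewrite ge_min lexx orbT.
  have ds1 : d * (s' - s) <= d * 1 by rewrite ler_wpM2l ?ltW //; lra.
  have ds2 : d * (s - s') <= d * 1 by rewrite ler_wpM2l ?ltW //; lra.
  have := inF e (comb (s - d * (s' - s)) (P i k) (P i l)) (- (d * t)) Fe.
  rewrite ee; case/(_ _ _)/andP.
  - by exists (s - d * (s' - s)); split=> //; lra.
  - move: ea et; rewrite -!/(comb _ _ _) !combE => -> -[x y].
    apply: plane_eq => /=.
      transitivity ((1 + d) * ((1 - s) * (P i k).1 + s * (P i l).1)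
         - d * ((1 - s') * (P i k).1 + s' * (P i l).1)); first by ring.
      by rewrite -x /=; ring.
    transitivity ((1 + d) * ((1 - s) * (P i k).2 + s * (P i l).2)
       - d * ((1 - s') * (P i k).2 + s' * (P i l).2)); first by ring.
    by rewrite -y /=; ring.
  - by have := mulr_gt0 d0 t0; lra.
have nar := sqd1_neq ar.
move: (et); rewrite ee => -[s [s0 s1 es]].
have sn : s != 0.
  apply/eqP => s00; move: es; rewrite s00 -!/(comb _ _ _) comb0 -{2}(comb0 a b).
  by move/(comb_inj ab) => t00; rewrite t00 ltxx in t0.
have sp : 0 < s by rewrite lt_neqAle eq_sym sn.
have er : r = comb (t / s) a b.
  move: es; rewrite -!/(comb _ _ _) !combE => -[x y].
  apply: plane_eq => /=; apply: (mulfI sn).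
    transitivity (((1 - s) * a.1 + s * r.1) - (1 - s) * a.1); first by ring.
    by rewrite -x; field.
  transitivity (((1 - s) * a.2 + s * r.2) - (1 - s) * a.2); first by ring.
  by rewrite -y; field.
pose ta := t / s.
have ta0 : 0 < ta by rewrite divr_gt0.
have /andP[_ ta1] : 0 <= ta <= 1.
  by apply: (inF e r) => //; rewrite ee; exact: segment_r.
have [ta1e|ta1n] := eqVneq ta 1.
  have -> : b = r by rewrite er -/ta ta1e comb1.
  by rewrite -ee; exact: FE.
have ta1s : ta < 1 by rewrite lt_neqAle ta1n.
have cov' u : ta <= u -> u <= 1 -> (\bigcup_(e in F) e) (comb u a b).
  by move=> h1 h2; apply: cov => //; apply: le_trans h1; exact: ltW.
have [f [u [Ff fr fu tau u1]]] := boundary_germ FE ta1s cov'.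
rewrite -er in fr.
(* Points of [e] have parameter at most [ta], and [f] reaches [u > ta]. *)
have ef : e <> f.
  move=> ef; move: fu; rewrite -ef ee => -[v [v0 v1]].
  have -> : (1 - v) *: a + v *: r = comb (v * ta) a b.
    by rewrite -/(comb _ _ _) er -/ta !combE; apply: plane_eq => /=; ring.
  move/(comb_inj ab) => uv.
  have : v * ta <= 1 * ta by rewrite ler_wpM2r // ltW.
  by lra.
have [_ rf] := edges_meet (FE _ Fe) (FE _ Ff) ef (eq_ind_r (fun e : set _ => e r) (segment_r a r) ee) fr.
have [r' [ff rr']] : exists r', f = segment r r' /\ sqd r r' = 1.
  have /edgeP[i [k [l [kl ff]]]] := FE _ Ff.
  have pq := P_sqd i kl; move: rf; rewrite ff.
  move/(endpoint_segment (sqd1_neq pq)) => [->|->]; first by exists (P i l).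
  by exists (P i k); rewrite segmentC sqdC.
have Era : E (segment r a) by rewrite segmentC -ee; exact: FE.
have Err : E (segment r r') by rewrite -ff; exact: FE.
case: (no_opposite_edges Era Err (nesym nar) (sqd1_neq rr')).
move: fu; rewrite ff => -[v [v0 v1 fu]].
have vn : v != 0.
  apply/eqP => v00; move: fu; rewrite v00 -!/(comb _ _ _) comb0 er.
  by move/(comb_inj ab) => e1; move: tau; rewrite /ta e1 ltxx.
have vp : 0 < v by rewrite lt_neqAle eq_sym vn.
pose m := (u - ta) / v.
have m0 : 0 < m by rewrite divr_gt0 // subr_gt0.
have [x1 y1] : r'.1 - r.1 = m * (b.1 - a.1) /\ r'.2 - r.2 = m * (b.2 - a.2).
  move: fu; rewrite -!/(comb _ _ _) !combE => -[x y].
  have rx : r.1 = (1 - ta) * a.1 + ta * b.1 by rewrite er.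
  have ry : r.2 = (1 - ta) * a.2 + ta * b.2 by rewrite er.
  split; apply: (mulfI vn).
    transitivity (((1 - v) * r.1 + v * r'.1) - r.1); first by ring.
    by rewrite -x rx /m; field.
  transitivity (((1 - v) * r.2 + v * r'.2) - r.2); first by ring.
  by rewrite -y ry /m; field.
have [x2 y2] : r.1 - a.1 = ta * (b.1 - a.1) /\ r.2 - a.2 = ta * (b.2 - a.2).
  by rewrite er -/ta combE /=; split; ring.
(* Both edges have length 1 and the same direction, so [r] is the midpoint of [a] and [r']. *)
have mt : m = ta.
  have h : m ^+ 2 * sqd a b = ta ^+ 2 * sqd a b.
    transitivity (sqd r r').
      by rewrite (sqdC a b) (sqdC r r') /sqd x1 y1; ring.
    rewrite rr' -[LHS]ar (sqdC a r) (sqdC a b) /sqd x2 y2; ring.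
  have sab : sqd a b != 0.
    apply/eqP => z; apply: ab; move: z; rewrite /sqd => /eqP.
    rewrite paddr_eq0 ?sqr_ge0 // !sqrf_eq0 !subr_eq0 => /andP[/eqP ? /eqP ?].
    exact: plane_eq.
  have := mulIf sab h => /eqP; rewrite eqf_sqr => /orP[/eqP //|/eqP mt].
  by lra.
by apply: plane_eq => /=; move: x1 y1 x2 y2; rewrite mt => x1 y1 x2 y2; lra.
Qed.

Lemma no_additional_complex : without_additional_triangles E (range solid).
Proof.
move=> a b c [nd [F FE bF] nT]; apply: nT.
have nd' : nondegenerate b c a.
  by move: nd; rewrite /nondegenerate; apply: contra_neq => <-; ring.
have nd'' : nondegenerate c a b.
  by move: nd; rewrite /nondegenerate; apply: contra_neq => <-; ring.
have rot x y z : triangle_boundary x y z = triangle_boundary y z x :> set (plane R).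
  by rewrite /triangle_boundary -setUA setUC.
have Eab := boundary_side nd FE bF.
have Ebc : E (segment b c) by apply: (boundary_side nd' FE); rewrite -rot.
have Eca : E (segment c a) by apply: (boundary_side nd'' FE); rewrite -rot -rot.
have neq x y z : nondegenerate x y z -> x <> y :> plane R.
  by move=> h e; move: h; rewrite /nondegenerate e !subrr !mul0r subr0 eqxx.
have [[ab bc] ca] := (neq _ _ _ nd, neq _ _ _ nd', neq _ _ _ nd'').
have [i [ia [ib [iab ai bi]]]] := edge_ends ab Eab.
have [j [jb [jc [jbc bj cj]]]] := edge_ends bc Ebc.
have [m [mc [ma [mca cm am]]]] := edge_ends ca Eca.
have one n (ka kb kc : 'I_3) : a = P n ka -> b = P n kb -> c = P n kc ->
    range solid (triangle a b c).
  move=> ea eb ec; exists n => //.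
  have kab : ka <> kb by move=> e; apply: ab; rewrite ea eb e.
  have [k [_ -> /(_ kc)]] := triple n kab.
  case=> e; [by case: ca; rewrite ea ec e|by case: bc; rewrite eb ec e|].
  by rewrite ea eb ec e.
(* Two sides in one triangle of the graph make [a], [b], [c] its corners. Otherwise the three
   triangles are partners in a cycle. *)
have /P_eq[[ij kl]|[ij sij]] : P i ib = P j jb by rewrite -bi.
  by subst j; apply: one ai bi cj.
have /P_eq[[jm kl]|[jm sjm]] : P j jc = P m mc by rewrite -cj.
  by subst m; apply: one am bj cj.
have /P_eq[[mi kl]|[mi smi]] : P m ma = P i ia by rewrite -am.
  by subst m; apply: one ai bi cm.
by case: (@no_3cycle i ib jc ma); rewrite sij /= sjm /= smi.
Qed.

Lemma card_solids : range solid #<= `I_#|I|.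
Proof.
apply: card_le_trans (card_image_le solid setT) _.
have -> : [set: I] = [set enum_val x | x in [set: 'I_#|I|]].
  by apply/seteqP; split=> // x _; exists (enum_rank x) => //; rewrite enum_rankK.
apply: card_le_trans (card_image_le _ _) _.
by rewrite (card_le_eql (card_esym card_II)) card_le_II.
Qed.

Theorem triangle_complex (i0 : I) (n : nat) : (#|I| <= n)%N ->
  exists (V : set (plane R)) (E T : set (set (plane R))),
    [/\ planar_unit_distance_graph V E,
        four_regular V E,
        consists_of_unit_triangles V E T,
        without_additional_triangles E T
      & T #<= `I_n].
Proof.
move=> In; exists V, E, (range solid); split.
- exact: planar_complex.
- exact: four_regular_complex.
- exact: consists_complex.
- exact: no_additional_complex.
- by apply: card_le_trans card_solids _; rewrite card_le_II.
Qed.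

End TriangleComplex.

(** * Kaleidoscopes *)

Section ComplexPlane.
Variable R : realType.
Implicit Types (p q z w : plane R).

(** Points are read as complex numbers, so that rotations about the origin are multiplications by
    numbers of norm 1. *)
Definition cmul z w : plane R := (z.1 * w.1 - z.2 * w.2, z.1 * w.2 + z.2 * w.1).
Definition conjp z : plane R := (z.1, - z.2).
Definition norm2 z : R := z.1 ^+ 2 + z.2 ^+ 2.
Fixpoint cpow z n : plane R := if n is n'.+1 then cmul z (cpow z n') else (1, 0).

Lemma scale_planeE (k : R) z : k *: z = (k * z.1, k * z.2).
Proof. by []. Qed.

Lemma cmulA x y z : cmul x (cmul y z) = cmul (cmul x y) z.
Proof. by rewrite /cmul /=; congr (_, _); ring. Qed.

Lemma cmulC x y : cmul x y = cmul y x.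
Proof. by rewrite /cmul /=; congr (_, _); ring. Qed.

Lemma cmul1 z : cmul (1, 0) z = z.
Proof. by case: z => x y; rewrite /cmul /=; congr (_, _); ring. Qed.

Lemma cpowD z m n : cpow z (m + n) = cmul (cpow z m) (cpow z n).
Proof. by elim: m => [|m IH]; [rewrite /= cmul1|rewrite addSn /= IH cmulA]. Qed.

Lemma norm2M z w : norm2 (cmul z w) = norm2 z * norm2 w.
Proof. by rewrite /norm2 /cmul /=; ring. Qed.

Lemma norm2X z n : norm2 z = 1 -> norm2 (cpow z n) = 1.
Proof.
move=> z1; elim: n => [|n IH] /=; last by rewrite norm2M z1 IH mulr1.
by rewrite /norm2 /= expr1n expr0n addr0.
Qed.

Lemma cmul_inj z w w' : norm2 z = 1 -> cmul z w = cmul z w' -> w = w'.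
Proof.
move=> z1 e; have k v : cmul (conjp z) (cmul z v) = v.
  rewrite cmulA; have -> : cmul (conjp z) z = (1, 0).
    by rewrite -z1 /norm2 /cmul /conjp /=; congr (_, _); ring.
  exact: cmul1.
by rewrite -(k w) e k.
Qed.

Lemma sqd_cmul z p q : norm2 z = 1 -> sqd (cmul z p) (cmul z q) = sqd p q.
Proof. by move=> z1; rewrite -[RHS]mul1r -z1 /norm2 /sqd /cmul /=; ring. Qed.

Lemma sqd_conj p q : sqd (conjp p) (conjp q) = sqd p q.
Proof. by rewrite /sqd /=; ring. Qed.

End ComplexPlane.

(** * The sectors between the mirrors of a dihedral group *)

Section Sectors.
Variables (R : realType) (N : nat) (zeta : plane R).
Implicit Types (p q : plane R) (m n : nat).

Hypothesis N1 : (1 < N)%N.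
Hypothesis zeta1 : norm2 zeta = 1.
Hypothesis zetaN : cpow zeta N = (-1, 0).
(** Together with [zetaN] this singles out [exp (i pi / N)] among the roots of [-1]. *)
Hypothesis zeta_pos : forall j, (0 < j < N)%N -> 0 < (cpow zeta j).2.

Local Notation pw := (cpow zeta).

(* The distances of a point to the two mirrors bounding the sector between the
   directions 1 and zeta. *)
Definition dist1 p : R := p.2.
Definition dist2 p : R := zeta.2 * p.1 - zeta.1 * p.2.

(** The closed sector without its apex, the only point that would lie in all sectors. *)
Definition in_sector p := [/\ 0 <= dist1 p, 0 <= dist2 p & 0 < dist1 p + dist2 p].

Lemma zeta2_gt0 : 0 < zeta.2.
Proof. by have := zeta_pos (j := 1%N) N1; rewrite /cpow /cmul /= mulr0 mulr1 add0r. Qed.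

Lemma pw_addN n : pw (N + n) = (- (pw n).1, - (pw n).2).
Proof. by rewrite cpowD zetaN /cmul /=; congr (_, _); ring. Qed.

Lemma pw_neg n : (N < n < N + N)%N -> (pw n).2 < 0.
Proof.
move=> /andP[n1 n2]; rewrite -(subnKC (ltnW n1)) pw_addN /= oppr_lt0.
by apply: zeta_pos; rewrite subn_gt0 n1 ltn_subLR // ltnW.
Qed.

Lemma pw_addNN n : pw (N + N + n) = pw n.
Proof. by rewrite -addnA !pw_addN /= !opprK; case: (pw n). Qed.

(** For odd [m] the basic sector is reflected: its sides [1] and [zeta] go to [pw m.+1] and [pw m].
    Copies in neighbouring sectors are therefore mirror images of each other. *)
Definition fold_map m p : plane R :=
  if odd m then cmul (pw m.+1) (conjp p) else cmul (pw m) p.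

(* [coord m p] and [coord m.+1 p] are, up to the factor [zeta.2], the coordinates of
   [fold_map m p] in the basis formed by the directions of the two sides of the
   m-th sector. *)
Definition coord m p := if odd m then dist1 p else dist2 p.

Lemma fold_map_coord m p :
  zeta.2 *: fold_map m p = coord m p *: pw m + coord m.+1 p *: pw m.+1.
Proof.
rewrite /fold_map /coord !scale_planeE /=; case: (odd m) => /=.
  rewrite /cmul /conjp /dist1 /dist2 /=; set u := pw m.
  apply: plane_eq => /=.
    transitivity (p.2 * u.1 * (zeta.1 ^+ 2 + zeta.2 ^+ 2)
        + (zeta.2 * p.1 - zeta.1 * p.2) * (zeta.1 * u.1 - zeta.2 * u.2)); first by ring.
    by rewrite [_ ^+ 2 + _]zeta1 mulr1.
  transitivity (p.2 * u.2 * (zeta.1 ^+ 2 + zeta.2 ^+ 2)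
      + (zeta.2 * p.1 - zeta.1 * p.2) * (zeta.1 * u.2 + zeta.2 * u.1)); first by ring.
  by rewrite [_ ^+ 2 + _]zeta1 mulr1.
by rewrite /cmul /dist1 /dist2 /=; set u := pw m; apply: plane_eq => /=; ring.
Qed.

Lemma coord_ge0 m p : in_sector p -> 0 <= coord m p.
Proof. by rewrite /coord => -[p1 p2 _]; case: odd. Qed.

Lemma coord_gt0 m p : in_sector p -> 0 < coord m p + coord m.+1 p.
Proof. by rewrite /coord /= => -[p1 p2 p3]; case: (odd m) => //=; rewrite addrC. Qed.

Lemma coord_eq p q : dist1 p = dist1 q -> dist2 p = dist2 q -> p = q.
Proof.
rewrite /dist1 /dist2 => e1 e2; apply: plane_eq => //.
have s0 := zeta2_gt0; apply: (mulfI (lt0r_neq0 s0)).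
by move: e2; rewrite e1; lra.
Qed.

(** A linear functional separates the two cones: the signed distance to the line of [pw 1] if
    [d <= N], the ordinate otherwise. Its signs on the two sides are opposite, so every term
    vanishes. *)
Lemma cone_meet d (A B C D : R) : 0 <= A -> 0 <= B -> 0 <= C -> 0 <= D ->
  0 < A + B -> 0 < C + D -> (0 < d < N + N)%N ->
  A *: pw 0 + B *: pw 1 = C *: pw d + D *: pw d.+1 ->
  [/\ d = 1%N, A = 0, D = 0 & B = C] \/ [/\ d = (N + N).-1, B = 0, C = 0 & A = D].
Proof.
move=> A0 B0 C0 D0 AB CD /andP[d0 d2] e.
have s0 := zeta2_gt0.
have kill (a b : R) : 0 < b -> a * b = 0 -> a = 0.
  by move=> b0 /eqP; rewrite mulf_eq0 (gt_eqF b0) orbF => /eqP.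
have [e1 e2] : A + B * zeta.1 = C * (pw d).1 + D * (pw d.+1).1 /\
     B * zeta.2 = C * (pw d).2 + D * (pw d.+1).2.
  move: e; rewrite !scale_planeE => -[x y]; split.
    by transitivity (A * 1 + B * (zeta.1 * 1 - zeta.2 * 0)); [ring|exact: x].
  by transitivity (A * 0 + B * (zeta.1 * 0 + zeta.2 * 1)); [ring|exact: y].
have [dN|dN] := leqP d N.
  left; clear e1; case: d d0 d2 dN e e2 => // d _ d2 dN + e2; rewrite !scale_planeE => -[x y].
  have h : - (A * zeta.2) = C * (pw d).2 + D * (pw d.+1).2.
    transitivity ((A * 1 + B * (zeta.1 * 1 - zeta.2 * 0)) * (- zeta.2)
        + (A * 0 + B * (zeta.1 * 0 + zeta.2 * 1)) * zeta.1); first by ring.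
    move: x y => /= -> ->.
    set u := pw d; transitivity ((C * u.2 + D * (zeta.1 * u.2 + zeta.2 * u.1)) * (zeta.1 ^+ 2 + zeta.2 ^+ 2));
      first by ring.
    by rewrite [_ ^+ 2 + _]zeta1 mulr1.
  have u0 : 0 <= (pw d).2.
    by case: d dN {h x y d2 e2} => // d dN; apply/ltW/zeta_pos; lia.
  have u1 : 0 <= (pw d.+1).2.
    move: dN; rewrite leq_eqVlt => /orP[/eqP ->|dN]; first by rewrite zetaN.
    by apply/ltW/zeta_pos; lia.
  have AA : 0 <= A * zeta.2 by rewrite mulr_ge0 // ltW.
  have CC : 0 <= C * (pw d).2 by rewrite mulr_ge0.
  have DD : 0 <= D * (pw d.+1).2 by rewrite mulr_ge0.
  have Az : A = 0.
    have /eqP : A * zeta.2 = 0 by lra.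
    by rewrite mulf_eq0 (gt_eqF s0) orbF => /eqP.
  have Cz : C * (pw d).2 = 0 by lra.
  have Dz : D * (pw d.+1).2 = 0 by lra.
  have [d00|dpos] := posnP d.
    subst d; have D00 : D = 0.
      apply: kill Dz; exact: zeta_pos.
    split=> //; apply: (mulIf (lt0r_neq0 s0)).
    move: y; rewrite Az D00 /= => y; transitivity (0 * 0 + B * (zeta.1 * 0 + zeta.2 * 1)); first by ring.
    by rewrite y; ring.
  have C00 : C = 0.
    by apply: kill Cz; apply: zeta_pos; move: dpos dN; clear; lia.
  exfalso; move: dN; rewrite leq_eqVlt => /orP[/eqP dN|dN].
    have : B * zeta.2 = - (D * zeta.2).
      rewrite e2 C00; have -> : pw d.+2 = cmul zeta (pw N) by rewrite -dN.
      by rewrite zetaN /cmul /=; ring.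
    move=> h2; have BB : 0 <= B * zeta.2 by rewrite mulr_ge0 // ltW.
    have DD2 : 0 < D * zeta.2 by rewrite mulr_gt0 //; lra.
    lra.
  have D00 : D = 0.
    by apply: kill Dz; apply: zeta_pos; move: dN; clear; lia.
  lra.
right.
have u0 : (pw d).2 < 0 by apply: pw_neg; move: dN d2; clear; lia.
have u1 : (pw d.+1).2 <= 0.
  have [dd|dd] := ltnP d.+1 (N + N); first by apply/ltW/pw_neg; move: dN dd; clear; lia.
  by rewrite (_ : d.+1 = N + N + 0)%N ?pw_addNN //; move: dd d2; clear; lia.
have BB : 0 <= B * zeta.2 by rewrite mulr_ge0 // ltW.
have CC : C * (pw d).2 <= 0 by rewrite mulr_ge0_le0 // ltW.
have DD : D * (pw d.+1).2 <= 0 by rewrite mulr_ge0_le0.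
have Bz : B = 0.
  have /eqP : B * zeta.2 = 0 by lra.
  by rewrite mulf_eq0 (gt_eqF s0) orbF => /eqP.
have Cz : C = 0.
  have /eqP : C * (pw d).2 = 0 by lra.
  by rewrite mulf_eq0 (lt_eqF u0) orbF => /eqP.
have [dd|dd] := ltnP d.+1 (N + N).
  have dr : (N < d.+1 < N + N)%N by move: dN dd; clear; lia.
  have : D * (pw d.+1).2 < 0 by rewrite pmulr_rlt0 ?pw_neg //; lra.
  lra.
have de : d.+1 = (N + N + 0)%N by move: dd d2; clear; lia.
split=> //; first by move: de; clear; lia.
by move: e1; rewrite Bz Cz de pw_addNN /=; lra.
Qed.

Definition dist (b : bool) p := if b then dist2 p else dist1 p.

Lemma coordE m p : coord m p = dist (~~ odd m) p.
Proof. by rewrite /coord /dist; case: odd. Qed.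

Lemma coord_inj m p q : coord m p = coord m q -> coord m.+1 p = coord m.+1 q -> p = q.
Proof. by rewrite /coord /=; case: odd => /= e1 e2; exact: coord_eq. Qed.

(** Rotating sector [m] to sector 0 reduces this to [cone_meet]. The second alternative is the wrap
    around from sector 0 to the last one. *)
Lemma sector_meet m n p q : (m < n < N + N)%N -> in_sector p -> in_sector q ->
  fold_map m p = fold_map n q -> p = q /\
  ((n = m.+1 /\ coord m p = 0) \/ [/\ m = 0%N, n = (N + N).-1 & coord m.+1 p = 0]).
Proof.
move=> /andP[mn n2] ps qs /(congr1 (fun z => zeta.2 *: z)); rewrite !fold_map_coord.
have nd : n = (m + (n - m))%N by rewrite subnKC // ltnW.
set d := (n - m)%N in nd.
have lin k (A B : R) : A *: pw (m + k) + B *: pw (m + k).+1 =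
    cmul (pw m) (A *: pw k + B *: pw k.+1).
  rewrite -addnS !cpowD; set u := pw m; set v := pw k; set w := pw k.+1.
  by rewrite !scale_planeE /cmul; apply: plane_eq => /=; ring.
move=> e; have := e; rewrite -[in LHS](addn0 m) [in RHS]nd !lin -nd addn0.
move/(cmul_inj (norm2X m zeta1))/cone_meet => [].
- exact: coord_ge0. - exact: coord_ge0. - exact: coord_ge0. - exact: coord_ge0.
- exact: coord_gt0. - exact: coord_gt0.
- by rewrite subn_gt0 mn /= (leq_ltn_trans _ n2) // leq_subr.
- move=> [d1 A0 D0 BC]; have nm : n = m.+1 by rewrite nd d1 addn1.
  split; last by left.
  apply: (@coord_inj m); last by rewrite BC nm.
  by move: D0; rewrite A0 nm /coord /= negbK.
- move=> [dN B0 C0 AD]; have m0 : m = 0%N by move: n2 dN; rewrite /d; lia.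
  have nN : n = (N + N).-1 by move: dN; rewrite /d m0 subn0.
  have on : odd n.
    have nN1 : n = (N.-1 + N.-1).+1 by rewrite nN; move: N1; clear; lia.
    by rewrite nN1 /= addnn odd_double.
  split; last by right.
  apply: (@coord_inj m); last first.
    by rewrite B0 m0 /coord /=; move: C0; rewrite /coord on.
  by rewrite AD m0 /coord /= on.
Qed.

Lemma in_sector_bary a b c (u v w : R) : in_sector a -> in_sector b -> in_sector c ->
  0 <= u -> 0 <= v -> 0 <= w -> u + v + w = 1 -> in_sector (bary u v w a b c).
Proof.
move=> [a1 a2 a3] [b1 b2 b3] [c1 c2 c3] u0 v0 w0 s.
have e1 : dist1 (bary u v w a b c) = u * dist1 a + v * dist1 b + w * dist1 c.
  by rewrite /dist1 baryE /=.
have e2 : dist2 (bary u v w a b c) = u * dist2 a + v * dist2 b + w * dist2 c.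
  by rewrite /dist2 baryE /=; ring.
split; [rewrite e1|rewrite e2|]; try by rewrite !addr_ge0 // mulr_ge0.
have -> : dist1 (bary u v w a b c) + dist2 (bary u v w a b c) =
  u * (dist1 a + dist2 a) + v * (dist1 b + dist2 b) + w * (dist1 c + dist2 c).
  by rewrite e1 e2; ring.
have pos (x y : R) : 0 <= x -> 0 < y -> 0 <= x * y by move=> x0 y0; rewrite mulr_ge0 // ltW.
have [[pa pb] pc] := (pos _ _ u0 a3, pos _ _ v0 b3, pos _ _ w0 c3).
have ps (x y : R) : 0 < y -> x * y <= 0 -> x <= 0.
  by move=> y0; rewrite pmulr_lle0.
rewrite ltNge; apply/negP => le0.
have ua : u <= 0 by apply: (ps _ _ a3); lra.
have vb : v <= 0 by apply: (ps _ _ b3); lra.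
have wc : w <= 0 by apply: (ps _ _ c3); lra.
lra.
Qed.


Lemma double_gt0 : (0 < N + N)%N. Proof. by rewrite addn_gt0 (ltnW N1). Qed.

(** The sector across the image of mirror [b], where [false] is the ray [1] and [true] the ray
    [zeta]. The reflection for odd [m] exchanges the roles of successor and predecessor. *)
Definition nbr b (m : 'I_(N + N)) : 'I_(N + N) :=
  if b (+) odd m then ordS m else ord_pred m.

Lemma odd_modNN k : odd (k %% (N + N)) = odd k.
Proof. by rewrite {2}(divn_eq k (N + N)) oddD oddM (_ : odd (N + N) = false) ?andbF // addnn odd_double. Qed.

Lemma odd_last : odd (N + N).-1.
Proof.
have -> : (N + N).-1 = (N.-1 + N.-1).+1 by move: N1; clear; lia.
by rewrite /= addnn odd_double.
Qed.

Lemma nbrP b (m : 'I_(N + N)) : (nbr b m = (if b (+) odd m then m.+1 else m + (N + N).-1) %% (N + N) :> nat)%N.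
Proof. by rewrite /nbr; case: ifP => //= _; congr (_ %% _)%N; have := double_gt0; lia. Qed.

Lemma odd_nbr b (m : 'I_(N + N)) : odd (nbr b m) = ~~ odd m.
Proof.
rewrite nbrP odd_modNN; case: ifP => //= _.
by rewrite oddD odd_last addbT.
Qed.

Lemma nbr_neq (m : 'I_(N + N)) : nbr true m <> nbr false m.
Proof.
have key (k : 'I_(N + N)) : ordS k <> ord_pred k.
  move=> /(congr1 (@nat_of_ord _)) /=; have := ltn_ord k; move: (nat_of_ord k) => j jN.
  have [j0|j0] := posnP j.
    rewrite j0 add0n !modn_small; [|by move: N1; clear; lia..].
    by move: N1; clear; lia.
  have -> : (j + (N + N)).-1 = (j.-1 + (N + N))%N by move: j0; clear; lia.
  rewrite modnDr (modn_small (m := j.-1)); last by move: j0 jN; clear; lia.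
  have [jN'|jN'] := ltnP j.+1 (N + N).
    by rewrite modn_small //; move: j0; clear; lia.
  have -> : j.+1 = (N + N)%N by move: jN jN'; clear; lia.
  by rewrite modnn; move: N1 jN'; clear; lia.
rewrite /nbr /=; case: (odd m) => /=; [by move/esym/key|exact: key].
Qed.

Lemma scale_inj (p q : plane R) : zeta.2 *: p = zeta.2 *: q -> p = q.
Proof.
have s0 := lt0r_neq0 zeta2_gt0; rewrite !scale_planeE => -[e1 e2].
by apply: plane_eq; exact: (mulfI s0).
Qed.

Lemma fold_mapS m p : coord m p = 0 -> fold_map m.+1 p = fold_map m p.
Proof.
move=> c0; apply: scale_inj; rewrite !fold_map_coord c0.
have -> : coord m.+2 p = 0 by move: c0; rewrite /coord /= negbK.
by rewrite !scale0r addr0 add0r.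
Qed.

Lemma fold_map0 p : coord 1 p = 0 -> fold_map (N + N).-1 p = fold_map 0 p.
Proof.
move=> c1; apply: scale_inj; rewrite !fold_map_coord c1.
have od := odd_last.
have -> : coord (N + N).-1 p = 0 by rewrite /coord od.
have -> : coord (N + N).-1.+1 p = coord 0 p by rewrite /coord /= od.
rewrite (_ : (N + N).-1.+1 = N + N + 0)%N ?pw_addNN; last by move: N1; clear; lia.
by rewrite !scale0r add0r addr0.
Qed.

Lemma fold_nbr b (m : 'I_(N + N)) p : dist b p = 0 -> fold_map (nbr b m) p = fold_map m p.
Proof.
move=> db; have m2 := ltn_ord m; rewrite nbrP; case: ifP => bm.
  have c0 : coord m p = 0.
    by rewrite coordE; have -> : ~~ odd m = b by case: b bm {db}; case: (odd m).
  have [mN|mN] := ltnP m.+1 (N + N); first by rewrite modn_small // fold_mapS.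
  have -> : m.+1 = (N + N)%N by lia.
  rewrite modnn; have -> : nat_of_ord m = (N + N).-1 by lia.
  rewrite fold_map0 //; move: c0; have -> : nat_of_ord m = (N + N).-1 by lia.
  by rewrite /coord odd_last.
have c0 : coord m.+1 p = 0.
  by rewrite coordE /= negbK; have -> : odd m = b by case: b bm {db}; case: (odd m).
case: (posnP m) => [m0|m0].
  rewrite m0 add0n modn_small; last by have := double_gt0; lia.
  by apply: fold_map0; rewrite -m0.
have -> : (m + (N + N).-1 = m.-1 + (N + N))%N by have := double_gt0; lia.
rewrite modnDr modn_small; last by lia.
rewrite -{2}(prednK m0) fold_mapS //.
by move: c0; rewrite -{1}(prednK m0) /coord /= negbK.
Qed.

Lemma folded_meet (m n : 'I_(N + N)) p q : m <> n -> in_sector p -> in_sector q ->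
  fold_map m p = fold_map n q -> p = q /\ exists2 b, dist b p = 0 & n = nbr b m.
Proof.
have step (a b : 'I_(N + N)) z w : (a < b)%N -> in_sector z -> in_sector w ->
    fold_map a z = fold_map b w -> z = w /\ exists c, [/\ dist c z = 0, b = nbr c a & a = nbr c b].
  move=> ab zs ws e; have h : (a < b < N + N)%N by rewrite ab ltn_ord.
  have [zw [[ba c0]|[a0 bN c0]]] := sector_meet h zs ws e; split=> //.
    exists (~~ odd a); rewrite -coordE c0; split; [by []|apply: ord_inj; rewrite nbrP..].
      by rewrite addNb addbb /= modn_small -ba // ltn_ord.
    rewrite ba /= addbb /= -ba; have -> : (b + (N + N).-1 = a + (N + N))%N.
      by rewrite ba; have := double_gt0; lia.
    by rewrite modnDr modn_small.
  exists false; move: c0; rewrite a0 /coord /= => c0; split; [exact: c0|apply: ord_inj; rewrite nbrP..].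
    by rewrite bN a0 /= add0n modn_small //; have := double_gt0; lia.
  by rewrite bN odd_last /= (prednK double_gt0) modnn.
move=> mn ps qs e; have [lt|gt|eq] := ltngtP m n.
- by have [pq [c [c0 nc _]]] := step _ _ _ _ lt ps qs e; split=> //; exists c.
- have [qp [c [c0 _ nc]]] := step _ _ _ _ gt qs ps (esym e).
  by split=> //; exists c => //; rewrite -qp.
- by case: mn; exact: val_inj.
Qed.

End Sectors.

(** * Unfolding a configuration in one sector *)

Section FoldedComplex.
Variables (R : realType) (N : nat) (zeta : plane R).
Hypothesis N1 : (1 < N)%N.
Hypothesis zeta1 : norm2 zeta = 1.
Hypothesis zetaN : cpow zeta N = (-1, 0).
Hypothesis zeta_pos : forall j, (0 < j < N)%N -> 0 < (cpow zeta j).2.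

Variables (T : finType) (pt : T -> 'I_3 -> plane R).
Variable nb : T -> 'I_3 -> bool + T * 'I_3.

Local Notation pw := (cpow zeta).
Local Notation dist := (dist zeta).
Local Notation fold_map := (fold_map zeta).
Local Notation coord := (coord zeta).
Local Notation in_sector := (in_sector zeta).

(** Forgets the partner's corner: injectivity of the key says that a triangle touches no other
    triangle, and no mirror, at two corners. *)
Definition nb_key (x : bool + T * 'I_3) : bool + T :=
  match x with inl b => inl b | inr y => inr y.1 end.

(* No edge of the triangle of p continues an edge of the mirror image of the triangle
   of q through the point r of the mirror b. *)
Definition mirror_straight b p q r := dist b p = dist b q /\
  dist (~~ b) p + dist (~~ b) q + 2 * zeta.1 * dist b q = 2 * dist (~~ b) r.

Hypothesis pt_unit : forall a, unit3 (pt a (@Ordinal 3 0 isT)) (pt a (@Ordinal 3 1 isT)) (pt a (@Ordinal 3 2 isT)).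
Hypothesis pt_sector : forall a k, in_sector (pt a k).
Hypothesis nb_mirror : forall a k b, nb a k = inl b -> dist b (pt a k) = 0.
Hypothesis nb_inner : forall a k a' k', nb a k = inr (a', k') -> pt a' k' = pt a k /\ a' <> a.
Hypothesis nb_inj : forall a k l, nb_key (nb a k) = nb_key (nb a l) -> k = l.
Hypothesis pt_meet : forall a b x, a <> b -> solid pt a x -> solid pt b x ->
  exists k k', x = pt a k /\ nb a k = inr (b, k').
Hypothesis mirror_meet : forall a b x, solid pt a x -> dist b x = 0 ->
  exists k, x = pt a k /\ nb a k = inl b.
Hypothesis inner_straight : forall a k a' k' k1 l1, nb a k = inr (a', k') ->
  k1 <> k -> l1 <> k' -> pt a k1 + pt a' l1 <> pt a k + pt a k.
Hypothesis mirror_not_straight : forall a k b k1 l1, nb a k = inl b ->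
  k1 <> k -> l1 <> k -> ~ mirror_straight b (pt a k1) (pt a l1) (pt a k).
Hypothesis nb_no_3cycle : forall a k b k' l c l' m m', nb a k = inr (b, k') ->
  nb b l = inr (c, l') -> nb c m <> inr (a, m').

Definition fold_pt (i : 'I_(N + N) * T) k : plane R := fold_map i.1 (pt i.2 k).

Definition fold_sg (i : 'I_(N + N) * T) k : ('I_(N + N) * T) * 'I_3 :=
  match nb i.2 k with
  | inl b => ((nbr b i.1, i.2), k)
  | inr (a, l) => ((i.1, a), l)
  end.

Lemma fold_map_sqd m p q : sqd (fold_map m p) (fold_map m q) = sqd p q.
Proof.
by rewrite /fold_map; case: ifP => _; rewrite sqd_cmul ?sqd_conj // norm2X.
Qed.

Lemma fold_map_bary m u v w a b c : fold_map m (bary u v w a b c) =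
  bary u v w (fold_map m a) (fold_map m b) (fold_map m c).
Proof.
by rewrite /fold_map !baryE; case: ifP => _; rewrite /cmul /conjp /=; congr (_, _); ring.
Qed.

Lemma fold_mapD m p q : fold_map m p + fold_map m q = fold_map m (p + q).
Proof.
by rewrite /fold_map; case: ifP => _; rewrite /cmul /conjp /=; apply: plane_eq => /=; ring.
Qed.

Lemma fold_map_inj m p q : fold_map m p = fold_map m q -> p = q.
Proof.
rewrite /fold_map; case: ifP => _ /(cmul_inj (norm2X _ zeta1)) //.
by rewrite /conjp => -[e1 e2]; apply: plane_eq => //; apply: oppr_inj.
Qed.

Lemma solid_fold i x : solid fold_pt i x ->
  exists p, [/\ x = fold_map i.1 p, solid pt i.2 p & in_sector p].
Proof.
move=> [u [v [w [u0 v0 w0 s ->]]]].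
exists (bary u v w (pt i.2 (@Ordinal 3 0 isT)) (pt i.2 (@Ordinal 3 1 isT)) (pt i.2 (@Ordinal 3 2 isT))).
split; first by rewrite fold_map_bary.
- by exists u, v, w.
- exact: in_sector_bary.
Qed.

(** Since [zeta] has norm 1, [pw k.+2 = 2 * zeta.1 * pw k.+1 - pw k]. Comparing coordinates in the
    basis [pw k], [pw k.+1] yields the two equations of [mirror_straight]. *)
Lemma straight_step k p q r : coord k r = 0 ->
  fold_map k p + fold_map k.+1 q = fold_map k r + fold_map k r ->
  mirror_straight (~~ odd k) p q r.
Proof.
move=> r0 /(congr1 (fun z => zeta.2 *: z)).
rewrite !scalerDr !fold_map_coord // r0 scale0r add0r.
have -> : coord k.+2 q = coord k q by rewrite /coord /= negbK.
have key A B A' B' C : A *: pw k + B *: pw k.+1 + (A' *: pw k.+1 + B' *: pw k.+2) =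
    C *: pw k.+1 + C *: pw k.+1 -> A = B' /\ B + A' + 2 * zeta.1 * B' = 2 * C.
  have s0 := zeta2_gt0 N1 zeta_pos.
  rewrite /=; set u := pw k; rewrite !scale_planeE /cmul /= => -[e1 e2].
  pose X := B + A' + 2 * zeta.1 * B' - 2 * C.
  have z1 v : B' * v * (zeta.1 ^+ 2 + zeta.2 ^+ 2) = B' * v.
    by rewrite [_ ^+ 2 + _]zeta1 mulr1.
  (* Divided by [u], the equation is [(A - B') + X * zeta = 0], and [zeta] is not real. *)
  have h : cmul u (A - B' + X * zeta.1, X * zeta.2) = cmul u (0, 0).
    rewrite /cmul /X; apply: plane_eq => /=.
      by have := z1 u.1; lra.
    by have := z1 u.2; lra.
  have [x1 x2] := cmul_inj (norm2X k zeta1) h.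
  have X0 : X = 0.
    by apply/eqP; move/eqP: x2; rewrite mulf_eq0 (gt_eqF s0) orbF.
  by move: x1; rewrite X0; rewrite /X in X0 *; split; lra.
move/key => [e1 e2]; split; first by move: e1; rewrite !coordE.
by move: e1 e2; rewrite !coordE /= !negbK => _.
Qed.

Lemma straight_nbr b (m : 'I_(N + N)) p q r : dist b r = 0 ->
  fold_map m p + fold_map (nbr b m) q = fold_map m r + fold_map m r ->
  mirror_straight b p q r.
Proof.
have symm b' p' q' : mirror_straight b' q' p' r -> mirror_straight b' p' q' r.
  by move=> [e1 e2]; split=> //; rewrite -e2 e1; ring.
have full z : fold_map (N + N) z = fold_map 0 z.
  rewrite /fold_map; have -> : odd (N + N) = false by rewrite addnn odd_double.
  by rewrite /= -[X in pw X]addn0 pw_addNN.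
move=> db; rewrite nbrP //; have m2 := ltn_ord m; case: ifP => bm.
  have bE : b = ~~ odd m by case: b bm {db}; case: (odd m).
  have c0 : coord m r = 0 by rewrite coordE -bE.
  have -> : fold_map (m.+1 %% (N + N)) q = fold_map m.+1 q.
    have [mN|mN] := ltnP m.+1 (N + N); first by rewrite modn_small.
    have -> : m.+1 = (N + N)%N by lia.
    by rewrite modnn full.
  by rewrite bE; exact: straight_step.
have bE : b = odd m by case: b bm {db}; case: (odd m).
(* The sector before [m], cyclically: [straight_step] applies to it with [p] and [q] exchanged. *)
have [k [mk [-> mz]]] : exists k : nat, odd m = ~~ odd k /\
    ((m + (N + N).-1) %% (N + N) = k /\ forall z, fold_map m z = fold_map k.+1 z)%N.
  have [m0|m0] := posnP m.
    exists (N + N).-1; split; last split.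
    - rewrite m0; have -> : (N + N).-1 = (N.-1 + N.-1).+1 by move: N1; clear; lia.
      by rewrite /= addnn odd_double.
    - by rewrite m0 add0n modn_small //; move: N1; clear; lia.
    - by move=> z; rewrite prednK ?full ?m0 //; move: N1; clear; lia.
  exists m.-1; split; last split.
  - by rewrite -{1}(prednK m0).
  - have -> : (m + (N + N).-1 = m.-1 + (N + N))%N by move: N1 m0; clear; lia.
    by rewrite modnDr modn_small //; lia.
  - by move=> z; rewrite prednK.
rewrite !mz => e; apply: symm.
have c0 : coord k r = 0 by rewrite coordE -mk -bE.
rewrite bE mk; apply: straight_step => //.
by rewrite addrC e (fold_mapS N1 zeta1 zeta_pos c0).
Qed.

Lemma fold_meet i j x : i <> j -> solid fold_pt i x -> solid fold_pt j x ->
  exists2 k, x = fold_pt i k & (fold_sg i k).1 = j.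
Proof.
case: i j => m a [n b] ij /solid_fold[p /= [xp pa ps]] /solid_fold[q /= [xq qb qs]].
have [mn|/eqP mn] := eqVneq m n.
  subst n; have pq : p = q by apply: (@fold_map_inj m); rewrite -xp.
  have ab : a <> b by move=> ab; apply: ij; rewrite ab.
  rewrite -pq in qb; have [k [k' [pk nk]]] := pt_meet ab pa qb.
  by exists k; rewrite /fold_pt /fold_sg /= ?nk // xp pk.
have [pq [c pc nc]] := folded_meet N1 zeta1 zetaN zeta_pos mn ps qs (etrans (esym xp) xq).
have [k [pk nk]] := mirror_meet pa pc.
exists k; rewrite /fold_pt /fold_sg /= ?nk /= ?xp ?pk // -nc.
(* Were the two triangles copies of different ones, the corner on the mirror would also be shared
   inside the sector, giving [nb] two values. *)
congr (_, _); apply/eqP/negP => /negP/eqP ab.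
rewrite -pq in qb; have [k' [k'' [pk' nk']]] := pt_meet ab pa qb.
have kk' : k = k' by apply: (P_inj pt_unit (i := a)); rewrite -pk -pk'.
by move: nk'; rewrite -kk' nk.
Qed.

Lemma folded_complex n : (0 < #|T|)%N -> ((N + N) * #|T| <= n)%N ->
  exists (V : set (plane R)) (E T : set (set (plane R))),
    [/\ planar_unit_distance_graph V E,
        four_regular V E,
        consists_of_unit_triangles V E T,
        without_additional_triangles E T
      & T #<= `I_n].
Proof.
move=> /card_gt0P[a0 _] Tn.
have N0 := double_gt0 N1.
apply: (@triangle_complex R _ fold_pt fold_sg _ _ _ _ _ _ _ (Ordinal N0, a0) n).
- by move=> [m a]; have [ab bc ca] := pt_unit a; split; rewrite fold_map_sqd.
- move=> [m a] k; rewrite /fold_sg /fold_pt /=; case e : (nb a k) => [b|[a' k']] /=.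
    by rewrite fold_nbr //; exact: nb_mirror e.
  by have [-> _] := nb_inner e.
- move=> [m a] k; rewrite /fold_sg /=; case e : (nb a k) => [b|[a' k']] /= [].
    by move=> /(congr1 (fun z : 'I_(N + N) => odd z)); rewrite odd_nbr //; case: odd.
  by have [_] := nb_inner e.
- move=> [m a] k l; rewrite /fold_sg /=.
  case ek : (nb a k) => [b|[a' k']]; case el : (nb a l) => [b'|[a'' l']] /= [].
  + move=> bb; apply: (@nb_inj a); rewrite ek el /=; congr inl.
    case: b b' bb {ek el} => [] [] // bb; exfalso; apply: (@nbr_neq N N1 m); first exact: bb.
    exact: esym bb.
  + by move=> /(congr1 (fun z : 'I_(N + N) => odd z)); rewrite odd_nbr //; case: odd.
  + by move=> /(congr1 (fun z : 'I_(N + N) => odd z)); rewrite odd_nbr //; case: odd.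
  + by move=> aa; apply: (@nb_inj a); rewrite ek el /= aa.
- exact: fold_meet.
- move=> [m a] k k' l'; rewrite /fold_sg /fold_pt /=; case e : (nb a k) => [b|[a' k'']] /=.
    move=> k1 l1 h; apply: (mirror_not_straight e k1 l1).
    by apply: straight_nbr h; exact: nb_mirror e.
  move=> k1 l1; rewrite !fold_mapD => /fold_map_inj.
  exact: inner_straight e k1 l1.
- move=> [m a] k l q; rewrite /fold_sg /=.
  (* Crossing a mirror changes the parity of the sector, so a closed walk of length 3 crosses none
     or two. Two crossings would leave one inner step from a triangle to itself; none is a cycle
     inside the sector. *)
  have par (b : bool) (z w : 'I_(N + N)) : nbr b z = w -> odd w = ~~ odd z.
    by move=> <-; rewrite odd_nbr.
  case e1 : (nb a k) => [b1|[a1 k1]] /=; case e2 : (nb _ l) => [b2|[a2 k2]] /=;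
    case e3 : (nb _ q) => [b3|[a3 k3]] /= [].
  + by move=> /par; rewrite !odd_nbr // !negbK; case: odd.
  + by move=> _ e; have [_] := nb_inner e3; rewrite e.
  + by move=> _ e; have [_] := nb_inner e2; rewrite e.
  + by move=> /(congr1 (fun z : 'I_(N + N) => odd z)); rewrite odd_nbr //; case: odd.
  + by move=> _ e; have [_] := nb_inner e1; rewrite e.
  + by move=> /(congr1 (fun z : 'I_(N + N) => odd z)); rewrite odd_nbr //; case: odd.
  + by move=> /par; case: odd.
  + by move=> e; apply: (nb_no_3cycle e1 e2 (m := q) (m' := k3)); rewrite e3 e.
- by rewrite card_prod card_ord.
Qed.

End FoldedComplex.

(** * Ball arithmetic *)

(** Locked, so that the images of large integers are never unfolded. *)
HB.lock Definition ZR (R : realType) (z : Z) : R := (int_of_Z z)%:~R.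

Section ZtoR.
Variable R : realType.
Local Notation ZR := (ZR R).

Lemma ZRD a b : ZR (a + b)%coqZ = ZR a + ZR b.
Proof. by rewrite ZR.unlock (rmorphD int_of_Z) intrD. Qed.
Lemma ZRN a : ZR (- a)%coqZ = - ZR a.
Proof. by rewrite ZR.unlock (rmorphN int_of_Z) mulrNz. Qed.
Lemma ZRB a b : ZR (a - b)%coqZ = ZR a - ZR b.
Proof. by rewrite -ZRN -ZRD. Qed.
Lemma ZRM a b : ZR (a * b)%coqZ = ZR a * ZR b.
Proof. by rewrite ZR.unlock (rmorphM int_of_Z) intrM. Qed.
Lemma ZR0 : ZR 0 = 0. Proof. by rewrite ZR.unlock. Qed.
Lemma ZR1 : ZR 1 = 1. Proof. by rewrite ZR.unlock /= /Pos.to_nat. Qed.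
Lemma ZR2 : ZR 2 = 2. Proof. by rewrite (ZRD 1 1) ZR1. Qed.

Lemma ler_ZR a b : (ZR a <= ZR b) <-> (a <= b)%coqZ.
Proof. by rewrite ZR.unlock ler_int; lia. Qed.

Lemma ltr_ZR a b : (ZR a < ZR b) <-> (a < b)%coqZ.
Proof. by rewrite ZR.unlock ltr_int; lia. Qed.

Lemma ZR_abs a : ZR (Z.abs a) = `|ZR a|.
Proof.
have [a0|a0] := Z_le_gt_dec 0 a.
  have h : 0 <= ZR a by rewrite -ZR0; apply/ler_ZR; lia.
  by rewrite (Z.abs_eq _ a0) (ger0_norm h).
have a1 : (a <= 0)%coqZ by lia.
have h : ZR a <= 0 by rewrite -ZR0; apply/ler_ZR; lia.
by rewrite (Z.abs_neq _ a1) ZRN (ler0_norm h).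
Qed.

Lemma ZR_div a b : (0 < b)%coqZ ->
  ZR (Z.div a b) <= ZR a / ZR b /\ ZR a / ZR b < ZR (Z.div a b) + 1.
Proof.
move=> b0; have b0' : 0 < ZR b by rewrite -ZR0; apply/ltr_ZR.
rewrite ler_pdivlMr // ltr_pdivrMr // -ZR1 -ZRD -!ZRM; split.
  by apply/ler_ZR; have := Z.mul_div_le a b b0; lia.
by apply/ltr_ZR; have := Z.mul_succ_div_gt a b b0; lia.
Qed.

End ZtoR.

(* A pair (m, r) of integers stands for the interval of radius r / 2^prec around
   m / 2^prec. *)
Section Balls.
Variables (R : realType) (prec : Z).
Hypothesis prec0 : (0 <= prec)%coqZ.
Local Notation ZR := (ZR R).

Definition one := Z.shiftl 1 prec.
Let K := ZR one.

Lemma oneE : one = (2 ^ prec)%coqZ. Proof. by rewrite /one Z.shiftl_1_l. Qed.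

Lemma one_gt0 : (0 < one)%coqZ.
Proof. by rewrite oneE; apply: Z.pow_pos_nonneg. Qed.

Lemma K_gt0 : 0 < K.
Proof. by rewrite /K -(ZR0 R); apply/ltr_ZR; exact: one_gt0. Qed.

Definition in_ball (x : R) (b : Z * Z) := `|x * K - ZR b.1| <= ZR b.2.

Definition ball_add (a b : Z * Z) : Z * Z := (a.1 + b.1, a.2 + b.2)%coqZ.
Definition ball_sub (a b : Z * Z) : Z * Z := (a.1 - b.1, a.2 + b.2)%coqZ.
(** The radius bounds [a.1 * (y - b.1) + y * (x - a.1)]; the added 2 pays for rounding down the
    midpoint and the radius, here and below. *)
Definition ball_mul (a b : Z * Z) : Z * Z :=
  (Z.shiftr (a.1 * b.1) prec,
   Z.shiftr (Z.abs a.1 * b.2 + (Z.abs b.1 + b.2) * a.2) prec + 2)%coqZ.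
Definition ball_half (a : Z * Z) : Z * Z := (Z.shiftr a.1 1, Z.shiftr a.2 1 + 2)%coqZ.
Definition ball_sqrt (a : Z * Z) : option (Z * Z) :=
  if (Z.ltb a.2 a.1 && Z.leb 0 a.2)%coqZ then
    let s := Z.sqrt (Z.shiftl a.1 prec) in
    Some (s, Z.div (Z.shiftl a.2 prec) s + 2)%coqZ
  else None.
Definition ball_inv (a : Z * Z) : option (Z * Z) :=
  if (Z.ltb a.2 a.1 && Z.leb 0 a.2)%coqZ then
    Some (Z.div (Z.shiftl one prec) a.1,
          Z.div (Z.shiftl (Z.shiftl a.2 prec) prec) ((a.1 - a.2) * a.1) + 2)%coqZ
  else None.

Lemma ball_ge0 x b : in_ball x b -> 0 <= ZR b.2.
Proof. by move=> h; apply: le_trans h; exact: normr_ge0. Qed.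

Lemma shiftr_bound z : ZR (Z.shiftr z prec) <= ZR z / K /\ ZR z / K < ZR (Z.shiftr z prec) + 1.
Proof. by rewrite Z.shiftr_div_pow2 // -oneE; apply: ZR_div; exact: one_gt0. Qed.

Lemma shiftl_one z : ZR (Z.shiftl z prec) = ZR z * K.
Proof. by rewrite Z.shiftl_mul_pow2 // -oneE ZRM. Qed.

Lemma in_ball_add x y a b : in_ball x a -> in_ball y b -> in_ball (x + y) (ball_add a b).
Proof.
rewrite /in_ball /= !ZRD mulrDl => xa yb.
have -> : x * K + y * K - (ZR a.1 + ZR b.1) = (x * K - ZR a.1) + (y * K - ZR b.1) by ring.
by apply: le_trans (ler_normD _ _) _; exact: lerD.
Qed.

Lemma in_ball_sub x y a b : in_ball x a -> in_ball y b -> in_ball (x - y) (ball_sub a b).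
Proof.
rewrite /in_ball /= ZRB ZRD mulrBl => xa yb.
have -> : x * K - y * K - (ZR a.1 - ZR b.1) = (x * K - ZR a.1) - (y * K - ZR b.1) by ring.
by apply: le_trans (ler_normB _ _) _; exact: lerD.
Qed.

Lemma in_ball_half x a : in_ball x a -> in_ball (x / 2) (ball_half a).
Proof.
rewrite /in_ball /= !Z.shiftr_div_pow2 // => xa.
have [m1 m2] := ZR_div R a.1 (b := (2 ^ 1)%coqZ) erefl.
have [r1 r2] := ZR_div R a.2 (b := (2 ^ 1)%coqZ) erefl.
move: xa m1 m2 r1 r2; rewrite ZRD (_ : (2 ^ 1)%coqZ = 2%coqZ) // !ZR2.
set q := ZR (_ / _); set q' := ZR (_ / _); rewrite !ler_norml => /andP[h1 h2] m1 m2 r1 r2.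
by apply/andP; split; lra.
Qed.

Lemma in_ball_mul x y a b : in_ball x a -> in_ball y b -> in_ball (x * y) (ball_mul a b).
Proof.
move=> xa yb; have a0 := ball_ge0 xa; have b0 := ball_ge0 yb; move: xa yb.
rewrite /in_ball /= ZRD ZR2 => xa yb.
set e := (Z.abs a.1 * b.2 + _)%coqZ.
have [q1 q2] := shiftr_bound (a.1 * b.1); have [e1 e2] := shiftr_bound e.
have K0 := K_gt0.
have he : `|x * K * (y * K) - ZR a.1 * ZR b.1| <= ZR e.
  have -> : x * K * (y * K) - ZR a.1 * ZR b.1 =
     ZR a.1 * (y * K - ZR b.1) + (y * K) * (x * K - ZR a.1) by ring.
  apply: le_trans (ler_normD _ _) _; rewrite (normrM (ZR a.1)) (normrM (y * K)) /e ZRD !ZRM ZRD !ZR_abs.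
  apply: lerD; first by rewrite ler_wpM2l.
  apply: ler_pM => //.
  have -> : y * K = ZR b.1 + (y * K - ZR b.1) by ring.
  by apply: le_trans (ler_normD _ _) _; rewrite lerD2l.
have hk : `|x * y * K - ZR (a.1 * b.1) / K| <= ZR e / K.
  rewrite ZRM ler_pdivlMr // -{3}(gtr0_norm K0) -normrM.
  by have -> : (x * y * K - ZR a.1 * ZR b.1 / K) * K = x * K * (y * K) - ZR a.1 * ZR b.1
    by field; rewrite gt_eqF.
move: hk; rewrite !ler_norml => /andP[h1 h2].
by apply/andP; split; lra.
Qed.

Lemma in_ball_bounds x a : in_ball x a -> (a.2 < a.1)%coqZ -> 0 < x.
Proof.
rewrite /in_ball ler_norml => /andP[h1 h2] /(ltr_ZR R) h.
rewrite -(pmulr_lgt0 _ K_gt0); lra.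
Qed.

(** The error is bounded through [(w - v) * (w + v) = w ^+ 2 - v ^+ 2] and [w + v >= s], where [w]
    and [v] are the scaled roots of [x] and of the midpoint. *)
Lemma in_ball_sqrt x a b : in_ball x a -> ball_sqrt a = Some b ->
  in_ball (Num.sqrt x) b /\ 0 < x.
Proof.
move=> xa; rewrite /ball_sqrt; case: andP => // -[/Z.ltb_lt am /Z.leb_le a0] [<-].
have x0 := in_ball_bounds xa am; split=> //.
have K0 := K_gt0.
have m1 : (1 <= a.1)%coqZ by lia.
set s := Z.sqrt _; set e := Z.div _ _.
have mK : (1 <= Z.shiftl a.1 prec)%coqZ.
  by rewrite Z.shiftl_mul_pow2 // -oneE; have := one_gt0; nia.
have s1 : (1 <= s)%coqZ.
  by have := Z.sqrt_le_mono _ _ mK; rewrite Z.sqrt_1.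
have [] := Z.sqrt_spec (Z.shiftl a.1 prec) (ltac:(lia)); rewrite -/s => /(ler_ZR R) s2 /(ltr_ZR R) s3.
have sK := shiftl_one a.1.
have [e1 e2] := ZR_div R (Z.shiftl a.2 prec) (b := s) (ltac:(lia)).
rewrite -/e shiftl_one in e1 e2.
move: s2 s3; rewrite sK !ZRM -Z.add_1_r ZRD ZR1 => s2 s3.
have s0 : 1 <= ZR s by rewrite -(ZR1 R); apply/ler_ZR; lia.
pose w := Num.sqrt x * K; pose v := Num.sqrt (ZR a.1 * K).
have m0 : 0 <= ZR a.1 * K by rewrite mulr_ge0 ?(ltW K0) // -(ZR0 R); apply/ler_ZR; lia.
have v2 : v ^+ 2 = ZR a.1 * K by rewrite sqr_sqrtr.
have v0 : 0 <= v by exact: sqrtr_ge0.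
have w0 : 0 <= w by rewrite mulr_ge0 ?sqrtr_ge0 // ltW.
have w2 : w ^+ 2 = (x * K) * K by rewrite exprMn sqr_sqrtr ?(ltW x0) //; ring.
have vs1 : ZR s <= v.
  have s0' : 0 <= ZR s by lra.
  by rewrite -(@ler_pXn2r _ 2) ?nnegrE // v2 expr2.
have vs2 : v < ZR s + 1.
  have s0' : 0 <= ZR s + 1 by lra.
  by rewrite -(@ltr_pXn2r _ 2) ?nnegrE // v2 expr2.
have wv : `|w - v| <= ZR a.2 * K / ZR s.
  rewrite ler_pdivlMr; last by lra.
  apply: (@le_trans _ _ (`|w - v| * (w + v))).
    by rewrite ler_wpM2l //; lra.
  rewrite -[X in _ * X <= _]ger0_norm ?addr_ge0 // -normrM -subr_sqr w2 v2 -mulrBl normrM (gtr0_norm K0).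
  by rewrite ler_wpM2r // ltW.
rewrite /in_ball /= ZRD ZR2 -/w; move: wv; rewrite !ler_norml => /andP[h1 h2].
by apply/andP; split; lra.
Qed.

(** With [m] the midpoint and [r] the radius, [1 / x - 1 / m = (m - x) / (x * m)], and [x] is at
    least [m - r] in scaled units. *)
Lemma in_ball_inv x a b : in_ball x a -> ball_inv a = Some b -> in_ball x^-1 b /\ 0 < x.
Proof.
move=> xa; rewrite /ball_inv; case: andP => // -[/Z.ltb_lt am /Z.leb_le a0] [<-].
have x0 := in_ball_bounds xa am; split=> //.
have K0 := K_gt0.
have m1 : (1 <= a.1)%coqZ by lia.
rewrite /in_ball /= ZRD ZR2.
have [q1 q2] := ZR_div R (Z.shiftl one prec) (b := a.1) (ltac:(lia)).
have d0 : (0 < (a.1 - a.2) * a.1)%coqZ by nia.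
have [e1 e2] := ZR_div R (Z.shiftl (Z.shiftl a.2 prec) prec) d0.
move: q1 q2 e1 e2; set q := Z.div _ _; set e := Z.div _ _.
rewrite !shiftl_one -/K ZR1 mul1r ZRM ZRB => q1 q2 e1 e2.
set m := ZR a.1 in q1 q2 e1 e2 *; set r := ZR a.2 in e1 e2.
have m0 : 0 < m by rewrite /m -(ZR0 R); apply/ltr_ZR; lia.
have rm : 0 < m - r by rewrite subr_gt0; apply/ltr_ZR.
have xK : m - r <= x * K by move: xa; rewrite /in_ball ler_norml => /andP[]; rewrite -/m -/r; lra.
have xm : `|m - x * K| <= r by rewrite distrC.
have h : `|x^-1 * K - K * K / m| <= r * K * K / ((m - r) * m).
  have -> : x^-1 * K - K * K / m = (m - x * K) * (K * K / (x * K * m)).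
    by field; rewrite !gt_eqF.
  have xKm : 0 < x * K * m by rewrite !mulr_gt0.
  rewrite normrM (@ger0_norm _ (K * K / _)); last by rewrite divr_ge0 ?mulr_ge0 // ltW.
  have -> : r * K * K / ((m - r) * m) = r * (K * K / ((m - r) * m)).
    by field; rewrite !gt_eqF.
  apply: ler_pM => //; first by rewrite divr_ge0 ?mulr_ge0 // ltW.
  rewrite ler_wpM2l ?mulr_ge0 ?(ltW K0) // lef_pV2 ?posrE ?mulr_gt0 //.
  by rewrite ler_wpM2r // ltW.
move: h; rewrite !ler_norml => /andP[h1 h2].
by apply/andP; split; lra.
Qed.

Lemma in_ball_exact z : in_ball (ZR z / K) (z, 0%coqZ).
Proof. by rewrite /in_ball /= divfK ?gt_eqF ?K_gt0 // subrr normr0 ZR0. Qed.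

End Balls.

Section BallShift.
Variables (R : realType) (prec k : Z).
Hypotheses (k0 : (0 <= k)%coqZ) (kprec : (k <= prec)%coqZ).

(** Drops [k] bits of precision, so that checks with large margins run on small integers. *)
Definition ball_shift (a : Z * Z) : Z * Z := (Z.shiftr a.1 k, Z.shiftr a.2 k + 2)%coqZ.

Lemma in_ball_shift (x : R) a : in_ball prec x a -> in_ball (prec - k) x (ball_shift a).
Proof.
have k1 : (0 < 2 ^ k)%coqZ by apply: Z.pow_pos_nonneg.
rewrite /in_ball /= !Z.shiftr_div_pow2 // !oneE; try by lia.
have -> : (2 ^ prec = 2 ^ (prec - k) * 2 ^ k)%coqZ.
  by rewrite -Z.pow_add_r; [congr Z.pow; lia|lia|lia].
have [m1 m2] := ZR_div R a.1 k1; have [r1 r2] := ZR_div R a.2 k1.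
have k2 : 0 < ZR R (2 ^ k)%coqZ by rewrite -(ZR0 R); apply/ltr_ZR.
move: m1 m2 r1 r2; rewrite ZRM !ZRD ZR2.
set q := ZR _ (_ / _)%coqZ; set q' := ZR _ (_ / _)%coqZ.
set K := ZR _ (2 ^ k)%coqZ in k2 *; set L := ZR _ (2 ^ (_ - _))%coqZ.
move=> m1 m2 r1 r2 h.
have : `|x * L - ZR R a.1 / K| <= ZR R a.2 / K.
  rewrite ler_pdivlMr // -{2}(gtr0_norm k2) -normrM mulrBl divfK ?gt_eqF //.
  by rewrite -mulrA.
rewrite !ler_norml => /andP[h1 h2].
by apply/andP; split; lra.
Qed.

End BallShift.

(** * Ruler and compass programs *)

(** A construction is written once over abstract operations and run both on real numbers and on
    enclosures. *)
Record arith := Arith {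
  acar : Type;
  aadd : acar -> acar -> acar;
  asub : acar -> acar -> acar;
  amul : acar -> acar -> acar;
  ahalf : acar -> acar;
  asqrt : acar -> acar;
  ainv : acar -> acar;
  aint : Z -> acar }.

(** The first boolean of [Foot] selects the mirror, [true] being the line of [zeta]. The other
    boolean of each step chooses between two solutions. *)
Inductive step := Foot of bool & bool & nat | Apex of bool & nat & nat
  | Meet of bool & nat & nat.

Section Programs.
Variable A : arith.
Local Notation P := (acar A * acar A)%type.

Definition asg (b : bool) (x y : acar A) := if b then aadd x y else asub x y.

(* A point at distance 1 from p on the line spanned by (c, s). *)
Definition foot c s b (p : P) : P :=
  let u := aadd (amul c p.1) (amul s p.2) in
  let v := asub (amul s p.1) (amul c p.2) in
  let t := asg b u (asqrt (asub (aint A 1) (amul v v))) in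
  (amul c t, amul s t).

(* The third vertex of an equilateral triangle; h is the height of the unit one. *)
Definition apex h b (p q : P) : P :=
  let x := asub q.1 p.1 in let y := asub q.2 p.2 in
  (asg (~~ b) (aadd p.1 (ahalf x)) (amul h y), asg b (aadd p.2 (ahalf y)) (amul h x)).

(* A point at distance 1 from both p and q. *)
Definition meet b (p q : P) : P :=
  let x := asub q.1 p.1 in let y := asub q.2 p.2 in
  let k := asqrt (asub (ainv (aadd (amul x x) (amul y y))) (ahalf (ahalf (aint A 1)))) in
  (asg (~~ b) (ahalf (aadd p.1 q.1)) (amul k y), asg b (ahalf (aadd p.2 q.2)) (amul k x)).

Definition pnth (st : seq P) i := nth (aint A 0, aint A 0) st i.

Definition eval (c s h : acar A) (st : seq P) (i : step) : P :=
  match i with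
  | Foot m b p => if m then foot c s b (pnth st p) else foot (aint A 1) (aint A 0) b (pnth st p)
  | Apex b p q => apex h b (pnth st p) (pnth st q)
  | Meet b p q => meet b (pnth st p) (pnth st q)
  end.

Definition height := ahalf (asqrt (aint A 3)).

Definition run c s (st : seq P) (prog : seq step) : seq P :=
  foldl (fun st i => rcons st (eval c s height st i)) st prog.

Definition closed_step n (i : step) :=
  match i with
  | Foot _ _ p => (p < n)%N
  | Apex _ p q => (p < n)%N && (q < n)%N
  | Meet _ p q => (p < n)%N && (q < n)%N
  end.

Lemma size_run c s st prog : size (run c s st prog) = (size st + size prog)%N.
Proof.
elim: prog st => [|i prog IH] st /=; first by rewrite addn0.
by rewrite IH size_rcons addnS.
Qed.

Lemma run_prefix c s st prog k : (k < size st)%N ->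
  pnth (run c s st prog) k = pnth st k.
Proof.
elim: prog st => [|i prog IH] st //= ks.
by rewrite IH ?size_rcons ?ltnS ?(ltnW ks) // /pnth nth_rcons ks.
Qed.

(** A step refers only to earlier points, which later steps leave unchanged, so its equation can be
    read in the final list. *)
Lemma run_nth c s st prog k i0 : (k < size prog)%N ->
  closed_step (size st + k) (nth i0 prog k) ->
  pnth (run c s st prog) (size st + k) = eval c s height (run c s st prog) (nth i0 prog k).
Proof.
elim: prog st k => [|i prog IH] st [|k] //= ks.
  rewrite addn0 => ci; rewrite run_prefix ?size_rcons //.
  rewrite {1}/pnth nth_rcons ltnn eqxx.
  have pre j : (j < size st)%N -> pnth st j = pnth (run c s (rcons st (eval c s height st i)) prog) j.
    by move=> js; rewrite run_prefix ?size_rcons ?ltnS ?(ltnW js) // /pnth nth_rcons js.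
  move: (run c s (rcons st _) prog) pre => r pre.
  case: i ci => [m b p|b p q|b p q] /=.
  - by move=> cp; rewrite (pre _ cp).
  - by move=> /andP[cp cq]; rewrite (pre _ cp) (pre _ cq).
  - by move=> /andP[cp cq]; rewrite (pre _ cp) (pre _ cq).
move=> ck; have e : (size st + k.+1 = size (rcons st (eval c s height st i)) + k)%N.
  by rewrite size_rcons addSnnS.
by rewrite e in ck *; exact: IH.
Qed.

End Programs.

Section RealArith.
Variable R : realType.

Definition real_arith : arith := @Arith R (fun x y => x + y) (fun x y => x - y)
  (fun x y => x * y) (fun x => x / 2) (fun x => Num.sqrt x) (fun x => x^-1) (ZR R).

Local Notation RA := real_arith.
Implicit Types p q : plane R.

(** In the orthonormal frame of the line, [p] has coordinates [u] and [v], and the foot lies at [u]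
    plus or minus [sqrt (1 - v * v)]. *)
Lemma foot_unit (c s : R) b p : c ^+ 2 + s ^+ 2 = 1 ->
  0 < 1 - (s * p.1 - c * p.2) * (s * p.1 - c * p.2) -> sqd p (@foot RA c s b p) = 1.
Proof.
move=> cs r0; have e := sqr_sqrtr (ltW r0); move: e.
rewrite /foot /= /asg /= ZR1; set w := Num.sqrt _ => e; rewrite /sqd /=.
pose u := c * p.1 + s * p.2; pose v := s * p.1 - c * p.2.
have p1 : p.1 = c * u + s * v.
  by rewrite -[LHS]mul1r -cs /u /v; ring.
have p2 : p.2 = s * u - c * v by rewrite -[LHS]mul1r -cs /u /v; ring.
rewrite -/u -/v in e *; rewrite p1 p2.
have -> : forall t, (c * u + s * v - c * t) ^+ 2 + (s * u - c * v - s * t) ^+ 2 =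
   (c ^+ 2 + s ^+ 2) * ((u - t) ^+ 2 + v * v) by move=> t; ring.
rewrite cs mul1r; case: b; rewrite -[RHS](subrK (v * v)) -e; ring.
Qed.

Lemma height2 : (@height RA) ^+ 2 = 3 / 4.
Proof.
rewrite /height /= exprMn sqr_sqrtr; last by rewrite -(ZR0 R); apply/ler_ZR.
have -> : ZR R 3 = 3 by rewrite (ZRD R 2 1) ZR2 ZR1; lra.
by field.
Qed.

Lemma apex_unit b p q : sqd p q = 1 -> sqd p (@apex RA (@height RA) b p q) = 1 /\
  sqd q (@apex RA (@height RA) b p q) = 1.
Proof.
have := height2; set h := height _ => h2; rewrite /sqd /apex /= /asg /= => pq.
have E : ((p.1 - q.1) ^+ 2 + (p.2 - q.2) ^+ 2) * (4^-1 + h ^+ 2) = 1.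
  by rewrite pq h2; field.
by split; rewrite -[RHS]E; case: b => /=; field.
Qed.

(** With [D] the squared distance of [p] and [q], the apex has height [sqrt (1 - D / 4)] over the
    midpoint, which is [sqrt (1 / D - 1 / 4)] times the length of the rotated vector from [p] to
    [q]. *)
Lemma meet_unit b p q : 0 < (q.1 - p.1) * (q.1 - p.1) + (q.2 - p.2) * (q.2 - p.2) ->
  0 < ((q.1 - p.1) * (q.1 - p.1) + (q.2 - p.2) * (q.2 - p.2))^-1 - 1 / 2 / 2 ->
  sqd p (@meet RA b p q) = 1 /\ sqd q (@meet RA b p q) = 1.
Proof.
rewrite /sqd /meet /= /asg /= ZR1.
set D := _ + _ => D0 r0; have := sqr_sqrtr (ltW r0); set k := Num.sqrt _ => k2.
have kD : k ^+ 2 * D = 1 - D / 4 by rewrite k2 mulrBl mulVf ?gt_eqF //; field.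
have DE : D = (q.1 - p.1) * (q.1 - p.1) + (q.2 - p.2) * (q.2 - p.2) by [].
have E : k ^+ 2 * D + D / 4 = 1 by rewrite kD; ring.
by split; rewrite -[RHS]E DE; case: b => /=; field.
Qed.

End RealArith.

(* ((v, a), b) encloses the values of a function of two real parameters in v, and
   its difference quotients with respect to the two parameters in a and b. *)
Definition dual := ((Z * Z) * (Z * Z) * (Z * Z))%type.

Definition omap2 (T : Type) (f : T -> T -> T) (x y : option T) :=
  if x is Some a then if y is Some b then Some (f a b) else None else None.

Section DualArith.
Variable prec : Z.
Local Notation mul := (ball_mul prec).

Definition ball_int z : Z * Z := (Z.shiftl z prec, 0%coqZ).
Definition ball_opp (a : Z * Z) : Z * Z := ball_sub (ball_int 0) a.

Definition dual_add (d e : dual) : dual :=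
  (ball_add d.1.1 e.1.1, ball_add d.1.2 e.1.2, ball_add d.2 e.2).
Definition dual_sub (d e : dual) : dual :=
  (ball_sub d.1.1 e.1.1, ball_sub d.1.2 e.1.2, ball_sub d.2 e.2).
Definition dual_mul (d e : dual) : dual :=
  (mul d.1.1 e.1.1, ball_add (mul d.1.1 e.1.2) (mul e.1.1 d.1.2),
   ball_add (mul d.1.1 e.2) (mul e.1.1 d.2)).
Definition dual_half (d : dual) : dual := (ball_half d.1.1, ball_half d.1.2, ball_half d.2).
Definition dual_sqrt (d : dual) : option dual :=
  if ball_sqrt prec d.1.1 is Some r then
    if ball_inv prec (ball_add r r) is Some k then Some (r, mul k d.1.2, mul k d.2) else None
  else None.
Definition dual_inv (d : dual) : option dual :=
  if ball_inv prec d.1.1 is Some r then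
    let k := ball_opp (mul r r) in Some (r, mul k d.1.2, mul k d.2) else None.
Definition dual_const (b : Z * Z) : dual := (b, ball_int 0, ball_int 0).

Definition dual_arith : arith := @Arith (option dual)
  (omap2 dual_add) (omap2 dual_sub) (omap2 dual_mul) (omap dual_half)
  (obind dual_sqrt) (obind dual_inv) (fun z => Some (dual_const (ball_int z))).

Variable R : realType.
Hypothesis prec0 : (0 <= prec)%coqZ.
Variables dx dy : R.
Local Notation ib := (in_ball prec).

(** [u] and [w] are the values at two parameters that differ by [dx] and [dy]. A failed operation,
    [None], claims nothing. *)
Definition encl (u w : R) (o : option dual) := if o is Some d then
  [/\ ib u d.1.1, ib w d.1.1 & exists s t, [/\ ib s d.1.2, ib t d.2 & u - w = s * dx + t * dy]]
  else True.

Lemma in_ball_int z : ib (ZR R z) (ball_int z).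
Proof.
by rewrite /in_ball /ball_int /= shiftl_one // subrr normr0 ZR0.
Qed.

Lemma in_ball0 : ib (0 : R) (ball_int 0).
Proof. by rewrite -(ZR0 R); exact: in_ball_int. Qed.

Lemma in_ball_opp (x : R) b : ib x b -> ib (- x) (ball_opp b).
Proof. by move=> xb; rewrite -sub0r; apply: in_ball_sub => //; exact: in_ball0. Qed.

Lemma encl_const u b : ib u b -> encl u u (Some (dual_const b)).
Proof.
move=> ub; split=> //; exists 0, 0; split; try exact: in_ball0.
by rewrite subrr !mul0r addr0.
Qed.

Lemma encl_add u w u' w' d e : encl u w d -> encl u' w' e ->
  encl (u + u') (w + w') (omap2 dual_add d e).
Proof.
case: d => [d|] //=; case: e => [e|] //= [ud wd [s [t [sd td E]]]] [ue we [s' [t' [se te E']]]].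
split; try exact: in_ball_add.
exists (s + s'), (t + t'); split; try exact: in_ball_add.
have -> : u + u' - (w + w') = (u - w) + (u' - w') by ring.
by rewrite E E'; ring.
Qed.

Lemma encl_sub u w u' w' d e : encl u w d -> encl u' w' e ->
  encl (u - u') (w - w') (omap2 dual_sub d e).
Proof.
case: d => [d|] //=; case: e => [e|] //= [ud wd [s [t [sd td E]]]] [ue we [s' [t' [se te E']]]].
split; try exact: in_ball_sub.
exists (s - s'), (t - t'); split; try exact: in_ball_sub.
have -> : u - u' - (w - w') = (u - w) - (u' - w') by ring.
by rewrite E E'; ring.
Qed.

(** The exact product rule [u * u' - w * w' = u * (u' - w') + w' * (u - w)] mixes values at both
    parameters, which is why one ball has to enclose both. *)
Lemma encl_mul u w u' w' d e : encl u w d -> encl u' w' e ->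
  encl (u * u') (w * w') (omap2 dual_mul d e).
Proof.
case: d => [d|] //=; case: e => [e|] //= [ud wd [s [t [sd td E]]]] [ue we [s' [t' [se te E']]]].
split; try exact: in_ball_mul.
exists (u * s' + w' * s), (u * t' + w' * t); split.
- by apply: in_ball_add; apply: in_ball_mul.
- by apply: in_ball_add; apply: in_ball_mul.
have -> : u * u' - w * w' = u * (u' - w') + w' * (u - w) by ring.
by rewrite E E'; ring.
Qed.

Lemma encl_half u w d : encl u w d -> encl (u / 2) (w / 2) (omap dual_half d).
Proof.
case: d => [d|] //= [ud wd [s [t [sd td E]]]].
split; try exact: in_ball_half.
exists (s / 2), (t / 2); split; try exact: in_ball_half.
by rewrite -mulrBl E; ring.
Qed.

(** The difference quotient of the root is [1 / (sqrt u + sqrt w)]. *)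
Lemma encl_sqrt u w d : encl u w d -> encl (Num.sqrt u) (Num.sqrt w) (obind dual_sqrt d).
Proof.
case: d => [d|] //= [ud wd [s [t [sd td E]]]].
rewrite /dual_sqrt; case er : ball_sqrt => [r|] //; case ek : ball_inv => [k|] //.
have [ur u0] := in_ball_sqrt prec0 ud er; have [wr w0] := in_ball_sqrt prec0 wd er.
have [km m0] := in_ball_inv prec0 (in_ball_add ur wr) ek.
split=> //=; set m := _^-1 in km.
exists (m * s), (m * t); split; try exact: in_ball_mul.
have -> : m * s * dx + m * t * dy = m * (s * dx + t * dy) by ring.
rewrite -E -{2}(sqr_sqrtr (ltW u0)) -{2}(sqr_sqrtr (ltW w0)).
by rewrite /m; field; rewrite gt_eqF.
Qed.

(** The difference quotient of the inverse is [- 1 / (u * w)]. *)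
Lemma encl_inv u w d : encl u w d -> encl u^-1 w^-1 (obind dual_inv d).
Proof.
case: d => [d|] //= [ud wd [s [t [sd td E]]]].
rewrite /dual_inv; case er : ball_inv => [r|] //.
have [ur u0] := in_ball_inv prec0 ud er; have [wr w0] := in_ball_inv prec0 wd er.
split=> //=; pose m := - (u^-1 * w^-1).
have mk : ib m (ball_opp (mul r r)) by apply: in_ball_opp; exact: in_ball_mul.
exists (m * s), (m * t); split; try exact: in_ball_mul.
have -> : m * s * dx + m * t * dy = m * (s * dx + t * dy) by ring.
by rewrite -E /m; field; rewrite !gt_eqF.
Qed.

(** Success of the computation certifies a positive radicand, without which the constructed lengths
    need not be 1. *)
Lemma encl_sqrt_gt0 u w d : encl u w d -> obind dual_sqrt d -> 0 < u.
Proof.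
case: d => [d|] //= [ud _ _]; rewrite /dual_sqrt; case er : ball_sqrt => [r|] // _.
by have [] := in_ball_sqrt prec0 ud er.
Qed.

Lemma encl_inv_gt0 u w d : encl u w d -> obind dual_inv d -> 0 < u.
Proof.
case: d => [d|] //= [ud _ _]; rewrite /dual_inv; case er : ball_inv => [r|] // _.
by have [] := in_ball_inv prec0 ud er.
Qed.

Local Notation RA := (real_arith R).
Local Notation DA := dual_arith.

Definition pencl (p q : plane R) (d : option dual * option dual) :=
  encl p.1 q.1 d.1 /\ encl p.2 q.2 d.2.

Lemma encl_asg b u w u' w' (d e : acar DA) : encl u w d -> encl u' w' e ->
  encl (@asg RA b u u') (@asg RA b w w') (asg b d e).
Proof. by case: b => /=; [exact: encl_add|exact: encl_sub]. Qed.

Lemma encl_int z : encl (ZR R z) (ZR R z) (aint DA z).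
Proof. by apply: encl_const; exact: in_ball_int. Qed.

Lemma pencl_foot c s dc ds b p q d : encl c c dc -> encl s s ds -> pencl p q d ->
  pencl (@foot RA c s b p) (@foot RA c s b q) (@foot DA dc ds b d).
Proof.
move=> cc ss [d1 d2]; rewrite /foot; cbv zeta.
set t := asg _ _ _; set t' := asg _ _ _; set t'' := asg _ _ _.
have tt : encl t t' t''.
  apply: encl_asg; first by apply: encl_add; exact: encl_mul.
  apply: encl_sqrt; apply: encl_sub; first exact: encl_int.
  by apply: encl_mul; apply: encl_sub; exact: encl_mul.
by split; apply: encl_mul.
Qed.

Lemma pencl_apex h dh b p q p' q' d d' : encl h h dh -> pencl p q d -> pencl p' q' d' ->
  pencl (@apex RA h b p p') (@apex RA h b q q') (@apex DA dh b d d').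
Proof.
move=> hh [d1 d2] [e1 e2]; split; apply: encl_asg.
- by apply: encl_add => //; apply: encl_half; exact: encl_sub.
- by apply: encl_mul => //; exact: encl_sub.
- by apply: encl_add => //; apply: encl_half; exact: encl_sub.
- by apply: encl_mul => //; exact: encl_sub.
Qed.

Lemma pencl_meet b p q p' q' d d' : pencl p q d -> pencl p' q' d' ->
  pencl (@meet RA b p p') (@meet RA b q q') (@meet DA b d d').
Proof.
move=> [d1 d2] [e1 e2]; rewrite /meet; cbv zeta.
set k := asqrt _; set k' := asqrt _; set k'' := asqrt _.
have kk : encl k k' k''.
  apply: encl_sqrt; apply: encl_sub.
    by apply: encl_inv; apply: encl_add; apply: encl_mul; exact: encl_sub.
  by do 2!apply: encl_half; exact: encl_int.
split; apply: encl_asg.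
- by apply: encl_half; exact: encl_add.
- by apply: encl_mul => //; exact: encl_sub.
- by apply: encl_half; exact: encl_add.
- by apply: encl_mul => //; exact: encl_sub.
Qed.

Definition sencl (st st' : seq (plane R)) (sd : seq (acar DA * acar DA)) :=
  [/\ size st = size sd, size st' = size sd &
    forall k, pencl (@pnth RA st k) (@pnth RA st' k) (@pnth DA sd k)].

Lemma encl_height : encl (height RA) (height RA) (height DA).
Proof. by apply: encl_half; apply: encl_sqrt; exact: encl_int. Qed.

Lemma pencl_eval c s dc ds st st' sd i : encl c c dc -> encl s s ds -> sencl st st' sd ->
  pencl (@eval RA c s (height RA) st i) (@eval RA c s (height RA) st' i)
        (@eval DA dc ds (height DA) sd i).
Proof.
move=> cc ss [_ _ h]; case: i => [[] b p|b p q|b p q] /=.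
- exact: pencl_foot.
- by apply: pencl_foot => //; exact: encl_int.
- by apply: pencl_apex => //; exact: encl_height.
- exact: pencl_meet.
Qed.

Lemma sencl_run c s dc ds st st' sd prog : encl c c dc -> encl s s ds -> sencl st st' sd ->
  sencl (@run RA c s st prog) (@run RA c s st' prog) (@run DA dc ds sd prog).
Proof.
move=> cc ss; elim: prog st st' sd => [|i prog IH] st st' sd //= h.
apply: IH; have he := pencl_eval i cc ss h; case: h => e1 e2 h.
split; rewrite ?size_rcons ?e1 ?e2 // => k.
rewrite /pnth !nth_rcons e1 e2; case: ifP => _; first exact: h.
by case: ifP => _ //; split; exact: encl_int.
Qed.

Lemma omap2_some f (x y : option dual) : omap2 f x y -> isSome x && isSome y.
Proof. by case: x => [?|] //; case: y. Qed.

Lemma asg_some b (x y : acar DA) : isSome (asg b x y) -> isSome (x : option dual) && isSome (y : option dual).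
Proof. by case: b; exact: omap2_some. Qed.

Definition pdef (d : option dual * option dual) := d.1 && d.2.

Lemma foot_def c s b p q dc ds d : encl c c dc -> encl s s ds -> pencl p q d ->
  pdef (@foot DA dc ds b d) -> c ^+ 2 + s ^+ 2 = 1 -> sqd p (@foot RA c s b p) = 1.
Proof.
move=> cc ss [h1 h2] /andP[f1 _] cs; apply: foot_unit => //.
pose r := @asub DA (aint DA 1) (let v := @asub DA (@amul DA ds d.1) (@amul DA dc d.2) in
  @amul DA v v).
have dr : @asqrt DA r.
  have /andP[_ f2] : isSome dc && isSome (@asg DA b (@aadd DA (@amul DA dc d.1) (@amul DA ds d.2)) (@asqrt DA r)).
    exact: omap2_some f1.
  by have /andP[] := asg_some f2.
apply: encl_sqrt_gt0 dr; rewrite -{1}(ZR1 R); apply: encl_sub; first exact: encl_int.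
by apply: encl_mul; apply: encl_sub; apply: encl_mul; eassumption.
Qed.

Lemma meet_def b p q p' q' d d' : pencl p q d -> pencl p' q' d' ->
  pdef (@meet DA b d d') -> sqd p (@meet RA b p p') = 1 /\ sqd p' (@meet RA b p p') = 1.
Proof.
move=> [h1 h2] [h1' h2'] /andP[f1 _].
pose D := let x := @asub DA d'.1 d.1 in let y := @asub DA d'.2 d.2 in
  @aadd DA (@amul DA x x) (@amul DA y y).
pose r := @asub DA (@ainv DA D) (@ahalf DA (@ahalf DA (aint DA 1))).
have dr : @asqrt DA r.
  have /andP[_ f2] := asg_some f1.
  have /andP[] : isSome (@asqrt DA r) && isSome (@asub DA d'.2 d.2) by exact: omap2_some f2.
  by [].
have dD : @ainv DA D by move: dr; rewrite /r; case: (@ainv DA D).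
have eD : encl ((p'.1 - p.1) * (p'.1 - p.1) + (p'.2 - p.2) * (p'.2 - p.2))
  ((q'.1 - q.1) * (q'.1 - q.1) + (q'.2 - q.2) * (q'.2 - q.2)) D.
  by apply: encl_add; apply: encl_mul; exact: encl_sub.
apply: meet_unit; first exact: encl_inv_gt0 eD dD.
apply: (encl_sqrt_gt0 (w := _ - ZR R 1 / 2 / 2)) dr; apply: encl_sub; first exact: (encl_inv eD).
by do 2!apply: encl_half; rewrite -(ZR1 R); exact: encl_int.
Qed.

End DualArith.

(** * The sector and the closing condition *)

Section FixedPoints.
Variable R : realType.

Lemma interval_fixed_point (a b : R) (g : R -> R) : a <= b ->
  (forall x, a <= x <= b -> a <= g x <= b) ->
  (forall x y, a <= x <= b -> a <= y <= b -> `|g x - g y| <= 2^-1 * `|x - y|) ->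
  exists2 x, a <= x <= b & g x = x.
Proof.
move=> ab gab lip; pose U := [set` `[a, b]] : set R^o.
have gU : {homo g : x / U x >-> U x} by move=> x; rewrite /U /= !in_itv /=; exact: gab.
have [] := @banach_fixed_point R R^o U (mkfun_fun gU).
- have q0 : 0 <= 2^-1 :> R by lra.
  exists (NngNum q0); split; first by rewrite /=; lra.
  by move=> [x y] [] /=; rewrite /U /= !in_itv /=; exact: lip.
- exact: interval_closed.
- by exists a; rewrite /U /= in_itv /= lexx.
by move=> x; rewrite /U /= in_itv /= => xab xg; exists x.
Qed.

(* Banach's theorem in the plane, one coordinate at a time. *)
Lemma box_fixed_point (x0 y0 r : R) (G : plane R -> plane R) : 0 <= r ->
  (forall p, `|p.1 - x0| <= r -> `|p.2 - y0| <= r ->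
     `|(G p).1 - x0| <= r /\ `|(G p).2 - y0| <= r) ->
  (forall p q, `|p.1 - x0| <= r -> `|p.2 - y0| <= r -> `|q.1 - x0| <= r -> `|q.2 - y0| <= r ->
     `|(G p).1 - (G q).1| <= 4^-1 * `|p.1 - q.1| + 4^-1 * `|p.2 - q.2| /\
     `|(G p).2 - (G q).2| <= 4^-1 * `|p.1 - q.1| + 4^-1 * `|p.2 - q.2|) ->
  exists p, [/\ `|p.1 - x0| <= r, `|p.2 - y0| <= r & G p = p].
Proof.
move=> r0 box lip.
have itv z c : (c - r <= z <= c + r) = (`|z - c| <= r) by rewrite ler_distl.
(* Solves the second coordinate for fixed [x]; outside the box the value 0 is a dummy. *)
have fixy x : exists y, `|x - x0| <= r -> `|y - y0| <= r /\ (G (x, y)).2 = y.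
  have [xr|xr] := boolP (`|x - x0| <= r); last by exists 0.
  have [|y|y y'|y] := @interval_fixed_point (y0 - r) (y0 + r) (fun y => (G (x, y)).2).
  - by lra.
  - by rewrite !itv => yr; have [] := box (x, y) xr yr.
  - rewrite !itv => yr yr'; have [_ /=] := lip (x, y) (x, y') xr yr xr yr'.
    by rewrite subrr normr0; have := normr_ge0 (y - y'); lra.
  - by rewrite itv => yr e; exists y.
have [Y YP] := choice fixy.
(* From [L <= 1/4 + L/4]. The remaining map in [x] then has the constant [1/4 + 1/12], which is
   below [1/2]. *)
have Ylip x x' : `|x - x0| <= r -> `|x' - x0| <= r -> `|Y x - Y x'| <= 3^-1 * `|x - x'|.
  move=> xr xr'; have [yr ye] := YP _ xr; have [yr' ye'] := YP _ xr'.
  have [_] := lip (x, Y x) (x', Y x') xr yr xr' yr'.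
  by rewrite ye ye' /=; lra.
have [|x|x x'|x] := @interval_fixed_point (x0 - r) (x0 + r) (fun x => (G (x, Y x)).1).
- by lra.
- by rewrite !itv => xr; have [yr _] := YP _ xr; have [] := box (x, Y x) xr yr.
- rewrite !itv => xr xr'; have [yr _] := YP _ xr; have [yr' _] := YP _ xr'.
  have [/= h _] := lip (x, Y x) (x', Y x') xr yr xr' yr'.
  by have := Ylip _ _ xr xr'; have := normr_ge0 (x - x'); lra.
rewrite itv => xr ex; have [yr ey] := YP _ xr; exists (x, Y x); split=> //.
by rewrite [G _]surjective_pairing ey ex.
Qed.

End FixedPoints.

(** * Enclosing the root of unity and its powers *)

Section ComplexBalls.
Variable prec : Z.
Local Notation cball := ((Z * Z) * (Z * Z))%type.

Definition cball_mul (z w : cball) : cball :=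
  (ball_sub (ball_mul prec z.1 w.1) (ball_mul prec z.2 w.2),
   ball_add (ball_mul prec z.1 w.2) (ball_mul prec z.2 w.1)).

Fixpoint cball_square k (z : cball) :=
  if k is k'.+1 then cball_square k' (cball_mul z z) else z.

Definition ball_gt0 (b : Z * Z) := Z.ltb b.2 b.1.
Definition ball_lt0 (b : Z * Z) := Z.ltb b.2 (- b.1).

Fixpoint cball_im_gt0 n (z w : cball) :=
  if n is n'.+1 then ball_gt0 w.2 && cball_im_gt0 n' z (cball_mul z w) else true.

Variable R : realType.
Hypothesis prec0 : (0 <= prec)%coqZ.
Implicit Types z w : plane R.

Definition in_cball z (b : cball) := in_ball prec z.1 b.1 /\ in_ball prec z.2 b.2.

Lemma in_cball_mul z w b d : in_cball z b -> in_cball w d -> in_cball (cmul z w) (cball_mul b d).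
Proof.
move=> [z1 z2] [w1 w2]; split; first by apply: in_ball_sub; exact: in_ball_mul.
by apply: in_ball_add; exact: in_ball_mul.
Qed.

Lemma cpow_mul z m n : cpow (cpow z m) n = cpow z (m * n).
Proof. by elim: n => [|n IH]; rewrite ?muln0 // mulnS cpowD /= IH. Qed.

Lemma in_cball_square k z b : in_cball z b -> in_cball (cpow z (2 ^ k)) (cball_square k b).
Proof.
elim: k z b => [|k IH] z b zb /=.
  by rewrite /= cmulC cmul1.
by rewrite expnS -cpow_mul; apply: IH; rewrite /= (cmulC z (1, 0)) cmul1; exact: in_cball_mul.
Qed.

Lemma in_ball_interval (x : R) m r :
  ZR R (m - r)%coqZ / ZR R (one prec) <= x <= ZR R (m + r)%coqZ / ZR R (one prec) ->
  in_ball prec x (m, r).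
Proof.
have K0 := K_gt0 R prec0.
rewrite /in_ball ler_pdivrMr // ler_pdivlMr // ZRB ZRD ler_norml /= => /andP[h1 h2].
by apply/andP; split; lra.
Qed.

Lemma ball_gt0P (x : R) b : in_ball prec x b -> ball_gt0 b -> 0 < x.
Proof. by move=> xb /Z.ltb_lt; exact: in_ball_bounds xb. Qed.

Lemma ball_lt0P (x : R) b : in_ball prec x b -> ball_lt0 b -> x < 0.
Proof.
rewrite -oppr_gt0 => /(in_ball_opp prec0) xb /Z.ltb_lt h; apply: in_ball_bounds xb _ => //=.
by move: h; case: (b) => m r /=; rewrite Z.shiftl_0_l; lia.
Qed.

Lemma cball_im_gt0P n z b w d : in_cball z b -> in_cball w d -> cball_im_gt0 n b d ->
  forall j, (j < n)%N -> 0 < (cmul (cpow z j) w).2.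
Proof.
elim: n w d => [|n IH] w d zb wd // /andP[dp h] [|j] jn.
  by rewrite [cmul _ _]cmul1; apply: ball_gt0P dp; case: wd.
have -> : cmul (cpow z j.+1) w = cmul (cpow z j) (cmul z w).
  by rewrite [cpow _ _](cmulC z) -cmulA.
apply: IH h _ jn => //; exact: in_cball_mul.
Qed.

End ComplexBalls.

Section PowerContinuity.
Variable R : realType.

Lemma continuous_cpow (x y : R -> R) n : continuous x -> continuous y ->
  continuous (fun t => (cpow (x t, y t) n).1) /\ continuous (fun t => (cpow (x t, y t) n).2).
Proof.
move=> cx cy; elim: n => [|n [IH1 IH2]] /=; first by split=> t; exact: cvg_cst.
split=> t.
- by apply: cvgB; apply: cvgM; [exact: cx|exact: IH1|exact: cy|exact: IH2].
- by apply: cvgD; apply: cvgM; [exact: cx|exact: IH2|exact: cy|exact: IH1].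
Qed.

(** The right half of the circle, parametrised by the ordinate: a root of unity is then found by the
    intermediate value theorem, without trigonometric functions. *)
Definition circle_point (t : R) : plane R := (Num.sqrt (1 - t ^+ 2), t).

Lemma continuous_circle n : continuous (fun t => (cpow (circle_point t) n).1).
Proof.
have [] // := @continuous_cpow (fun t => Num.sqrt (1 - t ^+ 2)) id n.
  move=> t; apply: continuous_comp; last exact: sqrt_continuous.
  apply: cvgB; first exact: cvg_cst.
  by rewrite expr2; apply: cvgM; exact: cvg_id.
by move=> t; exact: cvg_id.
Qed.

End PowerContinuity.

Definition zprec := 160%coqZ.

(* An approximation of sin (pi / 290), and an error bound for it. *)
Definition root_mid := 15832251732190040519234814364941372717306174011%coqZ.
Definition root_rad := 256%coqZ.

(** The default value is ruled out by [circle_ball_def]. *)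
Definition circle_ball (t : Z * Z) : (Z * Z) * (Z * Z) :=
  (odflt (0, 0)%coqZ (ball_sqrt zprec (ball_sub (ball_int zprec 1) (ball_mul zprec t t))), t).

Definition circle_ball_def (t : Z * Z) : bool :=
  isSome (ball_sqrt zprec (ball_sub (ball_int zprec 1) (ball_mul zprec t t))).

(** Repeated squaring for [145 = 128 + 16 + 1]. *)
Definition pow145 z := let z16 := cball_square zprec 4 z in
  cball_mul zprec (cball_square zprec 3 z16) (cball_mul zprec z16 z).

Definition root_ball := circle_ball (root_mid, root_rad).
Definition zeta_ball := cball_mul zprec root_ball root_ball.
Definition coarse_ball k (z : (Z * Z) * (Z * Z)) := (ball_shift k z.1, ball_shift k z.2).

(** On the circle the real part of the power 145 is the cosine of 145 times the angle, which changes
    sign at the angle [pi / 290]. *)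
Lemma root_check : [&& circle_ball_def (root_mid, root_rad),
  circle_ball_def (root_mid - root_rad, 0)%coqZ, circle_ball_def (root_mid + root_rad, 0)%coqZ,
  ball_gt0 (pow145 (circle_ball (root_mid - root_rad, 0)%coqZ)).1 &
  ball_lt0 (pow145 (circle_ball (root_mid + root_rad, 0)%coqZ)).1].
Proof. by vm_compute. Qed.

Lemma zeta_im_check :
  cball_im_gt0 40 144 (coarse_ball 120 zeta_ball) (coarse_ball 120 zeta_ball).
Proof. by vm_compute. Qed.

Lemma zprec0 : (0 <= zprec)%coqZ. Proof. by []. Qed.

Section Zeta.
Variable R : realType.
Hint Resolve zprec0 : core.

(** A purely imaginary [n]-th power of norm 1 squares to [-1]. Passing to a square root of [zeta]
    thus replaces [zeta ^ 145 = -1], where the real part is extremal, by a sign change of one real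
    function. *)
Lemma cpow_square_minus1 (z : plane R) n : norm2 z = 1 -> (cpow z n).1 = 0 ->
  cpow (cmul z z) n = (-1, 0).
Proof.
move=> z1 zn; have z2 : cmul z z = cpow z 2 by rewrite (cpowD z 1 1) [cpow z 1]cmulC cmul1.
rewrite z2 cpow_mul mul2n -addnn cpowD.
have := norm2X n z1; rewrite /norm2 /cmul zn mul0r sub0r mulr0 addr0 expr0n add0r expr2 => ->.
by rewrite mul0r.
Qed.

Lemma in_circle_ball (t : R) b : in_ball zprec t b -> circle_ball_def b ->
  in_cball zprec (circle_point t) (circle_ball b) /\ norm2 (circle_point t) = 1.
Proof.
move=> tb; rewrite /circle_ball_def /circle_ball.
case e : ball_sqrt => [d|] // _.
have h : in_ball zprec (1 - t ^+ 2) (ball_sub (ball_int zprec 1) (ball_mul zprec b b)).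
  rewrite -(ZR1 R) expr2; apply: in_ball_sub; first exact: in_ball_int.
  exact: in_ball_mul.
have [hs s0] := in_ball_sqrt zprec0 h e; split; first by split.
by rewrite /norm2 /= sqr_sqrtr ?(ltW s0) // subrK.
Qed.

Lemma in_pow145 (z : plane R) b : in_cball zprec z b -> in_cball zprec (cpow z 145) (pow145 b).
Proof.
move=> zb; have -> : cpow z 145 = cmul (cpow (cpow z (2 ^ 4)) (2 ^ 3)) (cmul (cpow z (2 ^ 4)) z).
  rewrite cpow_mul (_ : 145 = 2 ^ 4 * 2 ^ 3 + (2 ^ 4 + 1))%N // !cpowD; congr cmul; congr cmul.
  by rewrite [cpow z 1]cmulC cmul1.
have h4 := in_cball_square zprec0 4 zb.
by apply: in_cball_mul => //; [exact: in_cball_square|exact: in_cball_mul].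
Qed.

Lemma zeta_exists : exists z : plane R, [/\ norm2 z = 1, cpow z 145 = (-1, 0),
  in_cball zprec z zeta_ball & forall j, (0 < j < 145)%N -> 0 < (cpow z j).2].
Proof.
have /and5P[cm cl cr fl fr] := root_check.
pose a : R := ZR R (root_mid - root_rad)%coqZ / ZR R (one zprec).
pose b : R := ZR R (root_mid + root_rad)%coqZ / ZR R (one zprec).
have K0 := K_gt0 R zprec0.
have [ha _] := in_circle_ball (in_ball_exact R zprec0 _ : in_ball zprec a _) cl.
have [hb _] := in_circle_ball (in_ball_exact R zprec0 _ : in_ball zprec b _) cr.
have fa := ball_gt0P zprec0 (proj1 (in_pow145 ha)) fl.
have fb := ball_lt0P zprec0 (proj1 (in_pow145 hb)) fr.
have ab : a <= b.
  by rewrite /a /b ler_pM2r ?invr_gt0; [apply/ler_ZR; vm_compute|exact: K0].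
have [t tab ft] : exists2 t, t \in `[a, b] & (cpow (circle_point t) 145).1 = 0.
  apply: IVT ab _ _; first by apply: continuous_subspaceT; exact: continuous_circle.
  by rewrite ge_min le_max (ltW fb) (ltW fa) orbT.
have tb : in_ball zprec t (root_mid, root_rad).
  by apply: in_ball_interval; move: tab; rewrite in_itv.
have [zb z1] := in_circle_ball tb cm.
have zz := in_cball_mul zprec0 zb zb.
set z := circle_point t in ft zb z1 zz.
exists (cmul z z); split; [|exact: cpow_square_minus1|exact: zz|].
  by rewrite norm2M z1 mulr1.
move=> [|j] /andP[j0 j1]; first by [].
have cz : in_cball 40 (cmul z z) (coarse_ball 120 zeta_ball).
  have h0 : (0 <= 120)%coqZ by [].
  have h1 : (120 <= zprec)%coqZ by [].
  have [zz1 zz2] := zz; split.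
    exact: (in_ball_shift h0 h1 zz1).
  exact: (in_ball_shift h0 h1 zz2).
have h40 : (0 <= 40)%coqZ by [].
have := cball_im_gt0P h40 cz cz zeta_im_check (j1 : (j < 144)%N).
by rewrite (cmulC (cpow _ _)); exact: id.
Qed.

End Zeta.

(** * The Newton map of the closing condition *)

Definition newton_step (A : arith) (k11 k12 k21 k22 : acar A) (st : seq (acar A * acar A)) :=
  let u := asub (pnth st 40).1 (pnth st 35).1 in
  let v := asub (pnth st 40).2 (pnth st 35).2 in
  (asub (pnth st 0).1 (aadd (amul k11 u) (amul k12 v)),
   asub (pnth st 0).2 (aadd (amul k21 u) (amul k22 v))).

(** What a step guarantees exactly. [Apex] gives unit lengths only over a base of length 1; this
    premise is discharged later by collecting unit pairs along the program. *)
Definition step_unit (R : realType) (z : plane R) (st : seq (plane R)) (i : step) (r : plane R) :=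
  let q := @pnth (real_arith R) st in
  match i with
  | Foot m _ p => sqd (q p) r = 1 /\ dist z m r = 0
  | Apex _ p p' => sqd (q p) (q p') = 1 -> sqd (q p) r = 1 /\ sqd (q p') r = 1
  | Meet _ p p' => sqd (q p) r = 1 /\ sqd (q p') r = 1
  end.

Lemma eval_unit (R : realType) prec (z : plane R) dc ds st st' sd i : (0 <= prec)%coqZ ->
  norm2 z = 1 -> encl prec 0 0 z.1 z.1 dc -> encl prec 0 0 z.2 z.2 ds ->
  @sencl prec R 0 0 st st' sd ->
  pdef (@eval (dual_arith prec) dc ds (height _) sd i) ->
  step_unit z st i (@eval (real_arith R) z.1 z.2 (height _) st i).
Proof.
move=> prec0 z1 zc zs [_ _ h]; case: i => [m b p|b p q|b p q] /=.
- case: m => /= d; split.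
  + exact: foot_def zc zs (h p) d z1.
  + by rewrite /dist2 /=; ring.
  + apply: foot_def (h p) d _ => //; try exact: encl_int.
    by rewrite ZR1 ZR0 expr1n expr0n addr0.
  + by rewrite /dist1 /= ZR0 mul0r.
- by move=> _; exact: apex_unit.
- exact: meet_def (h p) (h q).
Qed.

Definition slope_small prec (b : Z * Z) := Z.leb (4 * (Z.abs b.1 + b.2)) (one prec).

Definition contracting prec (o : option dual) :=
  if o is Some d then slope_small prec d.1.2 && slope_small prec d.2 else false.

Definition near_center rad m (o : option dual) :=
  if o is Some d then Z.leb (2 * (Z.abs (d.1.1.1 - m) + d.1.1.2)) rad else false.

Definition ball_le (b c : Z * Z) := Z.leb (Z.abs (b.1 - c.1) + b.2) c.2.

Section Enclosures.
Variables (R : realType) (prec : Z).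
Hypothesis prec0 : (0 <= prec)%coqZ.
Local Notation RA := (real_arith R).
Local Notation DA := (dual_arith prec).
Local Notation K := (ZR R (one prec)).
Local Notation ib := (in_ball prec).

Lemma newton_encl dx dy k11 k12 k21 k22 (d11 d12 d21 d22 : acar DA) st st' sd :
  encl prec dx dy k11 k11 d11 -> encl prec dx dy k12 k12 d12 ->
  encl prec dx dy k21 k21 d21 -> encl prec dx dy k22 k22 d22 ->
  @sencl prec R dx dy st st' sd ->
  pencl prec dx dy (@newton_step RA k11 k12 k21 k22 st) (@newton_step RA k11 k12 k21 k22 st')
    (@newton_step DA d11 d12 d21 d22 sd).
Proof.
move=> h11 h12 h21 h22 [_ _ h]; rewrite /newton_step; cbv zeta.
by split; (apply: encl_sub; first by case: (h 0)); apply: encl_add; apply: encl_mul => //;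
  (apply: encl_sub; [by case: (h 40)|by case: (h 35)]).
Qed.

Lemma dist_scaled (x : R) m : `|x - ZR R m / K| * K = `|x * K - ZR R m|.
Proof.
have K0 := K_gt0 R prec0.
by rewrite -{2}(gtr0_norm K0) -normrM mulrBl divfK ?gt_eqF.
Qed.

Lemma in_ball_dist (x : R) m r : ib x (m, r) <-> `|x - ZR R m / K| <= ZR R r / K.
Proof.
have K0 := K_gt0 R prec0.
by rewrite /in_ball ler_pdivlMr // dist_scaled.
Qed.

Lemma slope_smallP (s : R) b : ib s b -> slope_small prec b -> `|s| <= 4^-1.
Proof.
have K0 := K_gt0 R prec0.
rewrite /in_ball => sb /Z.leb_le /(ler_ZR R); rewrite ZRM ZRD ZR_abs => h.
have h4 : ZR R 4 = 4 by rewrite (ZRD R 2 2) ZR2; lra.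
rewrite h4 in h; rewrite -(ler_pM2r K0) -{1}(gtr0_norm K0) -normrM.
have -> : s * K = (s * K - ZR R b.1) + ZR R b.1 by ring.
by apply: le_trans (ler_normD _ _) _; lra.
Qed.

Lemma contractingP dx dy (u w : R) o : encl prec dx dy u w o -> contracting prec o ->
  `|u - w| <= 4^-1 * `|dx| + 4^-1 * `|dy|.
Proof.
case: o => [d|] // [_ _ [s [t [sd td ->]]]] /andP[ss st].
apply: le_trans (ler_normD _ _) _; rewrite !normrM.
by apply: lerD; rewrite ler_wpM2r //; [exact: slope_smallP ss|exact: slope_smallP st].
Qed.

Lemma near_centerP dx dy (u w : R) rad m o : encl prec dx dy u w o -> near_center rad m o ->
  `|u - ZR R m / K| <= ZR R rad / K / 2.
Proof.
have K0 := K_gt0 R prec0.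
case: o => [d|] // [ub _ _] /Z.leb_le /(ler_ZR R); move: ub; set b := d.1.1; rewrite /in_ball => ub.
rewrite ZRM ZR2 ZRD ZR_abs ZRB => h.
rewrite mulrAC ler_pdivlMr // dist_scaled.
have -> : u * K - ZR R m = (u * K - ZR R b.1) + (ZR R b.1 - ZR R m) by ring.
by apply: le_trans (ler_normD _ _) _; lra.
Qed.

Lemma scaled_det a b c d : (0 < a * d - b * c)%coqZ ->
  ZR R a / K * (ZR R d / K) - ZR R b / K * (ZR R c / K) != 0.
Proof.
have K0 := K_gt0 R prec0; move=> /(ltr_ZR R); rewrite ZR0 ZRB !ZRM => h.
have -> : ZR R a / K * (ZR R d / K) - ZR R b / K * (ZR R c / K) =
    (ZR R a * ZR R d - ZR R b * ZR R c) / K / K by field; rewrite gt_eqF.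
by rewrite gt_eqF // !divr_gt0.
Qed.

Lemma ball_leP (x : R) b c : ib x b -> ball_le b c -> ib x c.
Proof.
rewrite /in_ball => xb /Z.leb_le /(ler_ZR R); rewrite ZRD ZR_abs ZRB => h.
have -> : x * K - ZR R c.1 = (x * K - ZR R b.1) + (ZR R b.1 - ZR R c.1) by ring.
by apply: le_trans (ler_normD _ _) _; lra.
Qed.

End Enclosures.

(* Point 0 is free; step k constructs point k + 1 from earlier points. *)
Definition program : seq step :=
  [:: Foot true true 0; Apex false 1 0; Foot true false 2; Apex false 3 2; Meet true 0 4;
     Apex true 0 5; Apex false 4 5; Foot false false 6; Apex true 8 6; Foot false false 9;
     Apex true 10 9; Foot false false 11; Apex true 12 11; Meet true 13 7; Apex true 13 14;
     Apex true 14 7; Foot true false 16; Apex false 17 16; Foot false false 15; Apex true 19 15;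
     Foot true false 18; Apex false 21 18; Foot true false 22; Apex false 23 22; Foot true false 24;
     Apex false 25 24; Meet false 20 26; Apex true 20 27; Apex true 27 26; Foot false false 28;
     Apex true 30 28; Foot false false 31; Apex true 32 31; Meet true 33 29; Apex true 33 34;
     Apex true 34 29; Foot true true 36; Apex false 37 36; Foot true false 38; Apex false 39 38].

(* Approximations of the points of the configuration, at scale 2 ^ 40. *)
Definition approx : seq (Z * Z) :=
  [:: (147860097454842, 2147385236023); (148141910185987, 3210168094457); (147080606866304, 2922833649521);
     (146007852819828, 3163924037930); (146335439442096, 2114346587465); (147114930030633, 1338898173967);
     (148187684077110, 1097807785558); (146053626710951, 1051563729031); (148126496777913, 0);
     (147206360996746, 601893648272); (146286225215579, 0); (146225037916382, 1097807785558);
     (146163850617186, 0); (145243714836018, 601893648272); (145164624157282, 1698556989572);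
     (144254431183685, 1081730781934); (146169438033822, 2144959154808); (145742443842975, 3158172745616);
     (145078472229300, 2281778133670); (144057493795080, 0); (143219156152172, 711418172454);
     (144377159562592, 3128587653651); (143994457339476, 2097828308296); (143567463148629, 3111041899103);
     (142903491534953, 2234647287157); (142202178868246, 3081456807138); (141819476645130, 2050697461783);
     (142879037226487, 1757001710965); (142143594783200, 939658311759); (142094908954617, 986243206070);
     (141572658642500, 0); (141044358743990, 964274357664); (140516058845480, 0);
     (139945122704780, 939658311759); (141015028858420, 1193088069320); (140260599173477, 1992939099257);
     (141734101812734, 2024869234042); (142049578281432, 3078150021541); (140979672127792, 2824720263980);
     (139899792031595, 3031565127229); (140260599173477, 1992939099257)]%coqZ.

(** An approximate solution at scale [2 ^ 160]; the box around it has radius [2 ^ -80]. *)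
Definition center_x := 196539780996461630034064879682399814265262680330146%coqZ.
Definition center_y := 2854364573457628544651275148255597304741509085731%coqZ.
Definition box_rad := Z.shiftl 1 80.

(* The inverse of the Jacobian matrix of the closing condition, at scale 2 ^ 20. *)
Definition jac11 := Z.shiftl (-9567292) 140.
Definition jac12 := Z.shiftl 68571994 140.
Definition jac21 := Z.shiftl (-108376) 140.
Definition jac22 := Z.shiftl 774554 140.

(** The coordinates are the parameters, with quotients 1 and 0. A box of radius 0 is a single point,
    and its quotients are set to 0. *)
Definition start_box (r : Z) : option dual * option dual :=
  let a := if Z.eqb r 0 then 0%coqZ else 1%coqZ in
  (Some ((center_x, r), ball_int zprec a, ball_int zprec 0),
   Some ((center_y, r), ball_int zprec 0, ball_int zprec a)).

Local Notation DA := (dual_arith zprec).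
Local Notation dconst b := (Some (dual_const zprec b)).

Definition run_box r := @run DA (dconst zeta_ball.1) (dconst zeta_ball.2) [:: start_box r] program.

Definition newton_box (st : seq (acar DA * acar DA)) := @newton_step DA (dconst (jac11, 0%coqZ))
  (dconst (jac12, 0%coqZ)) (dconst (jac21, 0%coqZ)) (dconst (jac22, 0%coqZ)) st.

(** At scale [2 ^ 40], about [10 ^ -9]: the tolerance of all later geometric checks. *)
Definition approx_rad := 1000%coqZ.

Definition approximates (d : option dual * option dual) (p : Z * Z) :=
  match d with
  | (Some x, Some y) => ball_le (ball_shift 120 x.1.1) (p.1, approx_rad) &&
                        ball_le (ball_shift 120 y.1.1) (p.2, approx_rad)
  | _ => false
  end.

Lemma box_check : let st := run_box box_rad in let g := newton_box st in
  [&& contracting zprec g.1, contracting zprec g.2 & all2 approximates st approx].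
Proof. by vm_compute. Qed.

Lemma center_check : let g := newton_box (run_box 0) in
  near_center box_rad center_x g.1 && near_center box_rad center_y g.2.
Proof. by vm_compute. Qed.

(** The box is mapped into itself because a displacement of the centre by at most [r / 2] and two
    contributions [r / 4] add up to [r]. *)
Lemma box_step (R : realType) (u v c dx dy r : R) : `|u - v| <= 4^-1 * dx + 4^-1 * dy ->
  `|v - c| <= r / 2 -> dx <= r -> dy <= r -> `|u - c| <= r.
Proof. by have := ler_distD v u c; lra. Qed.

Lemma subr_fixed (R : realType) (x y : R) : x - y = x -> y = 0.
Proof. by lra. Qed.

Lemma linear_system (R : realType) (a b c d x y : R) : a * d - b * c != 0 ->
  a * x + b * y = 0 -> c * x + d * y = 0 -> x = 0 /\ y = 0.
Proof.
move=> det e1 e2; have x0 : (a * d - b * c) * x = d * (a * x + b * y) - b * (c * x + d * y) by ring.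
have y0 : (a * d - b * c) * y = a * (c * x + d * y) - c * (a * x + b * y) by ring.
move: x0 y0; rewrite e1 e2 !mulr0 subrr => /eqP x0 /eqP y0.
by move: x0 y0; rewrite !mulf_eq0 (negbTE det) => /eqP -> /eqP ->.
Qed.

Lemma all2_nth (S T : Type) (r : S -> T -> bool) x y s t k : all2 r s t -> (k < size s)%N ->
  r (nth x s k) (nth y t k).
Proof.
by elim: s t k => [|a s IH] [|b t] [|k] //= /andP[ab st] ks; [exact: ab|exact: IH].
Qed.

Lemma approximates_def d a : approximates d a -> pdef d.
Proof. by case: d => [[x|] [y|]]. Qed.

Lemma approximatesP (R : realType) (dx dy : R) (p q : plane R) d a :
  pencl zprec dx dy p q d -> approximates d a ->
  in_ball 40 p.1 (a.1, approx_rad) /\ in_ball 40 p.2 (a.2, approx_rad).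
Proof.
have h0 : (0 <= 120)%coqZ by [].
have h1 : (120 <= zprec)%coqZ by [].
case: d => [[x|] [y|]] // [[p1 _ _] [p2 _ _]] /andP[ax ay]; split.
  exact: ball_leP (in_ball_shift h0 h1 p1) ax.
exact: ball_leP (in_ball_shift h0 h1 p2) ay.
Qed.

Section Configuration.
Variables (R : realType) (z : plane R).
Hypothesis z1 : norm2 z = 1.
Hypothesis zb : in_cball zprec z zeta_ball.

Local Notation RA := (real_arith R).
Local Notation DA := (dual_arith zprec).
Local Notation K := (ZR R (one zprec)).
Local Notation kk m := (ZR R m / K).

Definition run_real (p : plane R) : seq (plane R) := @run RA z.1 z.2 [:: p] program.

Definition newton_real (p : plane R) : plane R :=
  @newton_step RA (kk jac11) (kk jac12) (kk jac21) (kk jac22) (run_real p).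

Lemma run_encl dx dy (p q : plane R) r : pencl zprec dx dy p q (start_box r) ->
  sencl dx dy (run_real p) (run_real q) (run_box r).
Proof.
move=> h; case: zb => zb1 zb2; apply: (sencl_run zprec0).
- exact: (encl_const zprec0 dx dy zb1).
- exact: (encl_const zprec0 dx dy zb2).
split; [reflexivity|reflexivity|] => -[|k]; first exact: h.
by rewrite /pnth !nth_default //; split; exact: (encl_int zprec0).
Qed.

Lemma newton_real_encl dx dy (p q : plane R) r : pencl zprec dx dy p q (start_box r) ->
  pencl zprec dx dy (newton_real p) (newton_real q) (newton_box (run_box r)).
Proof.
move=> /run_encl h; have hk m : encl zprec dx dy (kk m) (kk m) (Some (dual_const zprec (m, 0%coqZ))).
  exact: (encl_const zprec0 dx dy (in_ball_exact R zprec0 m)).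
exact: (newton_encl zprec0 (hk jac11) (hk jac12) (hk jac21) (hk jac22) h).
Qed.

Definition in_box (p : plane R) :=
  `|p.1 - kk center_x| <= kk box_rad /\ `|p.2 - kk center_y| <= kk box_rad.

Lemma start_encl (p q : plane R) : in_box p -> in_box q ->
  pencl zprec (p.1 - q.1) (p.2 - q.2) p q (start_box box_rad).
Proof.
move=> [/(in_ball_dist zprec0) p1 /(in_ball_dist zprec0) p2].
move=> [/(in_ball_dist zprec0) q1 /(in_ball_dist zprec0) q2].
have h0 := in_ball_int R zprec0 0; have h1 := in_ball_int R zprec0 1.
split.
- split; [exact: p1|exact: q1|exists (ZR R 1), (ZR R 0); split; [exact: h1|exact: h0|]].
  by rewrite ZR1 ZR0; ring.
- split; [exact: p2|exact: q2|exists (ZR R 0), (ZR R 1); split; [exact: h0|exact: h1|]].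
  by rewrite ZR1 ZR0; ring.
Qed.

Lemma center_encl : let p : plane R := (kk center_x, kk center_y) in
  pencl zprec 0 0 p p (start_box 0).
Proof.
have hk m := encl_const zprec0 0 0 (in_ball_exact R zprec0 m).
by split; [exact: (hk center_x)|exact: (hk center_y)].
Qed.

(** The matrix only approximates an inverse Jacobian, but being invertible it makes every fixed
    point an exact solution of the closing condition. *)
Lemma jac_det : kk jac11 * kk jac22 - kk jac12 * kk jac21 != 0.
Proof. by apply: (scaled_det R zprec0); vm_compute. Qed.

Lemma box_rad_ge0 : 0 <= kk box_rad.
Proof.
have K0 := K_gt0 R zprec0.
by rewrite divr_ge0 ?(ltW K0) // -(ZR0 R); apply/ler_ZR; vm_compute.
Qed.

Lemma closing_point : exists2 p, in_box p &
  @pnth RA (run_real p) 40 = @pnth RA (run_real p) 35.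
Proof.
have r0 := box_rad_ge0.
pose p0 : plane R := (kk center_x, kk center_y).
have box0 : in_box p0 by rewrite /in_box /p0 !subrr normr0.
have /and3P[c1 c2 _] := box_check; have /andP[n1 n2] := center_check.
have lip p q : in_box p -> in_box q ->
    `|(newton_real p).1 - (newton_real q).1| <= 4^-1 * `|p.1 - q.1| + 4^-1 * `|p.2 - q.2| /\
    `|(newton_real p).2 - (newton_real q).2| <= 4^-1 * `|p.1 - q.1| + 4^-1 * `|p.2 - q.2|.
  move=> pb qb; have [e1 e2] := newton_real_encl (start_encl pb qb).
  by split; [exact: (contractingP zprec0 e1 c1)|exact: (contractingP zprec0 e2 c2)].
have [m1 m2] := newton_real_encl center_encl.
have h1 := near_centerP zprec0 m1 n1; have h2 := near_centerP zprec0 m2 n2.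
have [p [p1 p2 gp]] : exists p, [/\ `|p.1 - kk center_x| <= kk box_rad,
    `|p.2 - kk center_y| <= kk box_rad & newton_real p = p].
  apply: (box_fixed_point r0) => [p p1 p2|p q p1 p2 q1 q2]; last first.
    exact: lip (conj p1 p2) (conj q1 q2).
  have [l1 l2] := lip p p0 (conj p1 p2) box0.
  by split; [exact: box_step l1 h1 p1 p2|exact: box_step l2 h2 p1 p2].
exists p; first exact: conj p1 p2.
clear c1 c2 n1 n2 m1 m2 h1 h2 lip box0 p1 p2.
have := jac_det; move: gp; rewrite /newton_real /newton_step.
have -> : @pnth RA (run_real p) 0 = p.
  exact: (@run_prefix RA z.1 z.2 [:: p] program 0 isT).
move: (@pnth RA _ 40) (@pnth RA _ 35) => a b.
move: (kk jac11) (kk jac12) (kk jac21) (kk jac22) => k11 k12 k21 k22 /=.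
case: a b p => [a1 a2] [b1 b2] [x y] /= [e1 e2] det.
have [] := linear_system det (subr_fixed e1) (subr_fixed e2).
move=> /subr0_eq ab1 /subr0_eq ab2; congr pair; [exact: ab1|exact: ab2].
Qed.

Lemma program_closed k : (k < 40)%N -> closed_step (1 + k) (nth (Foot true true 0) program k).
Proof.
have h : all (fun k => closed_step k.+1 (nth (Foot true true 0) program k)) (iota 0 40).
  by vm_compute.
by move=> k40; apply: (allP h); rewrite mem_iota.
Qed.

Lemma run_box_nth r k : (k < 40)%N -> @pnth DA (run_box r) k.+1 =
  @eval DA (Some (dual_const zprec zeta_ball.1)) (Some (dual_const zprec zeta_ball.2)) (height DA)
    (run_box r) (nth (Foot true true 0) program k).
Proof.
by move=> k40; exact: (@run_nth DA _ _ [:: start_box r] program k _ k40 (program_closed k40)).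
Qed.

Lemma run_real_nth p k : (k < 40)%N -> @pnth RA (run_real p) k.+1 =
  @eval RA z.1 z.2 (height RA) (run_real p) (nth (Foot true true 0) program k).
Proof.
by move=> k40; exact: (@run_nth RA _ _ [:: p] program k _ k40 (program_closed k40)).
Qed.

Lemma run_box_approx k : (k < 41)%N ->
  approximates (@pnth DA (run_box box_rad) k) (nth (0, 0)%coqZ approx k).
Proof.
have /and3P[_ _ ap] := box_check.
have sz : size (run_box box_rad) = 41 by rewrite size_run.
by move=> k41; rewrite /pnth; apply: (all2_nth _ _ ap); rewrite sz; exact: k41.
Qed.

Lemma configuration_exists : exists st : seq (plane R),
  let q := @pnth RA st in
  [/\ q 40 = q 35,
      forall k, (k < 40)%N -> step_unit z st (nth (Foot true true 0) program k) (q k.+1)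
    & forall k, (k < 41)%N -> in_ball 40 (q k).1 ((nth (0, 0)%coqZ approx k).1, approx_rad) /\
                     in_ball 40 (q k).2 ((nth (0, 0)%coqZ approx k).2, approx_rad)].
Proof.
have [p pb e] := closing_point; exists (run_real p).
(* The solution is compared with itself, so [dx] and [dy] are 0 and only the values matter. *)
have se := run_encl (start_encl pb pb); move: se; rewrite !subrr => se.
split; first exact: e.
  move=> k k40; have := approximates_def (run_box_approx (k40 : (k.+1 < 41)%N)).
  rewrite run_box_nth // run_real_nth //.
  case: zb => zb1 zb2; move: (run_box box_rad) (run_real p) se => sd st se.
  exact: (eval_unit zprec0 z1 (encl_const zprec0 0 0 zb1) (encl_const zprec0 0 0 zb2) se).
move=> k k41; have := run_box_approx k41; case: se => _ _ /(_ k).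
by move: (run_box box_rad) => sd h1 h2; exact: approximatesP h1 h2.
Qed.

End Configuration.

(** * The triangles of a sector *)

Section ConvexCombinations.
Variable R : realType.
Implicit Types (P Q : 'I_3 -> plane R) (x : plane R) (w v : 'I_3 -> R).

Definition lin (al be : R) x := al * x.1 + be * x.2.

(** The point enters only through linear functionals, which turns separation arguments into
    computations with sums. *)
Definition convex3 w P x := [/\ forall k, 0 <= w k, \sum_k w k = 1 &
  forall al be, lin al be x = \sum_k w k * lin al be (P k)].

Lemma solid_convex (T : finType) (P : T -> 'I_3 -> plane R) a x :
  solid P a x -> exists w, convex3 w (P a) x.
Proof.
move=> [u [v [w [u0 v0 w0 uvw ->]]]].
exists (fun k : 'I_3 => if val k == 0%N then u else if val k == 1%N then v else w).
split=> [k||al be]; first by case: ifP => // _; case: ifP.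
  by rewrite !big_ord_recl big_ord0 /= addr0 addrA.
rewrite !big_ord_recl big_ord0 /= addr0.
have -> : ord0 = @Ordinal 3 0 isT by exact: val_inj.
have -> : lift (@Ordinal 3 0 isT) ord0 = @Ordinal 3 1 isT by exact: val_inj.
have -> : lift (@Ordinal 3 0 isT) (lift ord0 ord0) = @Ordinal 3 2 isT by exact: val_inj.
by rewrite /lin !scale_planeE /=; ring.
Qed.

Lemma convex_vertex w P x k : convex3 w P x -> (forall l, l != k -> w l = 0) -> x = P k.
Proof.
move=> [_ w1 wx] w0; have wk : w k = 1 by rewrite -w1 (bigD1 k) //= big1 ?addr0.
have E al be : lin al be x = lin al be (P k).
  rewrite wx (bigD1 k) //= wk mul1r big1 ?addr0 // => l /w0 ->; exact: mul0r.
move: (E 1 0) (E 0 1); rewrite /lin !mul1r !mul0r !addr0 !add0r.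
by case: (x) (P k) => [? ?] [? ?] /= -> ->.
Qed.

(** In a vanishing sum of nonnegative terms, corners off the line have weight 0. This serves for
    mirrors, which are supporting lines of the triangles they touch. *)
Lemma line_meet w P x (e : pred 'I_3) al be : convex3 w P x ->
  (forall k, if e k then lin al be (P k) = 0 else 0 < lin al be (P k)) ->
  (forall k l, e k -> e l -> k = l) -> lin al be x = 0 -> exists k, x = P k /\ e k.
Proof.
move=> c pos uniq; have [w0 w1 wx] := c; rewrite wx => s0.
have z k : w k * lin al be (P k) = 0.
  apply: (psumr_eq0P (P := xpredT) (F := fun k => w k * lin al be (P k))) => // l _.
  by apply: mulr_ge0 => //; have := pos l; case: (e l) => [->//|/ltW].
have ne k : ~~ e k -> w k = 0.
  move=> ek; have := pos k; rewrite (negbTE ek) => p.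
  by apply/eqP; have /eqP := z k; rewrite mulf_eq0 (gt_eqF p) orbF.
have [k ek|none] := pickP e.
  exists k; split=> //; apply: (convex_vertex c) => l lk; apply: ne.
  by apply: contra lk => el; apply/eqP; exact: uniq.
have : \sum_k w k = 0 by rewrite big1 // => k _; apply: ne; rewrite none.
by rewrite w1 => /eqP; rewrite oner_eq0.
Qed.

(** Separation that tolerates a shared corner. The sum of [w k * v l * (lin (P k) - lin (Q l))] over
    all pairs is [lin x - lin x = 0] with nonnegative terms, so [w k * v l] vanishes except on
    identified pairs. *)
Lemma separated_meet w v P Q x (e : 'I_3 -> 'I_3 -> bool) al be :
  convex3 w P x -> convex3 v Q x ->
  (forall k l, if e k l then P k = Q l else lin al be (Q l) < lin al be (P k)) ->
  (forall k k' l, e k l -> e k' l -> k = k') -> exists k l, x = P k /\ e k l.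
Proof.
move=> cw cv pos uniq; have [w0 w1 wx] := cw; have [v0 v1 vx] := cv.
pose g k l := w k * v l * (lin al be (P k) - lin al be (Q l)).
have s0 : \sum_k \sum_l g k l = 0.
  have -> : \sum_k \sum_l g k l = \sum_k (w k * lin al be (P k) - w k * lin al be x).
    apply: eq_bigr => k _; rewrite (vx al be) -[X in X - _]mulr1 -v1 !mulr_sumr -sumrB.
    by apply: eq_bigr => l _; rewrite /g; ring.
  by rewrite sumrB -wx -mulr_suml w1 mul1r subrr.
have g0 k l : 0 <= g k l.
  rewrite /g; have := pos k l; case: (e k l) => [->|h]; first by rewrite subrr mulr0.
  by rewrite mulr_ge0 ?mulr_ge0 // subr_ge0 ltW.
have z k l : g k l = 0.
  apply: (psumr_eq0P (P := xpredT) (F := fun l => g k l)) => //.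
  apply: (psumr_eq0P (P := xpredT) (F := fun k => \sum_l g k l)) => // k' _.
  by apply: sumr_ge0.
have ne k l : ~~ e k l -> w k * v l = 0.
  move=> ek; have := pos k l; rewrite (negbTE ek) -subr_gt0 => p.
  by apply/eqP; have /eqP := z k l; rewrite /g mulf_eq0 (gt_eqF p) orbF.
(* An identified pair of nonzero weight forces all other [w k'] to vanish. Without one all products
   vanish, although they add up to 1. *)
have [/existsP[k /existsP[l /andP[ek wv]]]|none] :=
  boolP [exists k, exists l, e k l && (w k * v l != 0)].
  exists k, l; split=> //; apply: (convex_vertex cw) => k' k'k.
  have : w k' * v l = 0.
    by apply: ne; apply: contra k'k => ek'; apply/eqP; exact: uniq ek' ek.
  move=> /eqP; rewrite mulf_eq0 => /orP[/eqP //|/eqP vl].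
  by rewrite vl mulr0 eqxx in wv.
have : (\sum_k w k) * (\sum_l v l) = 0.
  rewrite mulr_suml big1 // => k _; rewrite mulr_sumr big1 // => l _.
  have [ek|] := boolP (e k l); last exact: ne.
  apply/eqP/negPn/negP => wv; move/negP: none; apply.
  by apply/existsP; exists k; apply/existsP; exists l; rewrite ek.
by rewrite w1 v1 mulr1 => /eqP; rewrite oner_eq0.
Qed.

End ConvexCombinations.

(* The points 35 and 40 coincide, by the closing condition. *)
Definition triangles : seq (seq nat) :=
  [:: [:: 8; 6; 9]; [:: 10; 9; 11]; [:: 1; 2; 0]; [:: 0; 5; 6]; [:: 3; 4; 2]; [:: 4; 7; 5];
     [:: 12; 11; 13]; [:: 13; 14; 15]; [:: 14; 7; 16]; [:: 17; 18; 16]; [:: 19; 15; 20]; [:: 21; 22; 18];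
     [:: 23; 24; 22]; [:: 25; 26; 24]; [:: 20; 27; 28]; [:: 27; 26; 29]; [:: 30; 28; 31]; [:: 32; 31; 33];
     [:: 33; 34; 35]; [:: 34; 29; 36]; [:: 37; 38; 36]; [:: 39; 40; 38]].

(* The corner k of triangle a lies on a mirror (inl), or it is also the corner l of
   triangle b (inr (b, l)). *)
Definition neighbours : seq (seq (bool + nat * nat)) :=
  [:: [:: inl false; inr (3, 2); inr (1, 1)]; [:: inl false; inr (0, 2); inr (6, 1)];
     [:: inl true; inr (4, 2); inr (3, 0)]; [:: inr (2, 2); inr (5, 2); inr (0, 1)];
     [:: inl true; inr (5, 0); inr (2, 1)]; [:: inr (4, 1); inr (8, 1); inr (3, 1)];
     [:: inl false; inr (1, 2); inr (7, 0)]; [:: inr (6, 2); inr (8, 0); inr (10, 1)];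
     [:: inr (7, 1); inr (5, 1); inr (9, 2)]; [:: inl true; inr (11, 2); inr (8, 2)];
     [:: inl false; inr (7, 2); inr (14, 0)]; [:: inl true; inr (12, 2); inr (9, 1)];
     [:: inl true; inr (13, 2); inr (11, 1)]; [:: inl true; inr (15, 1); inr (12, 1)];
     [:: inr (10, 2); inr (15, 0); inr (16, 1)]; [:: inr (14, 1); inr (13, 1); inr (19, 1)];
     [:: inl false; inr (14, 2); inr (17, 1)]; [:: inl false; inr (16, 2); inr (18, 0)];
     [:: inr (17, 2); inr (19, 0); inr (21, 1)]; [:: inr (18, 1); inr (15, 2); inr (20, 2)];
     [:: inl true; inr (21, 2); inr (19, 2)]; [:: inl true; inr (18, 2); inr (20, 1)]].

Definition tri a k := nth 0%N (nth [::] triangles a) k.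
Definition nbn a k := nth (inl false) (nth [::] neighbours a) k.

(** Cosine and sine of [pi / 145] at scale [2 ^ 40]. *)
Definition zeta_approx : (Z * Z) * (Z * Z) :=
  ((1099253570218, 10)%coqZ, (23820326972, 10)%coqZ).

Definition ball_x i : Z * Z := ((nth (0, 0)%coqZ approx i).1, approx_rad).
Definition ball_y i : Z * Z := ((nth (0, 0)%coqZ approx i).2, approx_rad).
Definition ball_dist b i := if b then
    ball_sub (ball_mul 40 zeta_approx.2 (ball_x i)) (ball_mul 40 zeta_approx.1 (ball_y i))
  else ball_y i.

(** Lying on a mirror is an equation, out of reach of enclosures; it is read off the program
    instead. *)
Definition is_foot b (i : nat) :=
  if i is j.+1 then if nth (Foot true true 0) program j is Foot m _ _ then m == b else false
  else false.

Definition mirror_ok a k b :=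
  if nbn a k == inl b then is_foot b (tri a k) else ball_gt0 (ball_dist b (tri a k)).

Definition identified i j := [|| i == j, (i == 35) && (j == 40) | (i == 40) && (j == 35)]%N.

Definition inner_ok a k := if nbn a k is inr (b, l) then
    [&& b < 22, l < 3, b != a & identified (tri a k) (tri b l)]%N else true.

Definition key (x : bool + nat * nat) : bool + nat := match x with inl b => inl b | inr y => inr y.1 end.

Definition key_ok a k := all (fun l => (key (nbn a k) == key (nbn a l)) ==> (k == l)) (iota 0 3).

Definition cycle_ok a k := if nbn a k is inr (b, _) then
    all (fun l => if nbn b l is inr (c, _) then
      all (fun m => if nbn c m is inr (d, _) then d != a else true) (iota 0 3) else true) (iota 0 3)
  else true.

Definition ball_neq0 b := ball_gt0 b || ball_lt0 b.

(** For a corner shared inside the sector, one coordinate of the midpoint equation fails visibly; on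
    a mirror, one of the two equations of [mirror_straight] does. *)
Definition bend_ok a k := match nbn a k with
  | inr (b, l) => all (fun k1 => (k1 == k) || all (fun l1 => (l1 == l) ||
      let f g := ball_sub (ball_add (g (tri a k1)) (g (tri b l1))) (ball_add (g (tri a k)) (g (tri a k))) in
      ball_neq0 (f ball_x) || ball_neq0 (f ball_y)) (iota 0 3)) (iota 0 3)
  | inl b => all (fun k1 => (k1 == k) || all (fun l1 => (l1 == k) ||
      let p := tri a k1 in let q := tri a l1 in let r := tri a k in
      let d := ball_mul 40 zeta_approx.1 (ball_dist b q) in
      ball_neq0 (ball_sub (ball_dist b p) (ball_dist b q)) ||
      ball_neq0 (ball_sub (ball_add (ball_add (ball_dist (~~ b) p) (ball_dist (~~ b) q)) (ball_add d d))
        (ball_add (ball_dist (~~ b) r) (ball_dist (~~ b) r)))) (iota 0 3)) (iota 0 3)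
  end.

Definition all_corners (f : nat -> nat -> bool) := all (fun a => all (f a) (iota 0 3)) (iota 0 22).

Lemma all_iotaP n (f : nat -> bool) (a : 'I_n) : all f (iota 0 n) -> f a.
Proof. by move=> /allP; apply; rewrite mem_iota ltn_ord. Qed.

Lemma all_cornersP f (a : 'I_22) (k : 'I_3) : all_corners f -> f a k.
Proof. by move=> h; apply: (all_iotaP k); exact: (all_iotaP (f := fun a => all (f a) (iota 0 3)) a h). Qed.

Lemma corner_check : all_corners (fun a k =>
  [&& mirror_ok a k false, mirror_ok a k true, inner_ok a k, key_ok a k, cycle_ok a k & bend_ok a k]).
Proof. by vm_compute. Qed.

(** Normals of separating lines: up to sign, these eight suffice for all pairs of triangles. *)
Definition directions : seq (Z * Z) :=
  [:: (954, 301); (358, -934); (-131, -991); (-970, 242); (78, -997); (-719, 695); (-1000, -26); (-270, 1000)]%coqZ.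

(** The threshold is the largest error that the radii of two points allow in the functional [d] of
    their difference. *)
Definition separates a b (d : Z * Z) := all (fun k => all (fun l =>
    Z.ltb (2 * approx_rad * (Z.abs d.1 + Z.abs d.2))
      (d.1 * ((ball_x (tri a k)).1 - (ball_x (tri b l)).1) +
       d.2 * ((ball_y (tri a k)).1 - (ball_y (tri b l)).1)) ||
    (nbn a k == inr (b, l)))
  (iota 0 3)) (iota 0 3).

Definition separable a b := has (fun d => separates a b d || separates a b (- d.1, - d.2)%coqZ) directions.

Lemma separable_check : all (fun a => all (fun b => (b == a) || separable a b) (iota 0 22)) (iota 0 22).
Proof. by vm_compute. Qed.

Definition paired (l : seq (nat * nat)) i j := ((i, j) \in l) || ((j, i) \in l).

(** Collects pairs known to be at distance 1; an [Apex] contributes only if its base has been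
    collected before. *)
Definition add_units (l : seq (nat * nat)) k :=
  match nth (Foot true true 0) program k with
  | Foot _ _ p => (p, k.+1) :: l
  | Apex _ p q => if paired l p q then [:: (p, k.+1), (q, k.+1) & l] else l
  | Meet _ p q => [:: (p, k.+1), (q, k.+1) & l]
  end.

Definition unit_pairs := foldl add_units [::] (iota 0 40).

Lemma unit_check : all (fun a => [&& paired unit_pairs (tri a 0) (tri a 1),
  paired unit_pairs (tri a 1) (tri a 2) & paired unit_pairs (tri a 2) (tri a 0)]) (iota 0 22).
Proof. by vm_compute. Qed.

Lemma zeta_approx_check : let b := coarse_ball 120 zeta_ball in
  ball_le b.1 zeta_approx.1 && ball_le b.2 zeta_approx.2.
Proof. by vm_compute. Qed.

(** * From the checked tables to a configuration in the sector *)

Section Assembly.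
Variables (R : realType) (z : plane R) (st : seq (plane R)).
Local Notation q := (@pnth (real_arith R) st).
Hypothesis zball : in_cball 40 z zeta_approx.
Hypothesis closing : q 40 = q 35.
Hypothesis step_st : forall k, (k < 40)%N ->
  step_unit z st (nth (Foot true true 0) program k) (q k.+1).
Hypothesis approx_st : forall k, (k < 41)%N ->
  in_ball 40 (q k).1 (ball_x k) /\ in_ball 40 (q k).2 (ball_y k).

Definition corner_pt (a : 'I_22) (k : 'I_3) : plane R := q (tri a k).

Definition corner_nb (a : 'I_22) (k : 'I_3) : bool + 'I_22 * 'I_3 :=
  match nbn a k with inl b => inl b | inr y => inr (inord y.1, inord y.2) end.

Lemma corner_checkP (a : 'I_22) (k : 'I_3) : [&& mirror_ok a k false, mirror_ok a k true,
  inner_ok a k, key_ok a k, cycle_ok a k & bend_ok a k].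
Proof. exact: (all_cornersP a k corner_check). Qed.

Lemma tri_lt (a : 'I_22) (k : 'I_3) : (tri a k < 41)%N.
Proof.
have h : all_corners (fun a k => tri a k < 41)%N by [].
exact: (all_cornersP a k h).
Qed.

Lemma corner_nb_inl a k b : corner_nb a k = inl b <-> nbn a k = inl b.
Proof. by rewrite /corner_nb; case: (nbn a k) => [c|[x y]]; split=> // -[->]. Qed.

(** The range checks in [inner_ok] make the conversion by [inord] faithful. *)
Lemma corner_nb_inr (a b : 'I_22) (k l : 'I_3) :
  corner_nb a k = inr (b, l) <-> nbn a k = inr (b : nat, l : nat).
Proof.
have /and5P[_ _ h _ _] := corner_checkP a k; move: h; rewrite /inner_ok /corner_nb.
case: (nbn a k) => [c|[b' l']] //= /and4P[b22 l3 _ _]; split=> [[<- <-]|[-> ->]].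
  by rewrite !inordK.
by rewrite !inord_val.
Qed.

Let prec40 : (0 <= 40)%coqZ. Proof. by []. Qed.

Lemma in_ball_distance b k : (k < 41)%N -> in_ball 40 (dist z b (q k)) (ball_dist b k).
Proof.
move=> /approx_st[hx hy]; case: zball => z1 z2; case: b; last exact: hy.
by apply: in_ball_sub; exact: in_ball_mul.
Qed.

Lemma foot_dist b k : (k < 41)%N -> is_foot b k -> dist z b (q k) = 0.
Proof.
case: k => [|k] // k40; have := step_st k40; rewrite /is_foot.
by case: nth => //= m _ p [_ e] /eqP <-.
Qed.

Lemma mirror_okP (a : 'I_22) (k : 'I_3) b : if nbn a k == inl b then dist z b (corner_pt a k) = 0
  else 0 < dist z b (corner_pt a k).
Proof.
have : mirror_ok a k b by have /and5P[] := corner_checkP a k; case: b.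
rewrite /mirror_ok /corner_pt; case: ifP => _; first by apply: foot_dist; exact: tri_lt.
exact: (ball_gt0P prec40 (in_ball_distance b (tri_lt a k))).
Qed.

Lemma ball_neq0P (x : R) b : in_ball 40 x b -> ball_neq0 b -> x <> 0.
Proof.
move=> xb /orP[/(ball_gt0P prec40 xb)|/(ball_lt0P prec40 xb)] + x0; by rewrite x0 ltxx.
Qed.

Lemma functional_gap (p r : plane R) (m n : Z * Z) (d : Z * Z) (e : Z) :
  (2 * e * (Z.abs d.1 + Z.abs d.2) < d.1 * (m.1 - n.1) + d.2 * (m.2 - n.2))%coqZ ->
  in_ball 40 p.1 (m.1, e) -> in_ball 40 p.2 (m.2, e) ->
  in_ball 40 r.1 (n.1, e) -> in_ball 40 r.2 (n.2, e) ->
  lin (ZR R d.1) (ZR R d.2) r < lin (ZR R d.1) (ZR R d.2) p.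
Proof.
have K0 := K_gt0 R prec40; rewrite /in_ball /lin; move: (ZR R (one 40)) K0 => K K0.
have gap (c u v a b r' : R) : `|u * K - a| <= r' -> `|v * K - b| <= r' ->
    c * (a - b) - 2 * r' * `|c| <= c * ((u - v) * K).
  move=> h1 h2; have -> : c * ((u - v) * K) = c * (a - b) + c * ((u * K - a) - (v * K - b)) by ring.
  rewrite lerD2l lerNl; apply: le_trans (ler_norm _) _; rewrite normrN normrM mulrC.
  by rewrite ler_wpM2r //; apply: le_trans (ler_normB _ _) _; lra.
move=> /(ltr_ZR R); rewrite ZRD !ZRM ZRD !ZRB !ZR_abs ZR2 /= => h hp1 hp2 hr1 hr2.
have g1 := gap (ZR R d.1) _ _ _ _ _ hp1 hr1; have g2 := gap (ZR R d.2) _ _ _ _ _ hp2 hr2.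
rewrite -(ltr_pM2r K0); move: h g1 g2; clear; lra.
Qed.

Lemma pairedP l : (forall p, p \in l -> sqd (q p.1) (q p.2) = 1) ->
  forall i j, paired l i j -> sqd (q i) (q j) = 1.
Proof. by move=> h i j /orP[/h|/h] //=; rewrite sqdC. Qed.

Lemma unit_pairsP p : p \in unit_pairs -> sqd (q p.1) (q p.2) = 1.
Proof.
have h l s : all (fun k => k < 40)%N s -> (forall p, p \in l -> sqd (q p.1) (q p.2) = 1) ->
    forall p, p \in foldl add_units l s -> sqd (q p.1) (q p.2) = 1.
  elim: s l => [|k s IH] l //= /andP[k40 sk] hl; apply: IH => // {}p.
  have := step_st k40; rewrite /add_units; case: nth => [m b i|b i j|b i j] /=.
  - by move=> [e _]; rewrite inE => /orP[/eqP -> //|]; exact: hl.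
  - case: ifP => [ij|_]; last by move=> _; exact: hl.
    move=> /(_ (pairedP hl ij))[e1 e2]; rewrite !inE => /or3P[/eqP -> //|/eqP -> //|]; exact: hl.
  - by move=> [e1 e2]; rewrite !inE => /or3P[/eqP -> //|/eqP -> //|]; exact: hl.
apply: (h [::] (iota 0 40)); first exact: isT.
by move=> ?; rewrite in_nil.
Qed.

Lemma corner_unit a : unit3 (corner_pt a (@Ordinal 3 0 isT)) (corner_pt a (@Ordinal 3 1 isT))
  (corner_pt a (@Ordinal 3 2 isT)).
Proof.
have /and3P[h1 h2 h3] := all_iotaP a unit_check.
by split; apply: pairedP; try eassumption; exact: unit_pairsP.
Qed.

(** The table names at most one mirror per corner, so no corner is at the apex. *)
Lemma corner_sector a k : in_sector z (corner_pt a k).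
Proof.
have h1 := mirror_okP a k false; have h2 := mirror_okP a k true.
move: h1 h2; rewrite /in_sector /dist; case: eqP => [->|_] /=; first by move=> -> h; split=> //; lra.
by case: ifP => _ h1 h2; split; lra.
Qed.

Lemma identified_eq i j : identified i j -> q i = q j.
Proof. by move=> /or3P[/eqP -> //|/andP[/eqP -> /eqP ->]|/andP[/eqP -> /eqP ->]]. Qed.

Lemma corner_inner a k b l : corner_nb a k = inr (b, l) ->
  corner_pt b l = corner_pt a k /\ b <> a.
Proof.
move=> /corner_nb_inr e; have /and5P[_ _ h _ _] := corner_checkP a k.
move: h; rewrite /inner_ok e => /and4P[_ _ ab /identified_eq qe]; split=> [|ba]; first exact: esym qe.
by rewrite ba eqxx in ab.
Qed.

Lemma corner_inj a k l : nb_key (corner_nb a k) = nb_key (corner_nb a l) -> k = l.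
Proof.
have /and5P[_ _ hk h _] := corner_checkP a k; have /and5P[_ _ hl _ _] := corner_checkP a l.
move: h => /(all_iotaP l) h e.
apply/val_inj/eqP; apply: (implyP h); move: e hk hl.
rewrite /nb_key /corner_nb /inner_ok /key.
case: (nbn a k) => [b|[b k']]; case: (nbn a l) => [c|[c l']] //= [e].
  by rewrite e.
move=> /and4P[b22 _ _ _] /and4P[c22 _ _ _].
by move: (congr1 (@nat_of_ord 22) e); rewrite !inordK // => ->.
Qed.

(** The separating direction found by [separable_check] has a gap larger than the errors, except at
    a shared corner, where equality is exact by [corner_inner]. *)
Lemma corner_meet a b x : a <> b -> solid corner_pt a x -> solid corner_pt b x ->
  exists k l, x = corner_pt a k /\ corner_nb a k = inr (b, l).
Proof.
move=> ab /solid_convex[w cw] /solid_convex[v cv].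
have /orP[/eqP/val_inj ba|sep] := all_iotaP b (all_iotaP a separable_check); first by case: ab.
 have [d sd] : exists d, separates a b d.
  by have /hasP[d _ /orP[]] := sep; [exists d|exists (- d.1, - d.2)%coqZ].
pose e (k l : 'I_3) := nbn a k == inr (b : nat, l : nat).
have [k l|k k' l /eqP ek /eqP ek'|k [l [xk /eqP ek]]] :=
  @separated_meet R w v _ _ x e (ZR R d.1) (ZR R d.2) cw cv; last first.
- by exists k, l; split=> //; apply/corner_nb_inr.
- by apply: (@corner_inj a); move/corner_nb_inr: ek => ->; move/corner_nb_inr: ek' => ->.
move: sd => /(all_iotaP k)/(all_iotaP l); rewrite -/(e k l); case: ifP => [/eqP ek _|_].
  by have /corner_inner[-> _] : corner_nb a k = inr (b, l) by apply/corner_nb_inr.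
rewrite orbF => /Z.ltb_lt gap.
have [xi yi] := approx_st (tri_lt a k); have [xj yj] := approx_st (tri_lt b l).
exact: (@functional_gap _ _ (nth (0, 0)%coqZ approx (tri a k)) (nth (0, 0)%coqZ approx (tri b l))
  d approx_rad gap xi yi xj yj).
Qed.

Lemma corner_mirror a b x : solid corner_pt a x -> dist z b x = 0 ->
  exists k, x = corner_pt a k /\ corner_nb a k = inl b.
Proof.
move=> /solid_convex[w cw] xb.
have [al [be dE]] : exists al be, forall p, dist z b p = lin al be p.
  case: b {xb}; first by exists z.2, (- z.1) => p; rewrite /lin /dist /dist2; ring.
  by exists 0, 1 => p; rewrite /lin /dist /dist1; ring.
have [k|k l /eqP ek /eqP el||k [xk /eqP ek]] :=
  @line_meet R w _ x (fun k : 'I_3 => nbn a k == inl b) al be cw.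
- by rewrite -dE; exact: mirror_okP.
- by apply: (@corner_inj a); move/corner_nb_inl: ek => ->; move/corner_nb_inl: el => ->.
- by rewrite -dE.
by exists k; split=> //; apply/corner_nb_inl.
Qed.

Lemma corner_straight a k b l k1 l1 : corner_nb a k = inr (b, l) -> k1 <> k -> l1 <> l ->
  corner_pt a k1 + corner_pt b l1 <> corner_pt a k + corner_pt a k.
Proof.
move=> /corner_nb_inr e kk ll; have /and5P[_ _ _ _ /andP[_ h]] := corner_checkP a k.
move: h; rewrite /bend_ok e => /(all_iotaP k1)/orP[/eqP/val_inj //|/(all_iotaP l1)/orP[/eqP/val_inj //|]].
have [x1 y1] := approx_st (tri_lt a k1); have [x2 y2] := approx_st (tri_lt b l1).
have [x3 y3] := approx_st (tri_lt a k).
move=> /orP[|] /ball_neq0P h eq.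
  apply: (h _ (in_ball_sub (in_ball_add x1 x2) (in_ball_add x3 x3))).
  by apply/eqP; rewrite subr_eq0; apply/eqP; exact: (congr1 fst eq).
apply: (h _ (in_ball_sub (in_ball_add y1 y2) (in_ball_add y3 y3))).
by apply/eqP; rewrite subr_eq0; apply/eqP; exact: (congr1 snd eq).
Qed.

Lemma corner_mirror_straight a k b k1 l1 : corner_nb a k = inl b -> k1 <> k -> l1 <> k ->
  ~ mirror_straight z b (corner_pt a k1) (corner_pt a l1) (corner_pt a k).
Proof.
move=> /corner_nb_inl e kk ll [d1 d2]; have /and5P[_ _ _ _ /andP[_ h]] := corner_checkP a k.
move: h; rewrite /bend_ok e => /(all_iotaP k1)/orP[/eqP/val_inj //|/(all_iotaP l1)/orP[/eqP/val_inj //|]].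
have hp c := in_ball_distance c (tri_lt a k1); have hq c := in_ball_distance c (tri_lt a l1).
have hr c := in_ball_distance c (tri_lt a k).
have hd := in_ball_mul prec40 (proj1 zball) (hq b).
move=> /orP[|] /ball_neq0P h.
  by apply: (h _ (in_ball_sub (hp b) (hq b))); apply/eqP; rewrite subr_eq0; apply/eqP.
apply: (h _ (in_ball_sub (in_ball_add (in_ball_add (hp _) (hq _)) (in_ball_add hd hd))
  (in_ball_add (hr _) (hr _)))).
move: d2; rewrite /corner_pt; lra.
Qed.

Lemma corner_no_3cycle a k b k' l c l' m m' : corner_nb a k = inr (b, k') ->
  corner_nb b l = inr (c, l') -> corner_nb c m <> inr (a, m').
Proof.
move=> /corner_nb_inr e1 /corner_nb_inr e2 /corner_nb_inr e3.
have /and5P[_ _ _ _ /andP[h _]] := corner_checkP a k; move: h; rewrite /cycle_ok e1.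
move=> /(all_iotaP l); rewrite e2 => /(all_iotaP m); rewrite e3.
by rewrite eqxx.
Qed.

End Assembly.

Theorem mainTheorem1 (R : realType) :
  exists (V : set (plane R)) (E T : set (set (plane R))),
    [/\ planar_unit_distance_graph V E,
        four_regular V E,
        consists_of_unit_triangles V E T,
        without_additional_triangles E T
      & T #<= `I_6422].
Proof.
have [z [z1 zN zb zpos]] := zeta_exists R.
have [st [closing units approxs]] := configuration_exists z1 zb.
have zball : in_cball 40 z zeta_approx.
  have h0 : (0 <= 120)%coqZ by [].
  have h1 : (120 <= zprec)%coqZ by [].
  have /andP[c1 c2] := zeta_approx_check; have [zb1 zb2] := zb; split.
    exact: ball_leP (in_ball_shift h0 h1 zb1) c1.
  exact: ball_leP (in_ball_shift h0 h1 zb2) c2.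
have card : #|'I_22| = 22 by rewrite card_ord.
apply: (@folded_complex R 145 z isT z1 zN zpos _ (corner_pt st) corner_nb
  (corner_unit units) (corner_sector zball units approxs) _ (corner_inner closing)
  corner_inj (corner_meet closing approxs) (corner_mirror zball units approxs)
  (corner_straight approxs) (corner_mirror_straight zball approxs) corner_no_3cycle).
- move=> a k b /corner_nb_inl e; have := mirror_okP zball units approxs a k b.
  by rewrite e eqxx.
- by rewrite card.
(* The count is [290 * 22 = 6380]. *)
- by rewrite card.
Qed.
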